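(* Let $\mathcal{C}$ be a non-degenerate braided pivotal fusion category containing $\mathrm{Rep}(A,z)$ as a braided pivotal subcategory, where $A$ is a finite cyclic group with generator $a$ and $z\in A$ satisfies $z^2=1$. Then $$S_{a^{-1},1}\,T_1\,S_{1,a}=\frac{\tau^{-}(\mathcal{C}_1)}{\# A}\; T_{a^{-1}}^{-1}\,S_{a^{-1},a}\,T_a^{-1}.$$
   Context: $\Bbbk$ is an algebraically closed field of characteristic $0$; all categories are fusion categories over $\Bbbk$ (unit object $\mathbf 1$ simple). $c$ denotes the braiding and $a_X\colon X\to X^{**}$ the pivotal structure (an isomorphism of monoidal functors, not assumed spherical). The right quantum trace of $f\in\mathrm{End}(X)$ is the scalar $\mathrm{tr}^R_X(f)=\mathrm{ev}_{X^*}\circ((a_X\circ f)\otimes\mathrm{id}_{X^*})\circ\mathrm{coev}_X$, and the left quantum trace is $\mathrm{tr}^L_X(f)=\mathrm{ev}_X\circ(\mathrm{id}_{X^*}\otimes (f\circ a_X^{-1}))\circ\mathrm{coev}_{X^*}$; $\dim^{R}(X)=\mathrm{tr}^R_X(\mathrm{id}_X)$, $\dim^{L}(X)=\mathrm{tr}^L_X(\mathrm{id}_X)$. The $S$-matrix is $S_{X,Y}=\mathrm{tr}^R_{X\otimes Y}(c_{Y,X}\circ c_{X,Y})$ for $X,Y$ simple. Twist: $\theta$ is defined by $a=u\circ\theta$, where $u_X\colon X\to X^{**}$ is the Drinfeld morphism (composition of $\mathrm{coev}_{X^*}$, $c_{X,X^*}$ and $\mathrm{ev}_X$); it satisfies $\theta_{X\otimes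 Y}=(\theta_X\otimes\theta_Y)\circ c_{Y,X}\circ c_{X,Y}$, and $\theta_X$ is identified with a scalar for $X$ simple. Gauss sums: $\tau^{\pm}(\mathcal{C}_1)=\sum_{X\in\mathrm{Irr}(\mathcal{C}_1)}\theta_X^{\pm1}\dim^L(X)\dim^R(X)$. $\mathrm{Rep}(A,z)$ is the symmetric category of finite-dimensional representations of $A$ in which the simple objects $X_\alpha$ ($\alpha\in\hat A$, the character group) have braiding $c_{X_\alpha,X_\beta}$ equal to the flip, multiplied by $-1$ if $\alpha(z)=\beta(z)=-1$; its pivotal structure is the one with trivial twist, so that $\dim^R(X_\alpha)=\alpha(z)$. Grading: $\mathcal{C}=\bigoplus_{h\in A}\mathcal{C}_h$, where $\mathcal{C}_h$ is the full subcategory of objects $X$ with $c_{X,X_\alpha}\circ c_{X_\alpha,X}=\alpha(h)\,\mathrm{id}_{X_\alpha\otimes X}$ for all $\alpha\in\hat A$. Non-degenerate means the symmetric center of $\mathcal{C}$ is trivial. Involution: since $\mathcal C$ is non-degenerate, for each simple $X$ there is a unique (up to isomorphism) simple $\bar X$ with $S_{X,Y^*}/\dim^R(X)=S_{\bar X,Y}/\dim^R(\bar X)$ for all simple $Y$; $X\mapsto\bar X$ is an involution on $\mathrm{Irr}(\mathcal C)$, which exchanges simple objects of degree $h$ and $h^{-1}$. Sets and matrices: $\hat A$ acts on isomorphism classes of simple objects by $X\mapsto X_\alpha\otimes X$, preserving degrees. $I_h$ is the set of isomorphism classes of simple objects of degree $h$; $I_{1,n}\subset I_1$ is the subset of elements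 with trivial stabilizer; the action on $I_{a^{\pm1}}$ has trivial stabilizers. $[I_{1,n}]$ and $[I_a]$ are chosen sets of representatives of $I_{1,n}$ and $I_a$ for the action of $\hat A$, and $[I_{a^{-1}}]=\{\bar X: X\in[I_a]\}$ (if $\#A=2$, $[I_a]$ is chosen stable under $X\mapsto\bar X$). Put $S_{1,a}=(S_{X,Y})_{X\in[I_{1,n}],Y\in[I_a]}$, $S_{a^{-1},1}=(S_{X,Y})_{X\in[I_{a^{-1}}],Y\in[I_{1,n}]}$, $S_{a^{-1},a}=(S_{X,Y})_{X\in[I_{a^{-1}}],Y\in[I_a]}$, $T_1=\mathrm{diag}(\theta_X^{-1})_{X\in[I_{1,n}]}$, $T_{a^{\pm1}}=\mathrm{diag}(\theta_Y^{-1})_{Y\in[I_{a^{\pm1}}]}$. *)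

(* Defs.v *)
From HB Require Import structures.
From mathcomp Require Import all_boot all_order all_algebra all_fingroup.
From mathcomp Require Import all_solvable mxrepresentation.
From mathcomp Require Import ring mxtens boolp classical_sets.

Set Implicit Arguments.
Unset Strict Implicit.
Unset Printing Implicit Defensive.

Import GRing.Theory.
Local Open Scope ring_scope.

Declare Scope cat_scope.
Delimit Scope cat_scope with cat.
Local Open Scope cat_scope.

Reserved Notation "g ∘ f" (at level 40, left associativity).
Reserved Notation "X ⊗ Y" (at level 35, right associativity).
Reserved Notation "f ⊠ g" (at level 35, right associativity).
Reserved Notation "X ^∨" (at level 2, left associativity, format "X ^∨").

Record lincat (k : fieldType) := LinCat {
  ob :> Type;
  mor : ob -> ob -> vectType k;
  idmor : forall X, mor X X;
  compm : forall X Y Z, mor Y Z -> mor X Y -> mor X Z;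
  comp1m : forall X Y (f : mor X Y), compm (idmor Y) f = f;
  compm1 : forall X Y (f : mor X Y), compm f (idmor X) = f;
  compmA : forall X Y Z W (h : mor Z W) (g : mor Y Z) (f : mor X Y),
    compm h (compm g f) = compm (compm h g) f;
  comp_linearl : forall X Y Z (f : mor X Y),
    linear (fun g : mor Y Z => compm g f);
  comp_linearr : forall X Y Z (g : mor Y Z),
    linear (fun f : mor X Y => compm g f)
}.
Arguments mor {k l} X Y : rename.
Arguments idmor {k l} X : rename.
Arguments compm {k l X Y Z} g f : rename.
Notation "g ∘ f" := (compm g f) : cat_scope.

Section LinearCategories.
Variables (k : fieldType) (C : lincat k).
Implicit Types X Y Z : C.

Definition iso_mor X Y (f : mor X Y) : Prop :=
  exists g : mor Y X, g ∘ f = idmor X /\ f ∘ g = idmor Y.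

Definition isomorphic X Y : Prop := exists f : mor X Y, iso_mor f.

Definition mono_mor X Y (f : mor X Y) : Prop :=
  forall Z (g h : mor Z X), f ∘ g = f ∘ h -> g = h.

Definition epi_mor X Y (f : mor X Y) : Prop :=
  forall Z (g h : mor Y Z), g ∘ f = h ∘ f -> g = h.

Definition is_kernel X Y Z (f : mor X Y) (i : mor Z X) : Prop :=
  f ∘ i = 0 /\
  forall W (g : mor W X), f ∘ g = 0 -> exists! h : mor W Z, i ∘ h = g.

Definition is_cokernel X Y Z (f : mor X Y) (p : mor Y Z) : Prop :=
  p ∘ f = 0 /\
  forall W (g : mor Y W), g ∘ f = 0 -> exists! h : mor Z W, h ∘ p = g.

(* [n = 0] says that [Y] is a zero object. *)
Definition is_dsum n (X : 'I_n -> C) Y : Prop :=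
  exists (i : forall m, mor (X m) Y) (p : forall m, mor Y (X m)),
    [/\ forall m, p m ∘ i m = idmor (X m),
        forall m m', m != m' -> p m' ∘ i m = 0
      & \sum_m i m ∘ p m = idmor Y].

(* A monomorphism into [X] is zero iff its source is a zero object. *)
Definition simple_obj X : Prop :=
  idmor X <> 0 /\
  forall Y (f : mor Y X), mono_mor f -> f = 0 \/ iso_mor f.

Record abelian_cat : Prop := AbelianCat {
  ab_dsum : forall n (X : 'I_n -> C), exists Y, is_dsum X Y;
  ab_ker : forall X Y (f : mor X Y),
    exists Z (i : mor Z X), is_kernel f i;
  ab_coker : forall X Y (f : mor X Y),
    exists Z (p : mor Y Z), is_cokernel f p;
  ab_monic : forall X Y (f : mor X Y), mono_mor f ->
    exists Z (g : mor Y Z), is_kernel g f;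
  ab_epic : forall X Y (f : mor X Y), epi_mor f ->
    exists Z (g : mor Z X), is_cokernel g f
}.

Definition semisimple_cat : Prop :=
  forall X, exists n (S : 'I_n -> C), (forall m, simple_obj (S m)) /\ is_dsum S X.

(* [S] enumerates the isomorphism classes of simple objects, once each. *)
Definition irr_reps (I : finType) (S : I -> C) : Prop :=
  [/\ forall i, simple_obj (S i),
      forall i j, isomorphic (S i) (S j) -> i = j
    & forall X, simple_obj X -> exists i, isomorphic X (S i)].

(* The scalar [c] when [f = c *: idmor X]; used for simple [X], where every  *)
(* endomorphism has this form by Schur's lemma.                              *)
Definition scalar_of X (f : mor X X) : k := coord [tuple idmor X] ord0 f.

Lemma scalar_ofZ X (c : k) : idmor X != 0 -> scalar_of (c *: idmor X) = c.
Proof.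
move=> nz; have fr : free [tuple idmor X] by rewrite seq1_free.
by rewrite /scalar_of linearZ /= (coord_free ord0 ord0 fr) eqxx mulr1.
Qed.

End LinearCategories.

Record moncat (k : fieldType) := MonCat {
  mon_lincat :> lincat k;
  tunit : mon_lincat;
  tens : mon_lincat -> mon_lincat -> mon_lincat;
  tensm : forall X X' Y Y' : mon_lincat,
    mor X X' -> mor Y Y' -> mor (tens X Y) (tens X' Y');
  tensm1 : forall X Y, tensm (idmor X) (idmor Y) = idmor (tens X Y);
  tensm_comp : forall X X' X'' Y Y' Y'' (f' : mor X' X'') (f : mor X X')
      (g' : mor Y' Y'') (g : mor Y Y'),
    tensm (f' ∘ f) (g' ∘ g) = tensm f' g' ∘ tensm f g;
  tensm_linearl : forall X X' Y Y' (g : mor Y Y'),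
    linear (fun f : mor X X' => tensm f g);
  tensm_linearr : forall X X' Y Y' (f : mor X X'),
    linear (fun g : mor Y Y' => tensm f g);
  assoc : forall X Y Z, mor (tens (tens X Y) Z) (tens X (tens Y Z));
  assocV : forall X Y Z, mor (tens X (tens Y Z)) (tens (tens X Y) Z);
  assocVK : forall X Y Z, assocV X Y Z ∘ assoc X Y Z = idmor _;
  assocKV : forall X Y Z, assoc X Y Z ∘ assocV X Y Z = idmor _;
  assoc_nat : forall X X' Y Y' Z Z'
      (f : mor X X') (g : mor Y Y') (h : mor Z Z'),
    assoc X' Y' Z' ∘ tensm (tensm f g) h =
    tensm f (tensm g h) ∘ assoc X Y Z;
  lunit : forall X, mor (tens tunit X) X;
  lunitV : forall X, mor X (tens tunit X);
  lunitVK : forall X, lunitV X ∘ lunit X = idmor _;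
  lunitKV : forall X, lunit X ∘ lunitV X = idmor _;
  lunit_nat : forall X Y (f : mor X Y),
    lunit Y ∘ tensm (idmor tunit) f = f ∘ lunit X;
  runit : forall X, mor (tens X tunit) X;
  runitV : forall X, mor X (tens X tunit);
  runitVK : forall X, runitV X ∘ runit X = idmor _;
  runitKV : forall X, runit X ∘ runitV X = idmor _;
  runit_nat : forall X Y (f : mor X Y),
    runit Y ∘ tensm f (idmor tunit) = f ∘ runit X;
  triangle : forall X Y,
    tensm (idmor X) (lunit Y) ∘ assoc X tunit Y = tensm (runit X) (idmor Y);
  pentagon : forall X Y Z W,
    assoc X Y (tens Z W) ∘ assoc (tens X Y) Z W =
    tensm (idmor X) (assoc Y Z W) ∘ assoc X (tens Y Z) W ∘
      tensm (assoc X Y Z) (idmor W)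
}.
Arguments tunit {k m} : rename.
Arguments tens {k m} X Y : rename.
Arguments tensm {k m X X' Y Y'} f g : rename.
Arguments assoc {k m} X Y Z : rename.
Arguments assocV {k m} X Y Z : rename.
Arguments lunit {k m} X : rename.
Arguments lunitV {k m} X : rename.
Arguments runit {k m} X : rename.
Arguments runitV {k m} X : rename.
Notation "X ⊗ Y" := (tens X Y) : cat_scope.
Notation "f ⊠ g" := (tensm f g) : cat_scope.

(* Only left duals are required: the pivotal structure turns them into right *)
(* duals.                                                                    *)
Record rigidcat (k : fieldType) := RigidCat {
  rig_moncat :> moncat k;
  dual : rig_moncat -> rig_moncat;
  ev : forall X, mor (dual X ⊗ X) tunit;
  coev : forall X, mor tunit (X ⊗ dual X);
  zigzag : forall X,
    runit X ∘ (idmor X ⊠ ev X) ∘ assoc X (dual X) X ∘ (coev X ⊠ idmor X)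
      ∘ lunitV X = idmor X;
  zagzig : forall X,
    lunit (dual X) ∘ (ev X ⊠ idmor (dual X)) ∘ assocV (dual X) X (dual X)
      ∘ (idmor (dual X) ⊠ coev X) ∘ runitV (dual X) = idmor (dual X)
}.
Arguments dual {k r} X : rename.
Arguments ev {k r} X : rename.
Arguments coev {k r} X : rename.
Notation "X ^∨" := (dual X) : cat_scope.

Section Rigid.
Variables (k : fieldType) (C : rigidcat k).
Implicit Types X Y : C.

(* The morphism [Y -> X^∨] corresponding to a pairing [Y ⊗ X -> 1].          *)
Definition mate X Y (e : mor (Y ⊗ X) tunit) : mor Y (X^∨) :=
  lunit (X^∨) ∘ (e ⊠ idmor (X^∨)) ∘ assocV Y X (X^∨) ∘ (idmor Y ⊠ coev X)
    ∘ runitV Y.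

Definition dualm X Y (f : mor X Y) : mor (Y^∨) (X^∨) :=
  mate (ev Y ∘ (idmor (Y^∨) ⊠ f)).

Definition dual_tens X Y : mor (Y^∨ ⊗ X^∨) ((X ⊗ Y)^∨) :=
  mate (ev Y ∘ (idmor (Y^∨) ⊠ (lunit Y ∘ (ev X ⊠ idmor Y) ∘ assocV (X^∨) X Y))
          ∘ assoc (Y^∨) (X^∨) (X ⊗ Y)).

Record fusion : Prop := Fusion {
  fusion_abelian : abelian_cat C;
  fusion_semisimple : semisimple_cat C;
  fusion_finite : exists (I : finType) (S : I -> C), irr_reps S;
  fusion_unit : simple_obj (tunit : C)
}.

End Rigid.

Record braidedcat (k : fieldType) := BraidedCat {
  br_rigidcat :> rigidcat k;
  braid : forall X Y : br_rigidcat, mor (X ⊗ Y) (Y ⊗ X);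
  braidV : forall X Y : br_rigidcat, mor (Y ⊗ X) (X ⊗ Y);
  braidVK : forall X Y, braidV X Y ∘ braid X Y = idmor _;
  braidKV : forall X Y, braid X Y ∘ braidV X Y = idmor _;
  braid_nat : forall X X' Y Y' (f : mor X X') (g : mor Y Y'),
    braid X' Y' ∘ (f ⊠ g) = (g ⊠ f) ∘ braid X Y;
  hexagon : forall X Y Z,
    assoc Y Z X ∘ braid X (Y ⊗ Z) ∘ assoc X Y Z =
    (idmor Y ⊠ braid X Z) ∘ assoc Y X Z ∘ (braid X Y ⊠ idmor Z);
  hexagonV : forall X Y Z,
    assocV Z X Y ∘ braid (X ⊗ Y) Z ∘ assocV X Y Z =
    (braid X Z ⊠ idmor Y) ∘ assocV X Z Y ∘ (idmor X ⊠ braid Y Z)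
}.
Arguments braid {k b} X Y : rename.
Arguments braidV {k b} X Y : rename.

Section Braided.
Variables (k : fieldType) (C : braidedcat k).
Implicit Types X Y : C.

Definition drinfeld X : mor X (X^∨^∨) := mate (ev X ∘ braid X (X^∨)).

Definition transparent X : Prop :=
  forall Y, braid Y X ∘ braid X Y = idmor (X ⊗ Y).

Definition nondegenerate_cat : Prop :=
  forall X, transparent X -> exists n, is_dsum (fun _ : 'I_n => tunit) X.

End Braided.

(* [piv_tens] is monoidality of [a], the monoidal structure of the double    *)
(* dual functor being moved to the other side of the equation.               *)
Record bpcat (k : fieldType) := BPCat {
  bp_braidedcat :> braidedcat k;
  piv : forall X : bp_braidedcat, mor X (X^∨^∨);
  pivV : forall X : bp_braidedcat, mor (X^∨^∨) X;
  pivVK : forall X, pivV X ∘ piv X = idmor _;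
  pivKV : forall X, piv X ∘ pivV X = idmor _;
  piv_nat : forall X Y (f : mor X Y), dualm (dualm f) ∘ piv X = piv Y ∘ f;
  piv_tens : forall X Y,
    dualm (dual_tens X Y) ∘ piv (X ⊗ Y) =
    dual_tens (Y^∨) (X^∨) ∘ (piv X ⊠ piv Y)
}.
Arguments piv {k b} X : rename.
Arguments pivV {k b} X : rename.

Section Traces.
Variables (k : fieldType) (C : bpcat k).
Implicit Types X Y : C.

Definition trR X (f : mor X X) : k :=
  scalar_of (ev (X^∨) ∘ ((piv X ∘ f) ⊠ idmor (X^∨)) ∘ coev X).

Definition trL X (f : mor X X) : k :=
  scalar_of (ev X ∘ (idmor (X^∨) ⊠ (f ∘ pivV X)) ∘ coev (X^∨)).

Definition qdimR X : k := trR (idmor X).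
Definition qdimL X : k := trL (idmor X).

Definition Smat X Y : k := trR (braid Y X ∘ braid X Y).

(* The unique [t] with [piv X = drinfeld X ∘ t].                             *)
Definition twist X : mor X X :=
  xget 0 (fun t : mor X X => piv X = drinfeld X ∘ t).

Definition theta X : k := scalar_of (twist X).

End Traces.

(* [mate (Fmu0V ∘ Fhom (ev V) ∘ Fmu (V^∨) V)] is the canonical morphism      *)
(* from [F (V^∨)] to [(F V)^∨].                                              *)
Record bpfunctor (k : fieldType) (D C : bpcat k) := BPFunctor {
  Fob :> D -> C;
  Fhom : forall V W : D, mor V W -> mor (Fob V) (Fob W);
  Fhom_linear : forall V W, linear (@Fhom V W);
  Fhom1 : forall V, Fhom (idmor V) = idmor (Fob V);
  Fhom_comp : forall U V W (g : mor V W) (f : mor U V),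
    Fhom (g ∘ f) = Fhom g ∘ Fhom f;
  Fmu : forall V W, mor (Fob V ⊗ Fob W) (Fob (V ⊗ W));
  Fmu_iso : forall V W, iso_mor (Fmu V W);
  Fmu_nat : forall V V' W W' (f : mor V V') (g : mor W W'),
    Fmu V' W' ∘ (Fhom f ⊠ Fhom g) = Fhom (f ⊠ g) ∘ Fmu V W;
  Fmu0 : mor tunit (Fob tunit);
  Fmu0V : mor (Fob tunit) tunit;
  Fmu0VK : Fmu0V ∘ Fmu0 = idmor _;
  Fmu0KV : Fmu0 ∘ Fmu0V = idmor _;
  Fmu_assoc : forall U V W,
    Fhom (assoc U V W) ∘ Fmu (U ⊗ V) W ∘ (Fmu U V ⊠ idmor (Fob W)) =
    Fmu U (V ⊗ W) ∘ (idmor (Fob U) ⊠ Fmu V W) ∘ assoc (Fob U) (Fob V) (Fob W);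
  Fmu_lunit : forall V,
    Fhom (lunit V) ∘ Fmu tunit V ∘ (Fmu0 ⊠ idmor (Fob V)) = lunit (Fob V);
  Fmu_runit : forall V,
    Fhom (runit V) ∘ Fmu V tunit ∘ (idmor (Fob V) ⊠ Fmu0) = runit (Fob V);
  Fmu_braid : forall V W,
    Fhom (braid V W) ∘ Fmu V W = Fmu W V ∘ braid (Fob V) (Fob W);
  Fmu_piv : forall V,
    let Fdual V := mate (Fmu0V ∘ Fhom (ev V) ∘ Fmu (V^∨) V) in
    dualm (Fdual V) ∘ piv (Fob V) = Fdual (V^∨) ∘ Fhom (piv V)
}.
Arguments Fhom {k D C} F {V W} f : rename.

Definition fully_faithful (k : fieldType) (D C : bpcat k)
    (F : bpfunctor D C) : Prop :=
  forall V W : D, bijective (fun f : mor V W => Fhom F f).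

Section MapMatrices.
Variable k : fieldType.

Definition map1mx m n (f : 'I_m -> 'I_n) : 'M[k]_(m, n) :=
  \matrix_(i, j) (j == f i)%:R.

Lemma eq_map1mx m n (f g : 'I_m -> 'I_n) : f =1 g -> map1mx f = map1mx g.
Proof. by move=> fg; apply/matrixP=> i j; rewrite !mxE fg. Qed.

Lemma map1mx_id m : map1mx (@id 'I_m) = 1%:M.
Proof. by apply/matrixP=> i j; rewrite !mxE eq_sym. Qed.

Lemma mul_map1mx m n p (f : 'I_m -> 'I_n) (M : 'M[k]_(n, p)) :
  map1mx f *m M = \matrix_(i, j) M (f i) j.
Proof.
apply/matrixP=> i j; rewrite !mxE (bigD1 (f i)) //= mxE eqxx mul1r.
by rewrite big1 ?addr0 // => l /negPf nl; rewrite mxE nl mul0r.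
Qed.

Lemma mul_mx_map1 m n p (f : 'I_n -> 'I_p) g (M : 'M[k]_(m, n)) :
  cancel f g -> cancel g f -> M *m map1mx f = \matrix_(i, j) M i (g j).
Proof.
move=> fK gK; apply/matrixP=> i j; rewrite !mxE (bigD1 (g j)) //= mxE gK eqxx.
rewrite mulr1 big1 ?addr0 // => l nl; rewrite mxE.
case: eqP => [ej|_]; last by rewrite mulr0.
by rewrite ej fK eqxx in nl.
Qed.

Lemma mul_map1mx2 m n p (f : 'I_m -> 'I_n) (g : 'I_n -> 'I_p) :
  map1mx f *m map1mx g = map1mx (g \o f).
Proof. by rewrite mul_map1mx; apply/matrixP=> i j; rewrite !mxE. Qed.

Definition tens_map m m' n n' (f : 'I_m -> 'I_m') (g : 'I_n -> 'I_n')
    (i : 'I_(m * n)) : 'I_(m' * n') :=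
  mxtens_index (f (mxtens_unindex i).1, g (mxtens_unindex i).2).

Lemma tens_mapE m m' n n' (f : 'I_m -> 'I_m') (g : 'I_n -> 'I_n') i j :
  tens_map f g (mxtens_index (i, j)) = mxtens_index (f i, g j).
Proof. by rewrite /tens_map mxtens_indexK. Qed.

Lemma tens_map1mx m m' n n' (f : 'I_m -> 'I_m') (g : 'I_n -> 'I_n') :
  map1mx f *t map1mx g = map1mx (tens_map f g).
Proof.
apply/matrixP=> i j; case: (mxtens_indexP i) => i1 i2.
case: (mxtens_indexP j) => j1 j2.
rewrite tensmxE !mxE /tens_map mxtens_indexK /= -natrM mulnb.
by rewrite (can_eq (@mxtens_indexK _ _)) xpair_eqE.
Qed.

Definition swap_ord m n (i : 'I_(m * n)) : 'I_(n * m) :=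
  mxtens_index ((mxtens_unindex i).2, (mxtens_unindex i).1).

Lemma swap_ordE m n i j :
  @swap_ord m n (mxtens_index (i, j)) = mxtens_index (j, i).
Proof. by rewrite /swap_ord mxtens_indexK. Qed.

Lemma swap_ordK m n : cancel (@swap_ord m n) (@swap_ord n m).
Proof.
by move=> i; case: (mxtens_indexP i) => j l; rewrite /swap_ord !mxtens_indexK.
Qed.

Definition castm m n (e : m = n) : 'M[k]_(m, n) := map1mx (cast_ord e).

Lemma castm_mul m n p (e : m = n) (e' : n = p) :
  castm e *m castm e' = castm (etrans e e').
Proof. by rewrite mul_map1mx2; apply: eq_map1mx => i; apply: val_inj. Qed.

Lemma castm_id m (e : m = m) : castm e = 1%:M.
Proof. by rewrite -map1mx_id; apply: eq_map1mx => i; apply: val_inj. Qed.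

Lemma castm_tens m m' n n' (e : m = m') (e' : n = n') :
  castm e *t castm e' = castm (congr2 muln e e').
Proof.
subst m' n'; rewrite tens_map1mx; apply: eq_map1mx => i.
case: (mxtens_indexP i) => i1 i2; rewrite /tens_map mxtens_indexK /=.
by apply: val_inj.
Qed.

End MapMatrices.

Section TensorIdentities.
Variable k : fieldType.

Lemma sum_mxtens m n (F : 'I_(m * n) -> k) :
  \sum_i F i = \sum_i \sum_j F (mxtens_index (i, j)).
Proof.
rewrite pair_big /= (reindex (@mxtens_index m n)) /=; last first.
  exists (@mxtens_unindex m n) => i _; first exact: mxtens_indexK.
  exact: mxtens_unindexK.
by apply: eq_bigr => -[i j] _.
Qed.

Lemma mxtensP m n p q (M N : 'M[k]_(m * n, p * q)) :
  (forall i j i' j', M (mxtens_index (i, j)) (mxtens_index (i', j')) =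
                     N (mxtens_index (i, j)) (mxtens_index (i', j'))) -> M = N.
Proof.
move=> MN; apply/matrixP => i j; case: (mxtens_indexP i) => i1 i2.
by case: (mxtens_indexP j).
Qed.

Lemma cast_mxtensA m n p (e : (m * n * p = m * (n * p))%N) i j l :
  cast_ord e (mxtens_index (mxtens_index (i, j), l)) =
  mxtens_index (i, mxtens_index (j, l)).
Proof. by apply: val_inj; rewrite /= mulnDl mulnA addnA. Qed.

Lemma cast_mxtens1l n (e : (1 * n = n)%N) i j :
  cast_ord e (mxtens_index (i, j)) = j.
Proof. by apply: val_inj; rewrite /= ord1. Qed.

Lemma cast_mxtens1r n (e : (n * 1 = n)%N) i j :
  cast_ord e (mxtens_index (i, j)) = i.
Proof. by apply: val_inj; rewrite /= [j]ord1 muln1 addn0. Qed.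

Lemma castV_mxtensA m n p (e : (m * (n * p) = m * n * p)%N) i j l :
  cast_ord e (mxtens_index (i, mxtens_index (j, l))) =
  mxtens_index (mxtens_index (i, j), l).
Proof. by apply: val_inj; rewrite /= mulnDl mulnA addnA. Qed.

Lemma castV_mxtens1l n (e : n = (1 * n)%N) j :
  cast_ord e j = mxtens_index (ord0, j).
Proof. exact: val_inj. Qed.

Lemma castV_mxtens1r n (e : n = (n * 1)%N) j :
  cast_ord e j = mxtens_index (j, ord0).
Proof. by apply: val_inj; rewrite /= muln1 addn0. Qed.

Lemma castm_mulE m n p (e : m = n) (M : 'M[k]_(n, p)) :
  castm k e *m M = \matrix_(i, j) M (cast_ord e i) j.
Proof. exact: mul_map1mx. Qed.

Lemma mul_castmE m n p (e : n = p) (M : 'M[k]_(m, n)) :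
  M *m castm k e = \matrix_(i, j) M i (cast_ord (esym e) j).
Proof. exact: (mul_mx_map1 _ (cast_ordK e) (cast_ordKV e)). Qed.

Lemma tensmxDl m n p q (M M' : 'M[k]_(m, n)) (N : 'M[k]_(p, q)) :
  (M + M') *t N = M *t N + M' *t N.
Proof. by apply/matrixP=> i j; rewrite !mxE mulrDl. Qed.

Lemma tensmxDr m n p q (M : 'M[k]_(m, n)) (N N' : 'M[k]_(p, q)) :
  M *t (N + N') = M *t N + M *t N'.
Proof. by apply/matrixP=> i j; rewrite !mxE mulrDr. Qed.

Lemma tensmxZl m n p q a (M : 'M[k]_(m, n)) (N : 'M[k]_(p, q)) :
  (a *: M) *t N = a *: (M *t N).
Proof. by apply/matrixP=> i j; rewrite !mxE mulrA. Qed.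

Lemma tensmxZr m n p q a (M : 'M[k]_(m, n)) (N : 'M[k]_(p, q)) :
  M *t (a *: N) = a *: (M *t N).
Proof. by apply/matrixP=> i j; rewrite !mxE mulrCA. Qed.

Lemma tensmxBl m n p q (M M' : 'M[k]_(m, n)) (N : 'M[k]_(p, q)) :
  (M - M') *t N = M *t N - M' *t N.
Proof. by rewrite tensmxDl -scaleN1r tensmxZl scaleN1r. Qed.

Lemma tensmxBr m n p q (M : 'M[k]_(m, n)) (N N' : 'M[k]_(p, q)) :
  M *t (N - N') = M *t N - M *t N'.
Proof. by rewrite tensmxDr -scaleN1r tensmxZr scaleN1r. Qed.

Lemma tensmx11 m n : (1%:M : 'M[k]_m) *t (1%:M : 'M[k]_n) = 1%:M.
Proof.
apply: mxtensP => i j i' j'; rewrite tensmxE !mxE -natrM mulnb.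
by rewrite (can_eq (@mxtens_indexK _ _)) xpair_eqE.
Qed.

Definition amx m n p : 'M[k]_(m * n * p, m * (n * p)) :=
  castm k (esym (mulnA m n p)).
Definition amxV m n p : 'M[k]_(m * (n * p), m * n * p) :=
  castm k (mulnA m n p).

Lemma amx_tens m n p m' n' p'
  (M : 'M[k]_(m, m')) (N : 'M[k]_(n, n')) (P : 'M[k]_(p, p')) :
  amx m n p *m (M *t (N *t P)) = ((M *t N) *t P) *m amx m' n' p'.
Proof.
rewrite castm_mulE mul_castmE; apply: mxtensP => i j i' j'.
case: (mxtens_indexP i) => i1 i2; case: (mxtens_indexP j') => j1 j2.
by rewrite mxE [RHS]mxE cast_mxtensA castV_mxtensA !tensmxE mulrA.
Qed.

Lemma lmx_tens n n' (M : 'M[k]_(n, n')) :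
  castm k (mul1n n) *m M = (1%:M *t M) *m castm k (mul1n n').
Proof.
rewrite castm_mulE mul_castmE; apply/matrixP => i j.
case: (mxtens_indexP i) => i1 i2; rewrite mxE [RHS]mxE.
by rewrite cast_mxtens1l castV_mxtens1l tensmxE mxE [i1]ord1 eqxx mul1r.
Qed.

Lemma rmx_tens n n' (M : 'M[k]_(n, n')) :
  castm k (muln1 n) *m M = (M *t 1%:M) *m castm k (muln1 n').
Proof.
rewrite castm_mulE mul_castmE; apply/matrixP => i j.
case: (mxtens_indexP i) => i1 i2; rewrite mxE [RHS]mxE.
by rewrite cast_mxtens1r castV_mxtens1r tensmxE mxE [i2]ord1 eqxx mulr1.
Qed.

Lemma swapmx_tens m n m' n' (M : 'M[k]_(m, m')) (N : 'M[k]_(n, n')) :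
  map1mx k (@swap_ord m n) *m (N *t M) = (M *t N) *m map1mx k (@swap_ord m' n').
Proof.
rewrite mul_map1mx (mul_mx_map1 _ (@swap_ordK _ _) (@swap_ordK _ _)).
by apply/matrixP=> i j; rewrite !mxE !mxtens_indexK mulrC.
Qed.

Definition evmx n : 'M[k]_(n * n, 1) :=
  \matrix_(i, j) ((mxtens_unindex i).1 == (mxtens_unindex i).2)%:R.
Definition coevmx n : 'M[k]_(1, n * n) :=
  \matrix_(i, j) ((mxtens_unindex j).1 == (mxtens_unindex j).2)%:R.

Definition matemx p n (e : 'M[k]_(p * n, 1)) : 'M[k]_(p, n) :=
  castm k (esym (muln1 p)) *m ((1%:M *t coevmx n) *m (amxV p n n *m
    ((e *t 1%:M) *m castm k (mul1n n)))).

Lemma matemxE p n (e : 'M[k]_(p * n, 1)) :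
  matemx e = \matrix_(i, j) e (mxtens_index (i, j)) ord0.
Proof.
rewrite /matemx castm_mulE; apply/matrixP=> i j.
rewrite [LHS]mxE castV_mxtens1r [LHS]mxE [RHS]mxE.
have E y a b : (amxV p n n *m ((e *t 1%:M) *m castm k (mul1n n)))
    (mxtens_index (y, mxtens_index (a, b))) j =
    e (mxtens_index (y, a)) ord0 * (b == j)%:R.
  by rewrite castm_mulE mxE mul_castmE mxE castV_mxtensA castV_mxtens1l
             tensmxE mxE.
rewrite sum_mxtens (bigD1 i) //= [X in _ + X]big1 ?addr0; last first.
  move=> i' ni; rewrite big1 // => l _.
  by rewrite tensmxE mxE eq_sym (negPf ni) !mul0r.
rewrite sum_mxtens (bigD1 j) //= [X in _ + X]big1 ?addr0; last first.
  move=> a na; rewrite big1 // => b _; rewrite E tensmxE !mxE mxtens_indexK /=.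
  case: (a =P b) => [<-|_]; last by rewrite mulr0 mul0r.
  by rewrite (negPf na) !mulr0.
rewrite (bigD1 j) //= [X in _ + X]big1 ?addr0; last first.
  by move=> b nb; rewrite E (negPf nb) !mulr0.
by rewrite E tensmxE !mxE mxtens_indexK /= !eqxx !mul1r mulr1.
Qed.

Lemma zigzagmx n :
  castm k (esym (mul1n n)) *m ((coevmx n *t 1%:M) *m (amx n n n *m
    ((1%:M *t evmx n) *m castm k (muln1 n)))) = 1%:M :> 'M[k]_n.
Proof.
rewrite castm_mulE; apply/matrixP=> i j.
rewrite [LHS]mxE castV_mxtens1l [LHS]mxE [RHS]mxE.
have E a b c : (amx n n n *m ((1%:M *t evmx n) *m castm k (muln1 n)))
    (mxtens_index (mxtens_index (a, b), c)) j = (a == j)%:R * (b == c)%:R.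
  by rewrite castm_mulE mxE mul_castmE mxE cast_mxtensA castV_mxtens1r
             tensmxE !mxE mxtens_indexK.
rewrite !sum_mxtens (bigD1 j) //= [X in _ + X]big1 ?addr0; last first.
  by move=> a na; rewrite !big1 // => b _; rewrite big1 // => c _;
     rewrite E (negPf na) mul0r mulr0.
rewrite (bigD1 j) //= [X in _ + X]big1 ?addr0; last first.
  move=> b nb; rewrite big1 // => c _; rewrite tensmxE !mxE mxtens_indexK /=.
  by rewrite eq_sym (negPf nb) !mul0r.
rewrite (bigD1 j) //= [X in _ + X]big1 ?addr0; last first.
  by move=> c nc; rewrite E [_ == c]eq_sym (negPf nc) !mulr0.
by rewrite E tensmxE !mxE mxtens_indexK /= !eqxx mul1r !mulr1.
Qed.

Lemma swap_hexagon m n p :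
  (map1mx k (@swap_ord m n) *t 1%:M) *m amx n m p *m
    (1%:M *t map1mx k (@swap_ord m p)) =
  amx m n p *m map1mx k (@swap_ord m (n * p)) *m amx n p m.
Proof.
rewrite -!map1mx_id !tens_map1mx !mul_map1mx2; apply: eq_map1mx => i.
case: (mxtens_indexP i) => a c; case: (mxtens_indexP a) => {}a b.
rewrite ![(_ \o _) _]/comp !tens_mapE swap_ordE !cast_mxtensA swap_ordE cast_mxtensA.
by rewrite tens_mapE swap_ordE.
Qed.

End TensorIdentities.

Section RepAz.
Variables (k : fieldType) (A : finGroupType) (z : A).
Hypothesis char0 : [pchar k] =i pred0.
Hypothesis abelA : abelian [set: A].
Hypothesis z2 : (z ^+ 2)%g = 1%g.

(* As in the MathComp library, matrices act on row vectors, so that a        *)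
(* composite of morphisms is a product of matrices in the opposite order.    *)
Record rep := Rep {
  rep_dim : nat;
  rep_mx :> mx_representation k [set: A]%G rep_dim
}.
Implicit Types U V W T : rep.

Lemma rep_mx1 (V : rep) : V 1%g = 1%:M.
Proof. exact: repr_mx1. Qed.

Lemma rep_mxM (V : rep) g h : V (g * h)%g = V g *m V h.
Proof. by rewrite repr_mxM ?inE. Qed.

Lemma rep_mxC (V : rep) g h : V g *m V h = V h *m V g.
Proof. by rewrite -!rep_mxM; congr (V _); apply: (centsP abelA); rewrite inE. Qed.

Lemma rep_mxKV (V : rep) g : V g^-1%g *m V g = 1%:M.
Proof. by rewrite -rep_mxM mulVg rep_mx1. Qed.

Lemma rep_mxK (V : rep) g : V g *m V g^-1%g = 1%:M.
Proof. by rewrite -rep_mxM mulgV rep_mx1. Qed.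

Lemma zz : (z * z)%g = 1%g.
Proof. by rewrite -expg2. Qed.

Lemma zV : z^-1%g = z.
Proof. by apply/eqP; rewrite eq_invg_mul zz. Qed.

Definition rep_homs (V W : rep) : {vspace 'M[k]_(rep_dim V, rep_dim W)} :=
  (\bigcap_(g : A) lker (linfun (mulmx (V g) \- mulmxr (W g))))%VS.

Definition rep_hom (V W : rep) : vectType k := subvs_of (rep_homs V W).

Lemma rep_homP V W (M : 'M_(rep_dim V, rep_dim W)) :
  reflect (forall g, V g *m M = M *m W g) (M \in rep_homs V W).
Proof.
apply: (iffP subv_bigcapP) => [H g | H g _].
  have := H g isT; rewrite -memvE memv_ker lfunE /= subr_eq0.
  by move/eqP.
by rewrite -memvE memv_ker lfunE /= subr_eq0 H.
Qed.

Lemma rep_hom_comm V W (f : rep_hom V W) g : V g *m vsval f = vsval f *m W g.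
Proof. exact/rep_homP/valP. Qed.

Definition rep_mor V W (M : 'M_(rep_dim V, rep_dim W))
  (H : forall g, V g *m M = M *m W g) : rep_hom V W := Subvs (introT (rep_homP M) H).

Lemma rep_id_proof V g : V g *m 1%:M = 1%:M *m V g.
Proof. by rewrite mulmx1 mul1mx. Qed.

Lemma rep_comp_proof U V W (f : rep_hom V W) (h : rep_hom U V) g :
  U g *m (vsval h *m vsval f) = vsval h *m vsval f *m W g.
Proof. by rewrite mulmxA rep_hom_comm -!mulmxA rep_hom_comm. Qed.

Definition rep_id V := rep_mor (@rep_id_proof V).
Definition rep_comp U V W (f : rep_hom V W) (h : rep_hom U V) :=
  rep_mor (rep_comp_proof f h).

Lemma rep_comp1m V W (f : rep_hom V W) : rep_comp (rep_id W) f = f.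
Proof. by apply: val_inj; rewrite /= mulmx1. Qed.

Lemma rep_compm1 V W (f : rep_hom V W) : rep_comp f (rep_id V) = f.
Proof. by apply: val_inj; rewrite /= mul1mx. Qed.

Lemma rep_compA U V W T (h : rep_hom W T) (g : rep_hom V W) (f : rep_hom U V) :
  rep_comp h (rep_comp g f) = rep_comp (rep_comp h g) f.
Proof. by apply: val_inj; rewrite /= mulmxA. Qed.

Lemma rep_comp_linl U V W (f : rep_hom U V) :
  linear (fun g : rep_hom V W => rep_comp g f).
Proof. by move=> a g h; apply: val_inj; rewrite /= mulmxDr -scalemxAr. Qed.

Lemma rep_comp_linr U V W (g : rep_hom V W) :
  linear (fun f : rep_hom U V => rep_comp g f).
Proof. by move=> a f h; apply: val_inj; rewrite /= mulmxDl -scalemxAl. Qed.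

Definition rep_lincat : lincat k :=
  LinCat rep_comp1m rep_compm1 rep_compA rep_comp_linl rep_comp_linr.

Lemma rep_unit_repr : mx_repr [set: A]%G (fun _ : A => 1%:M : 'M[k]_1).
Proof. by split=> // g h _ _; rewrite mulmx1. Qed.

Definition rep_unit := Rep (MxRepresentation rep_unit_repr).

Lemma rep_tens_repr (V W : rep) : mx_repr [set: A]%G (fun g => V g *t W g).
Proof.
split=> [|g h _ _]; first by rewrite !rep_mx1 tensmx11.
by rewrite !rep_mxM tensmx_mul.
Qed.

Definition rep_tens V W := Rep (MxRepresentation (rep_tens_repr V W)).

Lemma rep_tensm_proof V V' W W' (f : rep_hom V V') (h : rep_hom W W') g :
  rep_tens V W g *m (vsval f *t vsval h) =
  (vsval f *t vsval h) *m rep_tens V' W' g.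
Proof. by rewrite /= !tensmx_mul !rep_hom_comm. Qed.

Definition rep_tensm V V' W W' (f : rep_hom V V') (h : rep_hom W W') :
  rep_hom (rep_tens V W) (rep_tens V' W') :=
  @rep_mor (rep_tens V W) (rep_tens V' W') _ (rep_tensm_proof f h).

Lemma rep_assoc_proof U V W g :
  rep_tens (rep_tens U V) W g *m amx k (rep_dim U) (rep_dim V) (rep_dim W) =
  amx k _ _ _ *m rep_tens U (rep_tens V W) g.
Proof. by rewrite /= amx_tens. Qed.

Lemma amxK m n p : amx k m n p *m amxV k m n p = 1%:M.
Proof. by rewrite castm_mul castm_id. Qed.

Lemma amxVK m n p : amxV k m n p *m amx k m n p = 1%:M.
Proof. by rewrite castm_mul castm_id. Qed.

Lemma mulmx_inv m n (M : 'M[k]_(m, n)) M' X Y :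
  M *m M' = 1%:M -> M' *m M = 1%:M -> X *m M = M *m Y -> Y *m M' = M' *m X.
Proof.
by move=> MK KM E; rewrite -[X in M' *m X]mulmx1 -MK [X *m _]mulmxA E
  !mulmxA KM mul1mx.
Qed.

Lemma rep_assocV_proof U V W g :
  rep_tens U (rep_tens V W) g *m amxV k (rep_dim U) (rep_dim V) (rep_dim W) =
  amxV k _ _ _ *m rep_tens (rep_tens U V) W g.
Proof. exact: mulmx_inv (amxK _ _ _) (amxVK _ _ _) (rep_assoc_proof U V W g). Qed.

Lemma rep_lunit_proof V g :
  rep_tens rep_unit V g *m castm k (mul1n (rep_dim V)) = castm k (mul1n _) *m V g.
Proof. by rewrite /= lmx_tens. Qed.

Lemma rep_lunitV_proof V g :
  V g *m castm k (esym (mul1n (rep_dim V))) =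
  castm k (esym (mul1n _)) *m rep_tens rep_unit V g.
Proof.
by apply: mulmx_inv (rep_lunit_proof V g); rewrite castm_mul castm_id.
Qed.

Lemma rep_runit_proof V g :
  rep_tens V rep_unit g *m castm k (muln1 (rep_dim V)) = castm k (muln1 _) *m V g.
Proof. by rewrite /= rmx_tens. Qed.

Lemma rep_runitV_proof V g :
  V g *m castm k (esym (muln1 (rep_dim V))) =
  castm k (esym (muln1 _)) *m rep_tens V rep_unit g.
Proof.
by apply: mulmx_inv (rep_runit_proof V g); rewrite castm_mul castm_id.
Qed.

Definition rep_assoc U V W : rep_hom (rep_tens (rep_tens U V) W) (rep_tens U (rep_tens V W)) :=
  @rep_mor (rep_tens (rep_tens U V) W) (rep_tens U (rep_tens V W)) _ (rep_assoc_proof U V W).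
Definition rep_assocV U V W : rep_hom (rep_tens U (rep_tens V W)) (rep_tens (rep_tens U V) W) :=
  @rep_mor (rep_tens U (rep_tens V W)) (rep_tens (rep_tens U V) W) _ (rep_assocV_proof U V W).
Definition rep_lunit V : rep_hom (rep_tens rep_unit V) V :=
  @rep_mor (rep_tens rep_unit V) V _ (rep_lunit_proof V).
Definition rep_lunitV V : rep_hom V (rep_tens rep_unit V) :=
  @rep_mor V (rep_tens rep_unit V) _ (rep_lunitV_proof V).
Definition rep_runit V : rep_hom (rep_tens V rep_unit) V :=
  @rep_mor (rep_tens V rep_unit) V _ (rep_runit_proof V).
Definition rep_runitV V : rep_hom V (rep_tens V rep_unit) :=
  @rep_mor V (rep_tens V rep_unit) _ (rep_runitV_proof V).

Definition rep_moncat : moncat k.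
Proof.
refine (@MonCat k rep_lincat rep_unit rep_tens rep_tensm _ _ _ _
  rep_assoc rep_assocV _ _ _ rep_lunit rep_lunitV _ _ _
  rep_runit rep_runitV _ _ _ _ _).
- by move=> V W; apply: val_inj; rewrite /= tensmx11.
- by move=> *; apply: val_inj; rewrite /= tensmx_mul.
- by move=> V V' W W' g a f h; apply: val_inj; rewrite /= tensmxDl tensmxZl.
- by move=> V V' W W' g a f h; apply: val_inj; rewrite /= tensmxDr tensmxZr.
- by move=> U V W; apply: val_inj; rewrite /= amxK.
- by move=> U V W; apply: val_inj; rewrite /= amxVK.
- by move=> *; apply: val_inj; rewrite /= amx_tens.
- by move=> V; apply: val_inj; rewrite /= castm_mul castm_id.
- by move=> V; apply: val_inj; rewrite /= castm_mul castm_id.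
- by move=> V W f; apply: val_inj; rewrite /= lmx_tens.
- by move=> V; apply: val_inj; rewrite /= castm_mul castm_id.
- by move=> V; apply: val_inj; rewrite /= castm_mul castm_id.
- by move=> V W f; apply: val_inj; rewrite /= rmx_tens.
- move=> V W; apply: val_inj => /=.
  rewrite -!(@castm_id k _ (erefl _)) !castm_tens castm_mul.
  by apply: eq_map1mx => i; apply: val_inj.
- move=> V W U T; apply: val_inj => /=.
  rewrite -!(@castm_id k _ (erefl _)) !castm_tens !castm_mul.
  by apply: eq_map1mx => i; apply: val_inj.
Defined.

Lemma rep_dual_repr (V : rep) : mx_repr [set: A]%G (fun g => (V g^-1%g)^T).
Proof.
split=> [|g h _ _]; first by rewrite invg1 rep_mx1 trmx1.
by rewrite invMg rep_mxM trmx_mul.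
Qed.

Definition rep_dual V := Rep (MxRepresentation (rep_dual_repr V)).

Lemma tens_evmx m n p (M : 'M[k]_(m, n)) (N : 'M[k]_(p, n)) :
  (M *t N) *m evmx k n = \matrix_(i, j)
    (M *m N^T) (mxtens_unindex i).1 (mxtens_unindex i).2.
Proof.
apply/matrixP=> i j; case: (mxtens_indexP i) => a b.
rewrite !mxE mxtens_indexK sum_mxtens; apply: eq_bigr => c _.
rewrite (bigD1 c) //= big1 ?addr0 => [|d nd]; rewrite tensmxE !mxE mxtens_indexK /=.
  by rewrite eqxx mulr1.
by rewrite eq_sym (negPf nd) mulr0.
Qed.

Lemma coevmx_tens m n (M N : 'M[k]_(m, n)) :
  coevmx k m *m (M *t N) = \matrix_(i, j)
    (M^T *m N) (mxtens_unindex j).1 (mxtens_unindex j).2.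
Proof.
apply/matrixP=> i j; case: (mxtens_indexP j) => a b.
rewrite !mxE mxtens_indexK sum_mxtens; apply: eq_bigr => c _.
rewrite (bigD1 c) //= big1 ?addr0 => [|d nd]; rewrite tensmxE !mxE mxtens_indexK /=.
  by rewrite eqxx mul1r.
by rewrite eq_sym (negPf nd) mul0r.
Qed.

Lemma rep_ev_proof V g :
  rep_tens (rep_dual V) V g *m evmx k (rep_dim V) =
  evmx k (rep_dim V) *m rep_unit g.
Proof.
rewrite /= tens_evmx mulmx1 -trmx_mul rep_mxK trmx1.
by apply/matrixP=> i j; rewrite !mxE.
Qed.

Lemma rep_coev_proof V g :
  rep_unit g *m coevmx k (rep_dim V) =
  coevmx k (rep_dim V) *m rep_tens V (rep_dual V) g.
Proof.
rewrite /= coevmx_tens mul1mx -trmx_mul rep_mxKV trmx1.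
by apply/matrixP=> i j; rewrite !mxE.
Qed.

Definition rep_ev V : rep_hom (rep_tens (rep_dual V) V) rep_unit :=
  @rep_mor (rep_tens (rep_dual V) V) rep_unit _ (rep_ev_proof V).
Definition rep_coev V : rep_hom rep_unit (rep_tens V (rep_dual V)) :=
  @rep_mor rep_unit (rep_tens V (rep_dual V)) _ (rep_coev_proof V).

Definition rep_rigidcat : rigidcat k.
Proof.
refine (@RigidCat k rep_moncat rep_dual rep_ev rep_coev _ _) => V.
- by apply: val_inj; rewrite /= zigzagmx.
- apply: val_inj; rewrite /= -/(matemx (evmx k (rep_dim V))) matemxE.
  by apply/matrixP=> i j; rewrite !mxE mxtens_indexK.
Defined.

(* The projection on the odd part of [V], where [z] acts by [-1]. *)
Definition oddmx V : 'M[k]_(rep_dim V) := 2^-1 *: (1%:M - V z).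

Lemma two_neq0 : 2 != 0 :> k.
Proof. by have /pcharf0P -> := char0. Qed.

Lemma rep_mxz V : V z = 1%:M - 2 *: oddmx V.
Proof. by rewrite scalerA divff ?two_neq0 // scale1r subKr. Qed.

Lemma oddmx_id V : oddmx V *m oddmx V = oddmx V.
Proof.
have E : (1%:M - V z) *m (1%:M - V z) = 2 *: (1%:M - V z).
  rewrite mulmxBl mul1mx mulmxBr mulmx1 -rep_mxM zz rep_mx1.
  by rewrite -[V z - _]opprB opprK scaler_nat mulr2n.
rewrite /oddmx -scalemxAl -scalemxAr E [X in _ *: X]scalerA mulVf ?two_neq0 //.
by rewrite scale1r.
Qed.

Lemma oddmx_nat V W (M : 'M_(rep_dim V, rep_dim W)) :
  M \in rep_homs V W -> oddmx V *m M = M *m oddmx W.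
Proof.
move/rep_homP => H; rewrite /oddmx -scalemxAl -scalemxAr.
by rewrite mulmxBl mulmxBr mul1mx mulmx1 H.
Qed.

Lemma oddmx_tens V W :
  oddmx (rep_tens V W) =
  oddmx V *t 1%:M + 1%:M *t oddmx W - 2 *: (oddmx V *t oddmx W).
Proof.
apply: (scalerI two_neq0); rewrite [LHS]scalerA divff ?two_neq0 // scale1r /=.
rewrite !rep_mxz; move: (oddmx V) (oddmx W) => M N.
rewrite tensmxBl !tensmxBr tensmx11 !tensmxZl !tensmxZr.
move: (M *t 1%:M) (1%:M *t N) (M *t N) => X Y Z.
by apply/matrixP=> i j; rewrite !mxE; ring.
Qed.

Definition oddsign V W : 'M[k]_(rep_dim V * rep_dim W) :=
  1%:M - 2 *: (oddmx V *t oddmx W).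

(* The flip, multiplied by [-1] on the tensor product of the odd parts; see  *)
(* [rep1_braid] for one-dimensional representations.                         *)
Definition braidmx V W :
    'M[k]_(rep_dim V * rep_dim W, rep_dim W * rep_dim V) :=
  oddsign V W *m map1mx k (@swap_ord (rep_dim V) (rep_dim W)).

Lemma oddsign_tens V V' W W' (M : 'M_(rep_dim V, rep_dim V'))
    (N : 'M_(rep_dim W, rep_dim W')) :
  M \in rep_homs V V' -> N \in rep_homs W W' ->
  oddsign V W *m (M *t N) = (M *t N) *m oddsign V' W'.
Proof.
move=> HM HN; rewrite mulmxBl mulmxBr mul1mx mulmx1 -scalemxAl -scalemxAr.
by rewrite !tensmx_mul (oddmx_nat HM) (oddmx_nat HN).
Qed.

Lemma braidmx_tens V V' W W' (M : 'M_(rep_dim V, rep_dim V'))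
    (N : 'M_(rep_dim W, rep_dim W')) :
  M \in rep_homs V V' -> N \in rep_homs W W' ->
  braidmx V W *m (N *t M) = (M *t N) *m braidmx V' W'.
Proof.
move=> HM HN; rewrite /braidmx -mulmxA swapmx_tens !mulmxA.
by rewrite (oddsign_tens HM HN).
Qed.

Lemma rep_mx_hom V g : V g \in rep_homs V V.
Proof. by apply/rep_homP => h; rewrite rep_mxC. Qed.

Lemma oddsignK V W : oddsign V W *m oddsign V W = 1%:M.
Proof.
rewrite mulmxBl mul1mx -scalemxAl mulmxBr mulmx1 -scalemxAr tensmx_mul.
rewrite !oddmx_id /oddsign; move: (_ *t _) => X.
by apply/matrixP=> i j; rewrite !mxE; ring.
Qed.

Lemma swapmx_odd V W :
  map1mx k (@swap_ord (rep_dim V) (rep_dim W)) *m oddsign W V =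
  oddsign V W *m map1mx k (@swap_ord (rep_dim V) (rep_dim W)).
Proof.
rewrite mulmxBr mulmxBl mul1mx mulmx1 -scalemxAr -scalemxAl.
by rewrite swapmx_tens.
Qed.

Lemma swapmxK m n :
  map1mx k (@swap_ord m n) *m map1mx k (@swap_ord n m) = 1%:M.
Proof.
by rewrite mul_map1mx2 -map1mx_id; apply: eq_map1mx => i; exact: swap_ordK.
Qed.

Lemma braidmxK V W : braidmx V W *m braidmx W V = 1%:M.
Proof.
by rewrite /braidmx mulmxA -[_ *m oddsign W V]mulmxA swapmx_odd mulmxA oddsignK
  mul1mx swapmxK.
Qed.

Lemma braidmx_hexagon U V W :
  amx k _ _ _ *m (braidmx U (rep_tens V W) *m amx k _ _ _) =
  (braidmx U V *t 1%:M) *m (amx k _ _ _ *m (1%:M *t braidmx U W)).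
Proof.
have E1 : amx k (rep_dim V) (rep_dim U) (rep_dim W) *m (1%:M *t oddsign U W) =
    (1%:M - 2 *: (1%:M *t oddmx U *t oddmx W)) *m amx k _ _ _.
  rewrite tensmxBr tensmx11 [_ *t (2 *: _)]tensmxZr mulmxBr mulmxBl mulmx1 mul1mx.
  by rewrite -scalemxAr -scalemxAl amx_tens.
have E2 : (map1mx k (@swap_ord (rep_dim U) (rep_dim V)) *t 1%:M) *m
      (1%:M - 2 *: (1%:M *t oddmx U *t oddmx W)) =
    (1%:M - 2 *: (oddmx U *t 1%:M *t oddmx W)) *m
      (map1mx k (@swap_ord (rep_dim U) (rep_dim V)) *t 1%:M).
  rewrite mulmxBr mulmxBl mulmx1 mul1mx -scalemxAr -scalemxAl.
  by rewrite !tensmx_mul swapmx_tens mulmx1 mul1mx.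
have E3 : amx k (rep_dim U) (rep_dim V) (rep_dim W) *m
      oddsign U (rep_tens V W) =
    (oddsign U V *t 1%:M) *m (1%:M - 2 *: (oddmx U *t 1%:M *t oddmx W)) *m
      amx k _ _ _.
  have -> : (oddsign U V *t 1%:M) *m
      (1%:M - 2 *: (oddmx U *t 1%:M *t oddmx W)) =
    1%:M - 2 *: (oddmx U *t oddmx V *t 1%:M + oddmx U *t 1%:M *t oddmx W
            - 2 *: (oddmx U *t oddmx V *t oddmx W)).
    rewrite tensmxBl tensmx11 tensmxZl mulmxBl mul1mx -scalemxAl.
    rewrite mulmxBr mulmx1 -scalemxAr !tensmx_mul !mul1mx !mulmx1 oddmx_id.
    move: (oddmx U *t oddmx V *t 1%:M) (oddmx U *t 1%:M *t oddmx W)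
      (oddmx U *t oddmx V *t oddmx W) => X Y Z.
    by apply/matrixP=> i j; rewrite !mxE; ring.
  rewrite /oddsign oddmx_tens tensmxBr tensmxDr [_ *t (2 *: _)]tensmxZr.
  rewrite mulmxBr mulmxBl mulmx1 mul1mx -scalemxAr -scalemxAl; congr (_ - _ *: _).
  rewrite mulmxBr mulmxBl mulmxDr mulmxDl -scalemxAr -scalemxAl.
  by rewrite !amx_tens.
have -> : braidmx U V *t 1%:M = (oddsign U V *t 1%:M) *m
    (map1mx k (@swap_ord (rep_dim U) (rep_dim V)) *t 1%:M) :> 'M_(_, _ * rep_dim W).
  by rewrite tensmx_mul mulmx1.
have -> : 1%:M *t braidmx U W = (1%:M *t oddsign U W) *m
    (1%:M *t map1mx k (@swap_ord (rep_dim U) (rep_dim W))) :> 'M_(rep_dim V * _, _).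
  by rewrite tensmx_mul mulmx1.
rewrite -!mulmxA [amx _ _ _ _ *m (_ *m _) in RHS]mulmxA E1.
rewrite -!mulmxA [(_ *t 1%:M) *m ((_ - _) *m _)]mulmxA E2.
rewrite /braidmx -!mulmxA [LHS]mulmxA E3.
rewrite -!mulmxA; congr (_ *m (_ *m _)).
by have := swap_hexagon k (rep_dim U) (rep_dim V) (rep_dim W); rewrite -!mulmxA => ->.
Qed.

Lemma mulmx3_inv m n p q (a : 'M[k]_(m, n)) (b : 'M[k]_(n, p))
    (c : 'M[k]_(p, q)) a' b' c' :
  a' *m a = 1%:M -> b' *m b = 1%:M -> c' *m c = 1%:M ->
  (c' *m (b' *m a')) *m (a *m (b *m c)) = 1%:M.
Proof.
move=> aK bK cK; rewrite -!mulmxA [a' *m (a *m _)]mulmxA aK mul1mx.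
by rewrite [b' *m (b *m _)]mulmxA bK mul1mx.
Qed.

Lemma inv_uniq m n (M : 'M[k]_(m, n)) X Y :
  X *m M = 1%:M -> M *m Y = 1%:M -> X = Y.
Proof. by move=> XM MY; rewrite -[X]mulmx1 -MY mulmxA XM mul1mx. Qed.

Lemma braidmx_hexagonV U V W :
  amxV k _ _ _ *m (braidmx (rep_tens U V) W *m amxV k _ _ _) =
  (1%:M *t braidmx V W) *m (amxV k _ _ _ *m (braidmx U W *t 1%:M)).
Proof.
have H := braidmx_hexagon W U V.
apply: (inv_uniq (M := amx k _ _ _ *m
                    (braidmx W (rep_tens U V) *m amx k _ _ _))).
  apply: mulmx3_inv; [exact: amxVK | exact: (braidmxK (rep_tens U V) W) | exact: amxVK].
rewrite H; apply: mulmx3_inv; last 1 first.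
- by rewrite tensmx_mul braidmxK mulmx1 tensmx11.
- by rewrite tensmx_mul braidmxK mulmx1 tensmx11.
- exact: amxK.
Qed.

Lemma rep_braid_proof V W g :
  rep_tens V W g *m braidmx V W = braidmx V W *m rep_tens W V g.
Proof. by rewrite (braidmx_tens (rep_mx_hom V g) (rep_mx_hom W g)). Qed.

Definition rep_braid V W : rep_hom (rep_tens V W) (rep_tens W V) :=
  @rep_mor (rep_tens V W) (rep_tens W V) _ (rep_braid_proof V W).

Definition rep_braidedcat : braidedcat k.
Proof.
refine (@BraidedCat k rep_rigidcat rep_braid (fun V W => rep_braid W V)
  _ _ _ _ _).
- by move=> V W; apply: val_inj; rewrite /= braidmxK.
- by move=> V W; apply: val_inj; rewrite /= braidmxK.
- by move=> V V' W W' f g; apply: val_inj; rewrite /= (braidmx_tens (valP f) (valP g)).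
- by move=> U V W; apply: val_inj; exact: braidmx_hexagon.
- by move=> U V W; apply: val_inj; exact: braidmx_hexagonV.
Defined.

(* The pivotal structure is the action of [z], the underlying space of the   *)
(* double dual of [V] being that of [V]. It is the one with trivial twist,   *)
(* see [rep_drinfeld] and [rep1_qdimR].                                      *)
Lemma rep_ddual V g : rep_dual (rep_dual V) g = V g.
Proof. by rewrite /= trmxK invgK. Qed.

Lemma rep_piv_proof V g : V g *m V z = V z *m rep_dual (rep_dual V) g.
Proof. by rewrite rep_ddual rep_mxC. Qed.

Lemma rep_pivV_proof V g : rep_dual (rep_dual V) g *m V z = V z *m V g.
Proof. by rewrite rep_ddual rep_mxC. Qed.

Definition rep_piv V : rep_hom V (rep_dual (rep_dual V)) :=
  @rep_mor V (rep_dual (rep_dual V)) _ (rep_piv_proof V).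
Definition rep_pivV V : rep_hom (rep_dual (rep_dual V)) V :=
  @rep_mor (rep_dual (rep_dual V)) V _ (rep_pivV_proof V).

Lemma rep_mateE V W (e : rep_hom (rep_tens W V) rep_unit) :
  vsval (@mate k rep_rigidcat V W e : rep_hom W (rep_dual V)) =
  \matrix_(i, j) vsval e (mxtens_index (i, j)) ord0.
Proof. by rewrite -matemxE. Qed.

Lemma rep_dualmE V W (f : rep_hom V W) :
  vsval (@dualm k rep_rigidcat V W f : rep_hom (rep_dual W) (rep_dual V)) =
  (vsval f)^T.
Proof.
rewrite rep_mateE /= tens_evmx mul1mx.
by apply/matrixP=> i j; rewrite !mxE !mxtens_indexK.
Qed.

Lemma rep_dual_tensE V W :
  vsval (@dual_tens k rep_rigidcat V W :
    rep_hom (rep_tens (rep_dual W) (rep_dual V)) (rep_dual (rep_tens V W))) =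
  map1mx k (@swap_ord (rep_dim W) (rep_dim V)).
Proof.
rewrite rep_mateE /=; apply: mxtensP => i j i' j'.
rewrite mxE castm_mulE mxE cast_mxtensA tens_evmx mul1mx mxE mxtens_indexK /=.
rewrite mxE castm_mulE mxE castV_mxtensA mul_castmE mxE castV_mxtens1l tensmxE.
rewrite !mxE mxtens_indexK /= swap_ordE (can_eq (@mxtens_indexK _ _)).
by rewrite xpair_eqE -natrM mulnb [j == _]eq_sym.
Qed.

Lemma rep_piv_nat V W (f : rep_hom V W) :
  rep_comp (@dualm k rep_rigidcat _ _ (@dualm k rep_rigidcat V W f)) (rep_piv V)
  = rep_comp (rep_piv W) f.
Proof.
have E1 := rep_dualmE f.
have E2 := @rep_dualmE (rep_dual W) (rep_dual V) (@dualm k rep_rigidcat V W f).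
rewrite E1 trmxK in E2; apply: val_inj.
apply: (etrans (congr1 (mulmx (V z)) E2)); exact: (rep_hom_comm f z).
Qed.

Lemma trmx_swap m n :
  (map1mx k (@swap_ord m n))^T = map1mx k (@swap_ord n m).
Proof.
apply/matrixP=> i j; rewrite !mxE.
by rewrite -(can_eq (@swap_ordK _ _)) swap_ordK eq_sym.
Qed.

Lemma rep_piv_tens V W :
  rep_comp (@dualm k rep_rigidcat _ _ (@dual_tens k rep_rigidcat V W))
    (rep_piv (rep_tens V W)) =
  rep_comp (@dual_tens k rep_rigidcat (rep_dual W) (rep_dual V))
    (rep_tensm (rep_piv V) (rep_piv W)).
Proof.
have E1 := rep_dual_tensE V W.
have E2 := rep_dual_tensE (rep_dual W) (rep_dual V).
have E3 := @rep_dualmE (rep_tens (rep_dual W) (rep_dual V))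
  (rep_dual (rep_tens V W)) (@dual_tens k rep_rigidcat V W).
rewrite E1 trmx_swap in E3; apply: val_inj.
apply: (etrans (congr1 (mulmx (V z *t W z)) E3)).
exact: (esym (congr1 (mulmx (V z *t W z)) E2)).
Qed.

Definition rep_bpcat : bpcat k.
Proof.
refine (@BPCat k rep_braidedcat rep_piv rep_pivV _ _ _ _).
- by move=> V; apply: val_inj; rewrite /= -rep_mxM zz rep_mx1.
- by move=> V; apply: val_inj; rewrite /= -rep_mxM zz rep_mx1.
- exact: rep_piv_nat.
- exact: rep_piv_tens.
Defined.

Lemma oddmx_dual V : (oddmx (rep_dual V))^T = oddmx V.
Proof. by rewrite /oddmx linearZ /= linearB /= trmx1 trmxK zV. Qed.

Lemma swap_evmx n : map1mx k (@swap_ord n n) *m evmx k n = evmx k n.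
Proof.
rewrite mul_map1mx; apply/matrixP=> i j; rewrite !mxE.
by case: (mxtens_indexP i) => a b; rewrite swap_ordE !mxtens_indexK eq_sym.
Qed.

Lemma rep_drinfeld (V : rep) :
  rep_piv V = @drinfeld k rep_braidedcat V.
Proof.
apply: val_inj; rewrite [RHS]rep_mateE /= -mulmxA swap_evmx.
rewrite mulmxBl mul1mx -scalemxAl tens_evmx oddmx_dual oddmx_id rep_mxz.
by apply/matrixP=> i j; rewrite !mxE mxtens_indexK.
Qed.

Record linchar := LinChar {
  lc_fun :> A -> k;
  lc1 : lc_fun 1%g = 1;
  lcM : forall g h, lc_fun (g * h)%g = lc_fun g * lc_fun h
}.

Lemma lc_repr (alpha : linchar) : mx_repr [set: A]%G (fun g => (alpha g)%:M : 'M[k]_1).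
Proof. by split=> [|g h _ _]; rewrite ?lc1 // lcM scalar_mxM. Qed.

Definition rep1 (alpha : linchar) : rep := Rep (MxRepresentation (lc_repr alpha)).

Lemma lcz (alpha : linchar) : alpha z = 1 \/ alpha z = -1.
Proof.
have /eqP : alpha z ^+ 2 = 1 by rewrite expr2 -lcM zz lc1.
by rewrite sqrf_eq1 => /orP[] /eqP; [left|right].
Qed.

Lemma rep1_braid (alpha beta : linchar) :
  vsval (rep_braid (rep1 alpha) (rep1 beta)) =
  (if (alpha z == -1) && (beta z == -1) then -1 else 1) *: map1mx k (@swap_ord 1 1).
Proof.
have odd1 (chi : linchar) : oddmx (rep1 chi) = (if chi z == -1 then 1 else 0)%:M.
  rewrite /oddmx /= -raddfB /= scale_scalar_mx; congr (_%:M).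
  have n1 : 1 == -1 :> k = false.
    by apply/negbTE; rewrite -subr_eq0 opprK -mulr2n two_neq0.
  case: (lcz chi) => ->; rewrite ?n1 ?eqxx ?subrr ?mulr0 //.
  by rewrite opprK mulVf // two_neq0.
have tens1 a b : (a%:M : 'M[k]_1) *t (b%:M : 'M[k]_1) = (a * b)%:M.
  by rewrite -[a%:M]scalemx1 -[b%:M]scalemx1 tensmxZl tensmxZr tensmx11
             scalerA scalemx1.
rewrite /= /braidmx /oddsign !odd1 tens1 scale_scalar_mx -raddfB /=.
rewrite mul_scalar_mx; congr (_ *: _).
case: (_ == -1); case: (_ == -1); rewrite /= ?mulr0 ?mul0r ?mulr0 ?subr0 //.
by rewrite !mulr1 opprD addrA subrr sub0r.
Qed.

Lemma rep1_qdimR (alpha : linchar) : @qdimR k rep_bpcat (rep1 alpha) = alpha z.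
Proof.
rewrite /qdimR /trR.
have H (f : @mor k rep_bpcat tunit tunit) c :
    vsval (f : rep_hom rep_unit rep_unit) = c%:M -> scalar_of f = c.
  move=> Hf; have -> : f = c *: idmor tunit.
    by apply: val_inj; apply: (etrans Hf); rewrite /= scalemx1.
  apply: scalar_ofZ; apply/eqP => /(congr1 vsval) /= /matrixP /(_ ord0 ord0).
  by rewrite !mxE; apply/eqP; rewrite oner_eq0.
apply: H; rewrite /= mul1mx tens_evmx trmx1 mulmx1.
apply/matrixP=> i j; rewrite !mxE sum_mxtens !big_ord1 !mxE !mxtens_indexK /=.
by rewrite mul1r [i]ord1 [j]ord1 eqxx.
Qed.

End RepAz.

Lemma generator_abelian (A : finGroupType) (a : A) :
  generator [set: A] a -> abelian [set: A].
Proof. by move/eqP=> ->; exact: cycle_abelian. Qed.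

Section Setting.
Variables (k : fieldType) (A : finGroupType) (z : A).
Variables (char0 : [pchar k] =i pred0) (abelA : abelian [set: A]).
Variable z2 : (z ^+ 2)%g = 1%g.
Variables (C : bpcat k) (F : bpfunctor (rep_bpcat char0 abelA z2) C).

Definition Xchar (alpha : linchar k A) : C := F (rep1 alpha).

Definition of_degree (h : A) (X : C) : Prop :=
  forall alpha, braid X (Xchar alpha) ∘ braid (Xchar alpha) X =
                alpha h *: idmor (Xchar alpha ⊗ X).

Variables (I : finType) (S : I -> C).

Definition Ideg (h : A) : {set I} := [set i | `[< of_degree h (S i) >]].

Definition trivial_stab (i : I) : Prop :=
  forall alpha, isomorphic (Xchar alpha ⊗ S i) (S i) -> forall g, alpha g = 1.

Definition I1n : {set I} := [set i in Ideg 1%g | `[< trivial_stab i >]].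

Definition orbit_reps (J R : {set I}) : Prop :=
  R \subset J /\
  forall i, i \in J -> exists! j, j \in R /\
    exists alpha, isomorphic (Xchar alpha ⊗ S j) (S i).

(* The Gauss sum for [theta^-1] of the component of trivial degree. *)
Definition tau_minus : k :=
  \sum_(i in Ideg 1%g) (theta (S i))^-1 * qdimL (S i) * qdimR (S i).

End Setting.

Section Blocks.
Variables (k : fieldType) (C : bpcat k) (I : finType) (S : I -> C).

(* If [C] is non-degenerate, these equations determine [bar].                *)
Definition is_bar (bar : I -> I) : Prop :=
  forall i j, Smat (S i) ((S j)^∨) / qdimR (S i) =
              Smat (S (bar i)) (S j) / qdimR (S (bar i)).

Definition Sblock (U V : {set I}) : 'M[k]_(#|U|, #|V|) :=
  \matrix_(i, j) Smat (S (enum_val i)) (S (enum_val j)).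

Definition Tblock (U : {set I}) : 'M[k]_#|U| :=
  diag_mx (\row_i (theta (S (enum_val i)))^-1).

End Blocks.

(* Main.v *)
(* Write [d] and [l] for the right and left dimensions. Since                *)
(* [S_{Z,X} S_{Z,Y} = d_Z S_{Z,X⊗Y}], the sum of [S_{X,Z} theta_Z^-1 S_{Z,Y}]*)
(* over the simple [Z] of degree 1 is a combination of the sums              *)
(* [G(W) = \sum_Z theta_Z^-1 d_Z S_{W,Z}], for [W] a constituent of [X ⊗ Y]. *)
(* Replace [Z] by its dual: [theta_{Z^∨} d_Z = theta_Z l_Z], and             *)
(* [d_Z S_{W,Z^∨}] is [l_Z] times the trace of the inverse of the double     *)
(* braiding, which the balancing axiom expands over the constituents [V] of  *)
(* [W ⊗ Z]. As [Hom(W ⊗ Z, V)] and [Hom(V^∨ ⊗ W, Z^∨)] have the same         *)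
(* dimension, the sum over [Z] can be carried out and                        *)
(* [G(W) = tau^- theta_W d_W]. Summing over [W] yields [tau^-] times the     *)
(* trace of the twist of [X ⊗ Y], that is [tau^- theta_X theta_Y S_{X,Y}].   *)
(* Finally, the summand is constant on the orbits of the characters of [A],  *)
(* which have [#|A|] elements if the stabilizers are trivial, and it vanishes*)
(* at the [Z] with a nontrivial stabilizer.                                  *)

Require Import Defs.
From HB Require Import structures.
From mathcomp Require Import all_boot all_order all_algebra all_fingroup.
From mathcomp Require Import all_solvable separable cyclotomic.
From mathcomp Require Import mxrepresentation mxtens ring boolp classical_sets.

Set Implicit Arguments.
Unset Strict Implicit.
Unset Printing Implicit Defensive.

Import GRing.Theory.
Local Open Scope ring_scope.
Local Open Scope cat_scope.

(** * Monoidal coherence *)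

(** Entrywise, the claim evaluates the sum of S_{x,v} theta_v^-1 S_{v,y} over representatives [v],
    for [x] of degree a^-1 and [y] of degree a. It is the relation between S and T of modular data,
    restricted to the trivial component.

    The unrestricted sum over I_1 is [gauss_Smat]. By [Smat_tens] the product S_{v,x} S_{v,y} is
    linear in the constituents [w] of x ⊗ y, all of degree 1. The remaining sum over [v] is
    [gauss_sum], with value tau^- theta_w d_w, and [twist_sum] recognises the total as a trace of
    the twist of x ⊗ y. Everything rests on the balancing formula [twist_tens]. Since sphericity is
    not assumed, left and right dimensions differ; [theta_dual_qdim] and [Smat_dual_qdim] control
    the difference.

    The passage to representatives uses the characters. If a nontrivial alpha fixes [v], then
    S_{y,v} = alpha(a) S_{y,v} with alpha(a) different from 1, so the term vanishes ([Smat_stab0]).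
    On a free orbit, tensoring with X_alpha multiplies the term by alpha(a^-1) alpha(a)
    dim^R(X_alpha)^2 = 1, and the orbit has #A elements ([card_orbit]), whence the factor 1/#A
    ([sum_orbits]).

    The graphical calculus behind these formulas is made strict by letting a morphism from X ⊗ Y act
    on X ⊗ (Y ⊗ T), naturally in T. *)

Section Composition.
Variables (k : fieldType) (C : lincat k).
Implicit Types X Y Z W V : C.

(** Composites are kept associated to the left, so a relation between adjacent factors must be
    usable under an arbitrary prefix [x]; [comp3r] serves three factors. *)
Lemma comp2r X Y Z W (f : mor X Y) (g : mor Y Z) (r : mor X Z) :
  g ∘ f = r -> forall x : mor Z W, x ∘ g ∘ f = x ∘ r.
Proof. by move=> <- x; rewrite compmA. Qed.

Lemma comp3r X Y Z W V (e : mor V X) (f : mor X Y) (g : mor Y Z) (r : mor V Z) :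
  g ∘ f ∘ e = r -> forall x : mor Z W, x ∘ g ∘ f ∘ e = x ∘ r.
Proof. by move=> <- x; rewrite !compmA. Qed.

Lemma compDl X Y Z (g h : mor Y Z) (f : mor X Y) : (g + h) ∘ f = g ∘ f + h ∘ f.
Proof. by have := comp_linearl f 1 g h; rewrite !scale1r. Qed.

Lemma compDr X Y Z (g : mor Y Z) (f h : mor X Y) : g ∘ (f + h) = g ∘ f + g ∘ h.
Proof. by have := comp_linearr g 1 f h; rewrite !scale1r. Qed.

Lemma comp0m X Y Z (f : mor X Y) : (0 : mor Y Z) ∘ f = 0.
Proof. by apply: (addrI ((0 : mor Y Z) ∘ f)); rewrite -compDl !addr0. Qed.

Lemma compm0 X Y Z (g : mor Y Z) : g ∘ (0 : mor X Y) = 0.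
Proof. by apply: (addrI (g ∘ (0 : mor X Y))); rewrite -compDr !addr0. Qed.

Lemma compZl X Y Z c (g : mor Y Z) (f : mor X Y) : (c *: g) ∘ f = c *: (g ∘ f).
Proof. by have := comp_linearl f c g 0; rewrite comp0m !addr0. Qed.

Lemma compZr X Y Z c (g : mor Y Z) (f : mor X Y) : g ∘ (c *: f) = c *: (g ∘ f).
Proof. by have := comp_linearr g c f 0; rewrite compm0 !addr0. Qed.

Lemma comp_suml (J : finType) X Y Z (g : J -> mor Y Z) (f : mor X Y) :
  (\sum_j g j) ∘ f = \sum_j (g j ∘ f).
Proof. by apply: (big_morph (fun g => g ∘ f)) => [? ?|]; rewrite ?compDl ?comp0m. Qed.

Lemma comp_sumr (J : finType) X Y Z (g : mor Y Z) (f : J -> mor X Y) :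
  g ∘ (\sum_j f j) = \sum_j (g ∘ f j).
Proof. by apply: (big_morph (fun f => g ∘ f)) => [? ?|]; rewrite ?compDr ?compm0. Qed.

Lemma iso_id X : iso_mor (idmor X).
Proof. by exists (idmor X); rewrite comp1m. Qed.

Lemma iso_comp X Y Z (g : mor Y Z) (f : mor X Y) :
  iso_mor g -> iso_mor f -> iso_mor (g ∘ f).
Proof.
move=> [g' [g'g gg']] [f' [f'f ff']]; exists (f' ∘ g'); split.
  by rewrite !compmA (comp2r g'g) compm1 f'f.
by rewrite !compmA (comp2r ff') compm1 gg'.
Qed.

Lemma isomorphic_refl X : isomorphic X X.
Proof. by exists (idmor X); apply: iso_id. Qed.

Lemma isomorphic_sym X Y : isomorphic X Y -> isomorphic Y X.
Proof. by move=> [f [g [gf fg]]]; exists g, f. Qed.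

Lemma isomorphic_trans X Y Z : isomorphic X Y -> isomorphic Y Z -> isomorphic X Z.
Proof. by move=> [f fP] [g gP]; exists (g ∘ f); apply: iso_comp. Qed.

Lemma iso_mono X Y (f : mor X Y) : iso_mor f -> mono_mor f.
Proof. by move=> [g [gf _]] Z a b /(congr1 (compm g)); rewrite !compmA gf !comp1m. Qed.

Lemma iso_epi X Y (f : mor X Y) : iso_mor f -> epi_mor f.
Proof.
by move=> [g [_ fg]] Z a b /(congr1 (fun x => compm x g)); rewrite -!compmA fg !compm1.
Qed.

End Composition.

Section Monoidal.
Variables (k : fieldType) (C : moncat k).
Implicit Types X Y Z W V T : C.

Lemma tensDl X X' Y Y' (f f' : mor X X') (g : mor Y Y') :
  (f + f') ⊠ g = f ⊠ g + f' ⊠ g.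
Proof. by have := tensm_linearl g 1 f f'; rewrite !scale1r. Qed.

Lemma tensDr X X' Y Y' (f : mor X X') (g g' : mor Y Y') :
  f ⊠ (g + g') = f ⊠ g + f ⊠ g'.
Proof. by have := tensm_linearr f 1 g g'; rewrite !scale1r. Qed.

Lemma tens0m X X' Y Y' (g : mor Y Y') : (0 : mor X X') ⊠ g = 0.
Proof. by apply: (addrI ((0 : mor X X') ⊠ g)); rewrite -tensDl !addr0. Qed.

Lemma tensm0 X X' Y Y' (f : mor X X') : f ⊠ (0 : mor Y Y') = 0.
Proof. by apply: (addrI (f ⊠ (0 : mor Y Y'))); rewrite -tensDr !addr0. Qed.

Lemma tensZl X X' Y Y' c (f : mor X X') (g : mor Y Y') : (c *: f) ⊠ g = c *: (f ⊠ g).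
Proof. by have := tensm_linearl g c f 0; rewrite tens0m !addr0. Qed.

Lemma tensZr X X' Y Y' c (f : mor X X') (g : mor Y Y') : f ⊠ (c *: g) = c *: (f ⊠ g).
Proof. by have := tensm_linearr f c g 0; rewrite tensm0 !addr0. Qed.

Lemma tens_suml (J : finType) X X' Y Y' (f : J -> mor X X') (g : mor Y Y') :
  (\sum_j f j) ⊠ g = \sum_j (f j ⊠ g).
Proof. by apply: (big_morph (fun f => f ⊠ g)) => [? ?|]; rewrite ?tensDl ?tens0m. Qed.

Lemma tens_sumr (J : finType) X X' Y Y' (f : mor X X') (g : J -> mor Y Y') :
  f ⊠ (\sum_j g j) = \sum_j (f ⊠ g j).
Proof. by apply: (big_morph (fun g => f ⊠ g)) => [? ?|]; rewrite ?tensDr ?tensm0. Qed.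

Lemma tens_compl X X' X'' Y (f : mor X' X'') (g : mor X X') :
  (f ∘ g) ⊠ idmor Y = (f ⊠ idmor Y) ∘ (g ⊠ idmor Y).
Proof. by rewrite -tensm_comp comp1m. Qed.

Lemma tens_compr X Y Y' Y'' (f : mor Y' Y'') (g : mor Y Y') :
  idmor X ⊠ (f ∘ g) = (idmor X ⊠ f) ∘ (idmor X ⊠ g).
Proof. by rewrite -tensm_comp comp1m. Qed.

Lemma tens_split X X' Y Y' (f : mor X X') (g : mor Y Y') :
  (f ⊠ idmor _) ∘ (idmor _ ⊠ g) = f ⊠ g.
Proof. by rewrite -tensm_comp comp1m compm1. Qed.

Lemma tens_split' X X' Y Y' (f : mor X X') (g : mor Y Y') :
  (idmor _ ⊠ g) ∘ (f ⊠ idmor _) = f ⊠ g.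
Proof. by rewrite -tensm_comp comp1m compm1. Qed.

Lemma tens_exch X X' Y Y' (f : mor X X') (g : mor Y Y') :
  (idmor _ ⊠ g) ∘ (f ⊠ idmor _) = (f ⊠ idmor _) ∘ (idmor _ ⊠ g).
Proof. by rewrite tens_split tens_split'. Qed.

Lemma iso_tens X X' Y Y' (f : mor X X') (g : mor Y Y') :
  iso_mor f -> iso_mor g -> iso_mor (f ⊠ g).
Proof.
move=> [f' [f'f ff']] [g' [g'g gg']]; exists (f' ⊠ g'); rewrite -!tensm_comp.
by rewrite f'f ff' g'g gg' !tensm1.
Qed.

Lemma assocV_nat X X' Y Y' Z Z' (f : mor X X') (g : mor Y Y') (h : mor Z Z') :
  assocV X' Y' Z' ∘ (f ⊠ (g ⊠ h)) = ((f ⊠ g) ⊠ h) ∘ assocV X Y Z.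
Proof.
rewrite -[LHS]compm1 -(assocKV X Y Z) !compmA.
by rewrite (comp2r (esym (assoc_nat f g h))) compmA assocVK comp1m.
Qed.

Lemma lunitV_nat X Y (f : mor X Y) : lunitV Y ∘ f = (idmor tunit ⊠ f) ∘ lunitV X.
Proof.
rewrite -[LHS]compm1 -(lunitKV X) !compmA (comp2r (esym (lunit_nat f))).
by rewrite compmA lunitVK comp1m.
Qed.

Lemma tensm1l_inj X Y (f g : mor X Y) :
  idmor (tunit : C) ⊠ f = idmor tunit ⊠ g -> f = g.
Proof.
by move=> E; rewrite -[f]compm1 -[g]compm1 -(lunitKV X) !compmA -!lunit_nat E.
Qed.

Lemma tensm1r_inj X Y (f g : mor X Y) :
  f ⊠ idmor (tunit : C) = g ⊠ idmor tunit -> f = g.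
Proof.
by move=> E; rewrite -[f]compm1 -[g]compm1 -(runitKV X) !compmA -!runit_nat E.
Qed.

Lemma iso_assoc X Y Z : iso_mor (assoc X Y Z).
Proof. by exists (assocV X Y Z); rewrite assocVK assocKV. Qed.

Lemma iso_assocV X Y Z : iso_mor (assocV X Y Z).
Proof. by exists (assoc X Y Z); rewrite assocVK assocKV. Qed.

(* Kelly's coherence lemma. *)
Lemma lunit_assoc X Y : lunit (X ⊗ Y) ∘ assoc tunit X Y = lunit X ⊠ idmor Y.
Proof.
apply: tensm1l_inj.
apply: (iso_epi (iso_comp (iso_assoc tunit (tunit ⊗ X) Y)
                   (iso_tens (iso_assoc tunit tunit X) (iso_id Y)))).
rewrite tens_compr !compmA (comp3r (esym (pentagon _ _ _ _))) compmA triangle.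
rewrite -[idmor (X ⊗ Y)]tensm1 -!assoc_nat (comp2r (esym (tens_compl _ _ _))).
by rewrite triangle.
Qed.

Lemma lunit_assocV X Y : (lunit X ⊠ idmor Y) ∘ assocV tunit X Y = lunit (X ⊗ Y).
Proof. by rewrite -lunit_assoc -compmA assocKV compm1. Qed.

Lemma assocV_lunitV X Y : assocV tunit X Y ∘ lunitV (X ⊗ Y) = lunitV X ⊠ idmor Y.
Proof.
apply: (iso_mono (f := lunit X ⊠ idmor Y)).
  by apply: iso_tens (iso_id Y); exists (lunitV X); rewrite lunitKV lunitVK.
by rewrite compmA lunit_assocV lunitKV -tens_compl lunitKV tensm1.
Qed.

Lemma triangle' X Y : (runit X ⊠ idmor Y) ∘ assocV X tunit Y = idmor X ⊠ lunit Y.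
Proof. by rewrite -triangle -compmA assocKV compm1. Qed.

Lemma triangleV X Y :
  assocV X tunit Y ∘ (idmor X ⊠ lunitV Y) = runitV X ⊠ idmor Y.
Proof.
apply: (iso_mono (f := runit X ⊠ idmor Y)).
  by apply: iso_tens (iso_id Y); exists (runitV X); rewrite runitKV runitVK.
by rewrite compmA triangle' -tens_compr -tens_compl lunitKV runitKV !tensm1.
Qed.

End Monoidal.

(** * Left action of words of objects *)

Section LeftAction.
Variables (k : fieldType) (C : moncat k).
Implicit Types X Y Z W T U : C.

(* A morphism from [X ⊗ Y] is represented by its action on [X ⊗ (Y ⊗ T)],    *)
(* natural in [T]: the calculus of duals and braidings then involves no       *)
(* associator. The definitions are locked because rewriting with [compmA]     *)
(* would otherwise unfold them.                                               *)
Definition homT X Y Z W (f : mor (X ⊗ Y) (Z ⊗ W)) T : mor (X ⊗ (Y ⊗ T)) (Z ⊗ (W ⊗ T)) :=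
  locked (assoc Z W T ∘ (f ⊠ idmor T) ∘ assocV X Y T).

Definition pairT X Y (e : mor (X ⊗ Y) tunit) T : mor (X ⊗ (Y ⊗ T)) T :=
  locked (lunit T ∘ (e ⊠ idmor T) ∘ assocV X Y T).

Definition copairT X Y (n : mor tunit (X ⊗ Y)) T : mor T (X ⊗ (Y ⊗ T)) :=
  locked (assoc X Y T ∘ (n ⊠ idmor T) ∘ lunitV T).

Lemma homTE X Y Z W (f : mor (X ⊗ Y) (Z ⊗ W)) T :
  homT f T = assoc Z W T ∘ (f ⊠ idmor T) ∘ assocV X Y T.
Proof. by rewrite /homT -lock. Qed.

Lemma pairTE X Y (e : mor (X ⊗ Y) tunit) T :
  pairT e T = lunit T ∘ (e ⊠ idmor T) ∘ assocV X Y T.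
Proof. by rewrite /pairT -lock. Qed.

Lemma copairTE X Y (n : mor tunit (X ⊗ Y)) T :
  copairT n T = assoc X Y T ∘ (n ⊠ idmor T) ∘ lunitV T.
Proof. by rewrite /copairT -lock. Qed.

Lemma homT1 X Y T : homT (idmor (X ⊗ Y)) T = idmor _.
Proof. by rewrite !homTE tensm1 compm1 assocKV. Qed.

Lemma homT_comp X Y Z W X' Y' (f : mor (X ⊗ Y) (Z ⊗ W)) (g : mor (Z ⊗ W) (X' ⊗ Y')) T :
  homT (g ∘ f) T = homT g T ∘ homT f T.
Proof. by rewrite !homTE !compmA (comp2r (assocVK _ _ _)) compm1 tens_compl !compmA. Qed.

Lemma homT_tens X Y X' Y' (f : mor X X') (g : mor Y Y') T :
  homT (f ⊠ g) T = f ⊠ (g ⊠ idmor T).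
Proof. by rewrite !homTE assoc_nat -compmA assocKV compm1. Qed.

Lemma homT_nat X Y Z W (f : mor (X ⊗ Y) (Z ⊗ W)) T U (h : mor T U) :
  homT f U ∘ (idmor X ⊠ (idmor Y ⊠ h)) = (idmor Z ⊠ (idmor W ⊠ h)) ∘ homT f T.
Proof.
rewrite !homTE !compmA -assoc_nat (comp2r (assocV_nat _ _ _)) compmA !tensm1.
by rewrite (comp2r (tens_split _ _)) (comp2r (tens_split' _ _)).
Qed.

Lemma pairT_nat X Y (e : mor (X ⊗ Y) tunit) T U (h : mor T U) :
  pairT e U ∘ (idmor X ⊠ (idmor Y ⊠ h)) = h ∘ pairT e T.
Proof.
rewrite !pairTE !compmA -lunit_nat (comp2r (assocV_nat _ _ _)) compmA !tensm1.
by rewrite (comp2r (tens_split _ _)) (comp2r (tens_split' _ _)).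
Qed.

Lemma copairT_nat X Y (n : mor tunit (X ⊗ Y)) T U (h : mor T U) :
  copairT n U ∘ h = (idmor X ⊠ (idmor Y ⊠ h)) ∘ copairT n T.
Proof.
rewrite !copairTE !compmA -assoc_nat (comp2r (lunitV_nat _)) compmA !tensm1.
by rewrite (comp2r (tens_split _ _)) (comp2r (tens_split' _ _)).
Qed.

Lemma pairT_comp X Y Z W (e : mor (Z ⊗ W) tunit) (f : mor (X ⊗ Y) (Z ⊗ W)) T :
  pairT (e ∘ f) T = pairT e T ∘ homT f T.
Proof.
by rewrite !homTE !pairTE !compmA (comp2r (assocVK _ _ _)) compm1 tens_compl !compmA.
Qed.

Lemma copairT_comp X Y Z W (n : mor tunit (X ⊗ Y)) (f : mor (X ⊗ Y) (Z ⊗ W)) T :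
  copairT (f ∘ n) T = homT f T ∘ copairT n T.
Proof.
by rewrite !homTE !copairTE !compmA (comp2r (assocVK _ _ _)) compm1 tens_compl !compmA.
Qed.

Lemma pairTZ X Y c (e : mor (X ⊗ Y) tunit) T : pairT (c *: e) T = c *: pairT e T.
Proof. by rewrite !pairTE tensZl compZr compZl. Qed.

(** The action on T = 1 already recovers the morphism, so identities may be checked in the left
    action and brought back. *)
Lemma pairT_inj X Y (e e' : mor (X ⊗ Y) tunit) :
  pairT e tunit = pairT e' tunit -> e = e'.
Proof.
move=> E; apply: tensm1r_inj; apply: (iso_epi (iso_assocV X Y tunit)).
apply: (iso_mono (f := lunit tunit)).
  by exists (lunitV tunit); rewrite lunitVK lunitKV.
by rewrite !compmA -!pairTE.
Qed.

Lemma copairT_inj X Y (n n' : mor tunit (X ⊗ Y)) :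
  copairT n tunit = copairT n' tunit -> n = n'.
Proof.
move=> E; apply: tensm1r_inj; apply: (iso_mono (iso_assoc X Y tunit)).
apply: (iso_epi (f := lunitV tunit)).
  by exists (lunit tunit); rewrite lunitVK lunitKV.
by rewrite -!copairTE.
Qed.

Lemma homT_inj X Y Z W (f g : mor (X ⊗ Y) (Z ⊗ W)) :
  homT f tunit = homT g tunit -> f = g.
Proof.
rewrite !homTE => E; apply: tensm1r_inj; apply: (iso_epi (iso_assocV X Y tunit)).
by apply: (iso_mono (iso_assoc Z W tunit)); rewrite !compmA.
Qed.

Lemma tens1T X T (f : mor tunit tunit) c : f = c *: idmor (tunit : C) ->
  lunit T ∘ (f ⊠ idmor T) ∘ lunitV T = c *: idmor T.
Proof. by move=> ->; rewrite tensZl compZr compZl tensm1 compm1 lunitKV. Qed.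

Lemma pair_copair X Y (e : mor (X ⊗ Y) tunit) n c T :
  e ∘ n = c *: idmor tunit -> pairT e T ∘ copairT n T = c *: idmor T.
Proof.
move=> E; rewrite -(tens1T T T E) !pairTE !copairTE !compmA.
by rewrite (comp2r (assocVK _ _ _)) compm1 tens_compl !compmA.
Qed.

Lemma pentagonV X Y T U :
  assocV X Y (T ⊗ U) ∘ (idmor X ⊠ assoc Y T U) ∘ assoc X (Y ⊗ T) U =
  assoc (X ⊗ Y) T U ∘ (assocV X Y T ⊠ idmor U).
Proof.
apply: (iso_mono (iso_assoc X Y (T ⊗ U))).
apply: (iso_epi (iso_tens (iso_assoc X Y T) (iso_id U))).
rewrite !compmA assocKV comp1m -pentagon (comp2r (esym (tens_compl _ _ _))).
by rewrite assocVK tensm1 compm1.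
Qed.

Lemma pentagonA X Y T U :
  (idmor X ⊠ assocV Y T U) ∘ assoc X Y (T ⊗ U) =
  assoc X (Y ⊗ T) U ∘ (assoc X Y T ⊠ idmor U) ∘ assocV (X ⊗ Y) T U.
Proof.
apply: (iso_mono (iso_tens (iso_id X) (iso_assoc Y T U))).
rewrite !compmA -tens_compr assocKV tensm1 comp1m -pentagon.
by rewrite (comp2r (assocKV _ _ _)) compm1.
Qed.

Lemma pentagonB X Y T U :
  assocV X Y (T ⊗ U) ∘ (idmor X ⊠ assoc Y T U) =
  assoc (X ⊗ Y) T U ∘ (assocV X Y T ⊠ idmor U) ∘ assocV X (Y ⊗ T) U.
Proof.
by rewrite -pentagonV (comp2r (assocKV _ _ _)) compm1.
Qed.

Lemma pentagonI X Y T U :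
  (assocV X Y T ⊠ idmor U) ∘ assocV X (Y ⊗ T) U ∘ (idmor X ⊠ assocV Y T U) =
  assocV (X ⊗ Y) T U ∘ assocV X Y (T ⊗ U).
Proof.
apply: (iso_epi (iso_assoc X Y (T ⊗ U))).
rewrite (comp2r (assocVK _ _ _)) compm1 (comp2r (pentagonA _ _ _ _)) !compmA.
by rewrite (comp2r (assocVK _ _ _)) compm1 -tens_compl assocVK tensm1 comp1m.
Qed.

Lemma homT_copair_pair X Y Z W (n : mor tunit (Z ⊗ W)) (e : mor (X ⊗ Y) tunit) T :
  homT (n ∘ e) T = copairT n T ∘ pairT e T.
Proof.
by rewrite homTE copairTE pairTE tens_compl !compmA (comp2r (lunitVK _)) compm1.
Qed.

Lemma pairT_tens X Y (e : mor (X ⊗ Y) tunit) T U :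
  pairT e T ⊠ idmor U =
  pairT e (T ⊗ U) ∘ (idmor X ⊠ assoc Y T U) ∘ assoc X (Y ⊗ T) U.
Proof.
rewrite !pairTE !tens_compl -lunit_assoc -[idmor (T ⊗ U)]tensm1.
rewrite (comp2r (assoc_nat _ _ _)) compmA.
by rewrite (comp3r (pentagonV _ _ _ _)) compmA.
Qed.

Lemma tens_tens1 X Y Y' U (g : mor Y Y') :
  (idmor X ⊠ g) ⊠ idmor U = assocV X Y' U ∘ (idmor X ⊠ (g ⊠ idmor U)) ∘ assoc X Y U.
Proof. by rewrite -compmA -assoc_nat compmA assocVK comp1m. Qed.

(** This is the shape of the evaluation of a tensor product, as it enters [dual_tens]. *)
Lemma pairT_nest X Y (e : mor (X ⊗ Y) tunit) V W
    (e' : mor (V ⊗ W) tunit) T :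
  pairT (e' ∘ (idmor V ⊠ pairT e W) ∘ assoc V X (Y ⊗ W)) T =
  pairT e' T ∘ (idmor V ⊠ pairT e (W ⊗ T))
   ∘ (idmor V ⊠ (idmor X ⊠ assoc Y W T)) ∘ assoc V X ((Y ⊗ W) ⊗ T).
Proof.
rewrite [LHS]pairTE [pairT e' T]pairTE !tens_compl !compmA tens_tens1 pairT_tens !compmA.
rewrite !tens_compr !compmA.
rewrite (comp3r (esym (pentagon _ _ _ _))) !compmA.
by rewrite (comp2r (assocKV _ _ _)) compm1.
Qed.
End LeftAction.

Notation evT X T := (pairT (ev X) T).
Notation coevT X T := (copairT (coev X) T).

(** * Duals in the left action *)

Section RigidAction.
Variables (k : fieldType) (C : rigidcat k).
Implicit Types X Y Z W T U : C.

Lemma zigT X T : (idmor X ⊠ evT X T) ∘ coevT X (X ⊗ T) = idmor (X ⊗ T).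
Proof.
have := congr1 (fun f => f ⊠ idmor T) (zigzag X); rewrite tensm1 => <-.
rewrite !tens_compl !pairTE !copairTE.
rewrite -assocV_lunitV -triangle !tens_compr !compmA.
rewrite (comp2r (esym (assocV_nat _ _ _))) compmA tensm1.
rewrite (comp2r (assoc_nat _ _ _)) compmA.
congr (_ ∘ _ ∘ _); rewrite -!compmA; congr (_ ∘ (_ ∘ _)).
by rewrite pentagonA compmA.
Qed.

Lemma zagT X T : evT X (X^∨ ⊗ T) ∘ (idmor (X^∨) ⊠ coevT X T) = idmor (X^∨ ⊗ T).
Proof.
have := congr1 (fun f => f ⊠ idmor T) (zagzig X); rewrite tensm1 => <-.
rewrite !tens_compl !pairTE !copairTE.
rewrite -triangleV -lunit_assoc !tens_compr !compmA.
rewrite (comp2r (assoc_nat _ _ _)) compmA tensm1.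
rewrite (comp2r (esym (pentagonV _ _ _ _))) !compmA.
by rewrite (comp2r (assoc_nat _ _ _)) !compmA (comp2r (assocKV _ _ _)) compm1.
Qed.

Lemma mateT X Y (e : mor (Y ⊗ X) tunit) T :
  mate e ⊠ idmor T = pairT e (X^∨ ⊗ T) ∘ (idmor Y ⊠ coevT X T).
Proof.
rewrite /mate !tens_compl !pairTE !copairTE.
rewrite -triangleV -lunit_assoc !tens_compr !compmA.
rewrite (comp2r (assoc_nat _ _ _)) compmA tensm1.
rewrite (comp2r (esym (pentagonV _ _ _ _))) !compmA.
by rewrite (comp2r (assoc_nat _ _ _)) !compmA (comp2r (assocKV _ _ _)) compm1.
Qed.

Lemma ev_mateT X Y (e : mor (Y ⊗ X) tunit) T :
  evT X T ∘ (mate e ⊠ idmor _) = pairT e T.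
Proof.
rewrite mateT compmA -pairT_nat -compmA -tens_compr.
by rewrite zigT tensm1 compm1.
Qed.

Lemma ev_mate X Y (e : mor (Y ⊗ X) tunit) : ev X ∘ (mate e ⊠ idmor X) = e.
Proof.
by apply: pairT_inj; rewrite pairT_comp homT_tens tensm1 ev_mateT.
Qed.

Lemma mateK X Y (g : mor Y (X^∨)) : mate (ev X ∘ (g ⊠ idmor X)) = g.
Proof.
apply: tensm1r_inj; rewrite mateT pairT_comp homT_tens tensm1.
by rewrite -compmA -tens_exch compmA zagT comp1m.
Qed.

Lemma ev_inj X Y (g g' : mor Y (X^∨)) :
  ev X ∘ (g ⊠ idmor X) = ev X ∘ (g' ⊠ idmor X) -> g = g'.
Proof. by move=> E; rewrite -(mateK g) E mateK. Qed.

Lemma ev_dualm X Y (f : mor X Y) : ev X ∘ (dualm f ⊠ idmor X) = ev Y ∘ (idmor _ ⊠ f).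
Proof. exact: ev_mate. Qed.

Lemma evT_dualm X Y (f : mor X Y) T :
  evT X T ∘ (dualm f ⊠ idmor _) = evT Y T ∘ (idmor _ ⊠ (f ⊠ idmor T)).
Proof. by rewrite ev_mateT pairT_comp homT_tens. Qed.

(** Uniqueness of the coevaluation: insert the zigzag of [n] after [coevT], slide by naturality, and
    straighten with [zagT]. *)
Lemma coevT_unique X (n : forall T, mor T (X ⊗ (X^∨ ⊗ T))) :
    (forall T U (h : mor T U), n U ∘ h = (idmor X ⊠ (idmor _ ⊠ h)) ∘ n T) ->
    (forall T, (idmor X ⊠ evT X T) ∘ n (X ⊗ T) = idmor _) ->
  forall T, n T = coevT X T.
Proof.
move=> n_nat n_zig T.
rewrite -[RHS]comp1m -n_zig -compmA n_nat compmA -tens_compr zagT.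
by rewrite tensm1 comp1m.
Qed.

Lemma coevT_dualm X Y (f : mor X Y) T :
  (f ⊠ idmor _) ∘ coevT X T = (idmor _ ⊠ (dualm f ⊠ idmor T)) ∘ coevT Y T.
Proof.
rewrite -[LHS]comp1m -(zigT Y) -compmA copairT_nat compmA -tens_compr; congr (_ ⊠ _ ∘ _).
rewrite tens_compr compmA -evT_dualm -compmA -tens_exch compmA.
by rewrite zagT comp1m.
Qed.

Lemma dual_tensE X Y :
  dual_tens X Y =
  mate (ev Y ∘ (idmor (Y^∨) ⊠ evT X Y) ∘ assoc (Y^∨) (X^∨) (X ⊗ Y)).
Proof. by rewrite pairTE. Qed.

Lemma evT_dual_tens X Y T :
  evT (X ⊗ Y) T ∘ (dual_tens X Y ⊠ idmor _) =
  evT Y T ∘ (idmor (Y^∨) ⊠ evT X (Y ⊗ T))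
   ∘ (idmor _ ⊠ (idmor _ ⊠ assoc X Y T)) ∘ assoc (Y^∨) (X^∨) ((X ⊗ Y) ⊗ T).
Proof. by rewrite dual_tensE ev_mateT pairT_nest. Qed.

(** The nested coevaluations, carried along [dual_tens], satisfy the zigzag with the evaluation of X
    ⊗ Y, so [coevT_unique] applies. *)
Lemma coevT_tens X Y T :
  coevT (X ⊗ Y) T =
  assocV X Y _ ∘ (idmor X ⊠ (idmor Y ⊠ ((dual_tens X Y ⊠ idmor T) ∘ assocV _ _ T)))
    ∘ (idmor X ⊠ coevT Y (X^∨ ⊗ T)) ∘ coevT X T.
Proof.
pose D T := (dual_tens X Y ⊠ idmor T) ∘ assocV _ _ T.
have D_nat T' U (h : mor T' U) : D U ∘ (idmor _ ⊠ (idmor _ ⊠ h)) = (idmor _ ⊠ h) ∘ D T'.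
  by rewrite /D -compmA assocV_nat tensm1 !compmA tens_split tens_split'.
symmetry; move: T; apply: coevT_unique => [T U h|T]; rewrite -!/(D _).
  rewrite -compmA copairT_nat compmA (comp2r (esym (tens_compr _ _ _))) copairT_nat.
  rewrite tens_compr !compmA (comp2r (esym (tens_compr _ (idmor Y ⊠ D U) _))).
  rewrite -tens_compr D_nat.
  by rewrite !tens_compr !compmA -[idmor (X ⊗ Y)]tensm1 -assocV_nat.
apply: (iso_mono (iso_assoc X Y T)).
rewrite compm1 !compmA -[idmor (X ⊗ Y)]tensm1 assoc_nat.
rewrite (comp2r (assocKV _ _ _)) compm1 -!tens_compr /D compmA evT_dual_tens.
rewrite (comp2r (assocKV _ _ _)) compm1 -compmA -tens_compr.
rewrite [X in _ ⊠ (X ∘ _)]tens_compr (comp2r (esym (copairT_nat _ _))) compmA zigT comp1m.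
rewrite tens_compr (comp2r (esym (copairT_nat _ _))) compmA.
by rewrite zigT comp1m.
Qed.

End RigidAction.

(** * Pivotal traces *)

(** The conclusion of Schur's lemma, used in place of simplicity because it passes easily to duals
    and to products with invertible objects ([dual_brick], [tens_invertible_brick]). In the fusion
    category the two notions agree up to isomorphism, by [simple_brick] and [brick_isomorphic]. *)
Definition brick (k : fieldType) (C : lincat k) (X : C) : Prop :=
  idmor X <> 0 /\ forall f : mor X X, exists c, f = c *: idmor X.

Lemma brick_scalar (k : fieldType) (C : lincat k) (X : C) (f : mor X X) :
  brick X -> f = scalar_of f *: idmor X.
Proof.
move=> [/eqP nz /(_ f) [c fc]]; rewrite {2}fc.
by rewrite scalar_ofZ.
Qed.

Lemma brick_scaleI (k : fieldType) (C : lincat k) (X : C) (c c' : k) :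
  brick X -> c *: idmor X = c' *: idmor X -> c = c'.
Proof. by move=> [/eqP nz _] E; rewrite -[c](scalar_ofZ c nz) E scalar_ofZ. Qed.

Section Pivotal.
Variables (k : fieldType) (C : bpcat k).
Implicit Types X Y Z W T U : C.
Hypothesis unit_brick : brick (tunit : C).

(** With [pcoev], this makes [X^∨] a dual of [X] on the other side ([rzigT], [rzagT]). *)
Definition pev X : mor (X ⊗ X^∨) tunit :=
  locked (ev (X^∨) ∘ (piv X ⊠ idmor _)).
Definition pcoev X : mor tunit (X^∨ ⊗ X) :=
  locked ((idmor _ ⊠ pivV X) ∘ coev (X^∨)).

Lemma pevE X : pev X = ev (X^∨) ∘ (piv X ⊠ idmor _).
Proof. by rewrite /pev -lock. Qed.

Lemma pcoevE X : pcoev X = (idmor _ ⊠ pivV X) ∘ coev (X^∨).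
Proof. by rewrite /pcoev -lock. Qed.

Notation pevT X T := (pairT (pev X) T).
Notation pcoevT X T := (copairT (pcoev X) T).

Lemma pevTE X T : pevT X T = evT (X^∨) T ∘ (piv X ⊠ idmor _).
Proof. by rewrite pevE pairT_comp homT_tens tensm1. Qed.

Lemma pcoevTE X T : pcoevT X T = (idmor _ ⊠ (pivV X ⊠ idmor T)) ∘ coevT (X^∨) T.
Proof. by rewrite pcoevE copairT_comp homT_tens. Qed.

Lemma coevT_dual X T : coevT (X^∨) T = (idmor _ ⊠ (piv X ⊠ idmor T)) ∘ pcoevT X T.
Proof.
by rewrite pcoevTE compmA -tens_compr -tens_compl pivKV !tensm1 comp1m.
Qed.

Lemma rzigT X T : (idmor _ ⊠ pevT X T) ∘ pcoevT X (X^∨ ⊗ T) = idmor _.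
Proof.
rewrite pevTE pcoevTE compmA -tens_compr -compmA -tens_compl pivKV tensm1 compm1.
exact: zigT.
Qed.

Lemma rzagT X T : pevT X (X ⊗ T) ∘ (idmor X ⊠ pcoevT X T) = idmor _.
Proof.
apply: (iso_mono (f := piv X ⊠ idmor T)).
  by apply: iso_tens (iso_id T); exists (pivV X); rewrite pivVK pivKV.
rewrite compmA -pairT_nat compm1 -compmA -tens_compr pcoevTE compmA -tens_compr.
rewrite -tens_compl pivKV !tensm1 comp1m pevTE -compmA -tens_exch compmA.
by rewrite zagT comp1m.
Qed.

Lemma pev_dinat X Y (f : mor X Y) :
  pev Y ∘ (f ⊠ idmor _) = pev X ∘ (idmor X ⊠ dualm f).
Proof.
rewrite !pevE -!compmA -tens_compl -piv_nat tens_compl compmA ev_dualm -compmA.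
by rewrite tens_exch.
Qed.

Lemma coev_dinat X Y (f : mor X Y) :
  (f ⊠ idmor _) ∘ coev X = (idmor _ ⊠ dualm f) ∘ coev Y.
Proof.
apply: copairT_inj; rewrite !copairT_comp !homT_tens tensm1.
exact: coevT_dualm.
Qed.

Lemma trRE X (f : mor X X) : trR f = scalar_of (pev X ∘ (f ⊠ idmor _) ∘ coev X).
Proof. by rewrite /trR pevE tens_compl compmA. Qed.

(** The morphism [f] slides over the cup as its transpose and returns over the cap; the return uses
    naturality of [piv]. *)
Lemma trR_cyc X Y (f : mor X Y) (g : mor Y X) : trR (g ∘ f) = trR (f ∘ g).
Proof.
rewrite !trRE !tens_compl !compmA; congr scalar_of.
rewrite (comp2r (coev_dinat f)) compmA (comp2r (esym (tens_exch _ _))).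
by rewrite compmA -pev_dinat.
Qed.

Lemma trR_iso X Y (f : mor X Y) (g : mor Y X) (h : mor X X) :
  g ∘ f = idmor X -> trR (f ∘ h ∘ g) = trR h.
Proof. by move=> gf; rewrite -trR_cyc compmA gf comp1m. Qed.

Lemma trRT X (f : mor X X) T :
  pevT X T ∘ (f ⊠ idmor _) ∘ coevT X T = trR f *: idmor T.
Proof.
rewrite trRE; have := brick_scalar (pev X ∘ (f ⊠ idmor _) ∘ coev X) unit_brick.
move/(pair_copair T); rewrite pairT_comp homT_tens tensm1; exact.
Qed.

Lemma trLT X (f : mor X X) T :
  evT X T ∘ (idmor _ ⊠ (f ⊠ idmor T)) ∘ pcoevT X T = trL f *: idmor T.
Proof.
rewrite /trL pcoevTE; set e := _ ∘ coev _.
have := brick_scalar e unit_brick.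
move/(pair_copair T); rewrite pairT_comp homT_tens => <-.
by rewrite tens_compl tens_compr !compmA.
Qed.

(** Here monoidality of the pivotal structure enters: it makes the cap of X ⊗ Y the nesting of the
    caps of [X] and [Y]. *)
Lemma pevT_dual_tens X Y T :
  pevT (X ⊗ Y) T ∘ (idmor _ ⊠ (dual_tens X Y ⊠ idmor T)) =
  pevT X T ∘ (idmor X ⊠ pevT Y (X^∨ ⊗ T)) ∘ assoc X Y _
    ∘ (idmor _ ⊠ assoc (Y^∨) (X^∨) T).
Proof.
rewrite pevTE -compmA -tens_exch compmA -evT_dualm -compmA -tens_compl piv_tens.
rewrite tens_compl compmA evT_dual_tens !pevTE.
rewrite (comp2r (assoc_nat _ _ _)) compmA.
rewrite -[idmor (X ⊗ Y)]tensm1 (comp2r (assoc_nat _ _ _)) compmA.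
congr (_ ∘ assoc _ _ _); rewrite -!compmA; congr (_ ∘ _).
by rewrite -!tensm_comp !comp1m !compm1 -compmA -tensm_comp comp1m compm1.
Qed.

Lemma trR_tensT X Y (f : mor (X ⊗ Y) (X ⊗ Y)) T :
  pevT X T ∘ (idmor X ⊠ pevT Y (X^∨ ⊗ T)) ∘ homT f (Y^∨ ⊗ (X^∨ ⊗ T))
    ∘ (idmor X ⊠ coevT Y (X^∨ ⊗ T)) ∘ coevT X T = trR f *: idmor T.
Proof.
rewrite -trRT coevT_tens homTE !compmA (comp2r (assocV_nat _ _ _)) compmA tensm1.
rewrite (comp2r (esym (tens_exch _ _))) compmA tens_compr compmA pevT_dual_tens.
by rewrite (comp2r (esym (tens_compr _ _ _))) assocKV tensm1 compm1.
Qed.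

(** The right partial trace, closing the strand [Y]. *)
Definition ptr X Y (f : mor (X ⊗ Y) (X ⊗ Y)) : mor X X :=
  locked (runit X ∘ (idmor X ⊠ pev Y) ∘ assoc X Y _ ∘ (f ⊠ idmor _) ∘ assocV X Y _
    ∘ (idmor X ⊠ coev Y) ∘ runitV X).

Lemma ptrT X Y (f : mor (X ⊗ Y) (X ⊗ Y)) T :
  ptr f ⊠ idmor T =
  (idmor X ⊠ pevT Y T) ∘ homT f (Y^∨ ⊗ T) ∘ (idmor X ⊠ coevT Y T).
Proof.
rewrite /ptr -lock pairTE copairTE homTE !tens_compl !tens_compr -triangle -triangleV !compmA.
rewrite (comp2r (pentagonA _ _ _ _)) !compmA (comp2r (pentagonB _ _ _ _)) !compmA.
rewrite -[idmor (Y^∨ ⊗ T)]tensm1 (comp2r (assocV_nat f _ _)) compmA.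
rewrite (comp2r (assocVK _ _ _)) compm1 (comp2r (assocV_nat _ _ _)) compmA.
by rewrite (comp2r (esym (assoc_nat _ _ _))) compmA.
Qed.

Lemma trR_ptr X Y (f : mor (X ⊗ Y) (X ⊗ Y)) : trR f = trR (ptr f).
Proof.
by apply: (brick_scaleI unit_brick); rewrite -trR_tensT -trRT ptrT !compmA.
Qed.

Lemma trRZ X c (f : mor X X) : trR (c *: f) = c * trR f.
Proof.
apply: (brick_scaleI unit_brick).
by rewrite -trRT tensZl compZr compZl trRT scalerA.
Qed.

Lemma trR_sum (J : finType) X (f : J -> mor X X) : trR (\sum_j f j) = \sum_j trR (f j).
Proof.
apply: (brick_scaleI unit_brick); rewrite -trRT tens_suml comp_sumr comp_suml scaler_suml.
by apply: eq_bigr => j _; rewrite trRT.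
Qed.

Lemma qdimR_isomorphic X Y : isomorphic X Y -> qdimR X = qdimR Y.
Proof. by move=> [f [g [gf fg]]]; rewrite /qdimR -gf trR_cyc fg. Qed.

Lemma ptr_id X Y : ptr (idmor (X ⊗ Y)) = qdimR Y *: idmor X.
Proof.
apply: tensm1r_inj; rewrite ptrT homT1 compm1 -tens_compr.
by have := trRT (idmor Y) (tunit : C); rewrite tensm1 compm1 => ->; rewrite tensZl tensZr.
Qed.

Lemma qdimR_tens X Y : qdimR (X ⊗ Y) = qdimR X * qdimR Y.
Proof. by rewrite /qdimR trR_ptr ptr_id trRZ mulrC. Qed.

Lemma qdimR_tunit : qdimR (tunit : C) != 0 -> qdimR (tunit : C) = 1.
Proof.
move=> nz; apply: (mulfI nz); rewrite mulr1 -qdimR_tens.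
apply: qdimR_isomorphic; exists (lunit _), (lunitV _).
by rewrite lunitVK lunitKV.
Qed.

(* Both sides are proportional; the factor is 1 because the trace of          *)
(* [coev X ∘ pev X] can be computed by cyclicity or strand by strand.         *)
Lemma pev_piv X : qdimR (tunit : C) != 0 -> qdimR X != 0 -> brick (X^∨) ->
  pev (X^∨) ∘ (idmor _ ⊠ piv X) = ev X.
Proof.
move=> nz1 nzX bX; set e := LHS.
have [s sE] : exists s, e = s *: ev X.
  have := brick_scalar (mate e) bX; set s := scalar_of _ => sE.
  by exists s; rewrite -(ev_mate e) sE tensZl compZr tensm1 compm1.
rewrite sE; suff -> : s = 1 by rewrite scale1r.
have eT T : pevT (X^∨) T ∘ (idmor _ ⊠ (piv X ⊠ idmor T)) = s *: evT X T.
  by rewrite -homT_tens -pairT_comp -/e sE pairTZ.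
have := trR_tensT (coev X ∘ pev X) (tunit : C).
rewrite trR_cyc.
have -> : pev X ∘ coev X = qdimR X *: idmor tunit.
  rewrite /qdimR trRE tensm1 compm1; exact: brick_scalar.
rewrite trRZ -/(qdimR _) qdimR_tunit // mulr1 homT_copair_pair !compmA.
rewrite coevT_dual tens_compr !compmA (comp2r (pairT_nat _ _)) compmA.
rewrite (comp2r (rzagT _ _)) compm1 (comp2r (copairT_nat _ _)) compmA.
rewrite (comp2r (esym (tens_compr _ _ _))) eT tensZr !compZr !compZl.
rewrite (comp2r (zigT _ _)) compm1.
have := trRT (idmor X) (tunit : C); rewrite tensm1 compm1 -/(qdimR X) => ->.
rewrite scalerA => /(brick_scaleI unit_brick).
by rewrite -{2}[qdimR X]mul1r => /(mulIf nzX).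
Qed.

Lemma ptr_comp X X' Y (g : mor X X') (f : mor (X ⊗ Y) (X ⊗ Y)) (h : mor X' X) :
  ptr ((g ⊠ idmor Y) ∘ f ∘ (h ⊠ idmor Y)) = g ∘ ptr f ∘ h.
Proof.
apply: tensm1r_inj; rewrite ptrT !homT_comp !homT_tens tensm1 !tens_compl ptrT !compmA.
by rewrite tens_exch (comp2r (esym (tens_exch _ _))) compmA.
Qed.

Lemma ptr_assoc X Y Z (f : mor (Y ⊗ Z) (Y ⊗ Z)) :
  ptr (assocV X Y Z ∘ (idmor X ⊠ f) ∘ assoc X Y Z) = idmor X ⊠ ptr f.
Proof.
apply: tensm1r_inj; set T := tunit.
rewrite tens_tens1 !ptrT !tens_compr !homTE !tens_compr !tens_compl !compmA.
rewrite assocV_nat tensm1 (comp2r (esym (assoc_nat _ _ _))) compmA tensm1.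
rewrite (comp2r (pentagonA _ _ _ _)) !compmA (comp2r (pentagonB _ _ _ _)) !compmA.
by rewrite (comp2r (assocV_nat _ f _)) compmA (comp2r (assocVK _ _ _)) compm1.
Qed.

End Pivotal.

Notation pevT X T := (pairT (pev X) T).
Notation pcoevT X T := (copairT (pcoev X) T).

(** * Braiding *)

Notation brT X Y T := (homT (braid X Y) T).
Notation brVT X Y T := (homT (braidV X Y) T).

Section Braiding.
Variables (k : fieldType) (C : braidedcat k).
Implicit Types X Y Z W T U : C.

Lemma brVK X Y T : brVT X Y T ∘ brT X Y T = idmor _.
Proof. by rewrite -homT_comp braidVK homT1. Qed.

Lemma brKV X Y T : brT X Y T ∘ brVT X Y T = idmor _.
Proof. by rewrite -homT_comp braidKV homT1. Qed.

Lemma iso_br X Y T : iso_mor (brT X Y T).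
Proof. by exists (brVT X Y T); rewrite brVK brKV. Qed.

Lemma iso_lunit X : iso_mor (lunit X).
Proof. by exists (lunitV X); rewrite lunitVK lunitKV. Qed.

Lemma brT_nat X X' Y Y' (f : mor X X') (g : mor Y Y') T :
  brT X' Y' T ∘ (f ⊠ (g ⊠ idmor T)) = (g ⊠ (f ⊠ idmor T)) ∘ brT X Y T.
Proof. by rewrite -!homT_tens -!homT_comp braid_nat. Qed.

Lemma hexT X Y Z T :
  (idmor Y ⊠ brT X Z T) ∘ brT X Y (Z ⊗ T) =
  assoc Y Z (X ⊗ T) ∘ brT X (Y ⊗ Z) T ∘ (idmor X ⊠ assocV Y Z T).
Proof.
have H : braid X (Y ⊗ Z) = assocV Y Z X ∘ (idmor Y ⊠ braid X Z) ∘ assoc Y X Z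
    ∘ (braid X Y ⊠ idmor Z) ∘ assocV X Y Z.
  apply: (iso_mono (iso_assoc Y Z X)); apply: (iso_epi (iso_assoc X Y Z)).
  rewrite hexagon !compmA assocKV comp1m -[RHS]compmA assocVK compm1.
  by rewrite -!compmA.
rewrite !homTE H !tens_compl !tens_compr !compmA.
rewrite (comp2r (pentagonA _ _ _ _)) !compmA (comp2r (esym (assoc_nat _ _ _))) compmA.
have HQ : assoc Y Z (X ⊗ T) ∘ assoc (Y ⊗ Z) X T ∘ (assocV Y Z X ⊠ idmor T) =
    (idmor Y ⊠ assoc Z X T) ∘ assoc Y (Z ⊗ X) T.
  by rewrite pentagon -compmA -tens_compl assocKV tensm1 compm1.
rewrite HQ -[idmor (Z ⊗ T)]tensm1 (comp2r (assocV_nat _ _ _)) compmA.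
by rewrite (comp3r (pentagonI _ _ _ _)) compmA.
Qed.

Lemma hexVT X Y Z T :
  brT X Z (Y ⊗ T) ∘ (idmor X ⊠ brT Y Z T) =
  (idmor Z ⊠ assoc X Y T) ∘ brT (X ⊗ Y) Z T ∘ assocV X Y (Z ⊗ T).
Proof.
have H : braid (X ⊗ Y) Z = assoc Z X Y ∘ (braid X Z ⊠ idmor Y) ∘ assocV X Z Y
    ∘ (idmor X ⊠ braid Y Z) ∘ assoc X Y Z.
  apply: (iso_mono (iso_assocV Z X Y)); apply: (iso_epi (iso_assocV X Y Z)).
  rewrite hexagonV !compmA assocVK comp1m -[RHS]compmA assocKV compm1.
  by rewrite -!compmA.
rewrite !homTE H !tens_compl !tens_compr !compmA.
rewrite (comp2r (pentagonB _ _ _ _)) !compmA -[idmor (Y ⊗ T)]tensm1.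
rewrite (comp2r (esym (assoc_nat _ _ _))) compmA (comp2r (assocV_nat _ _ _)) compmA.
have HQ : (assoc X Y Z ⊠ idmor T) ∘ assocV (X ⊗ Y) Z T ∘ assocV X Y (Z ⊗ T) =
    assocV X (Y ⊗ Z) T ∘ (idmor X ⊠ assocV Y Z T).
  by rewrite -compmA -pentagonI !compmA -tens_compl assocKV tensm1 comp1m.
by rewrite (comp3r HQ) compmA pentagon.
Qed.

Lemma hexVT_assoc X Y Z T :
  (idmor Z ⊠ assoc X Y T) ∘ brT (X ⊗ Y) Z T =
  brT X Z (Y ⊗ T) ∘ (idmor X ⊠ brT Y Z T) ∘ assoc X Y (Z ⊗ T).
Proof. by rewrite hexVT (comp2r (assocVK _ _ _)) compm1. Qed.

(* The hexagon for [tunit ⊗ tunit] makes the composite [g] idempotent up to   *)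
(* the unitors, hence trivial, since it is invertible.                        *)
Lemma brT_unitr X T : lunit (X ⊗ T) ∘ brT X tunit T = idmor X ⊠ lunit T.
Proof.
pose g T := lunit (X ⊗ T) ∘ brT X tunit T.
have g_iso U : iso_mor (g U) by apply: iso_comp (iso_lunit _) (iso_br _ _ _).
have g_nat U V (h : mor U V) : g V ∘ (idmor X ⊠ (idmor tunit ⊠ h)) = (idmor X ⊠ h) ∘ g U.
  by rewrite /g -compmA homT_nat compmA lunit_nat compmA.
have gg U : g (tunit ⊗ U) = idmor X ⊠ lunit (tunit ⊗ U).
  apply: (iso_mono (g_iso U)).
  rewrite {1 2}/g compmA (comp2r (esym (lunit_nat _))) compmA.
  rewrite (comp2r (hexT _ _ _ _)) !compmA (comp2r (lunit_assoc _ _)).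
  rewrite -[idmor (X ⊗ U)]tensm1 (comp2r (esym (brT_nat _ _ _))) compmA -/(g U).
  by rewrite -compmA -tens_compr lunit_assocV.
have := g_nat _ _ (lunit T); rewrite gg -tens_compr -lunit_nat tens_compr.
by move/(iso_epi (iso_tens (iso_id X) (iso_tens (iso_id tunit) (iso_lunit T)))).
Qed.

(** The mirror argument: by the other hexagon, applying [d] twice amounts to [d] for tunit ⊗ tunit,
    and [d] can be cancelled. *)
Lemma brT_unitl X T : (idmor X ⊠ lunit T) ∘ brT tunit X T = lunit (X ⊗ T).
Proof.
pose d := (idmor X ⊠ lunit T) ∘ brT tunit X T; rewrite -/d.
have d_iso : iso_mor d.
  by apply: iso_comp (iso_tens (iso_id X) (iso_lunit T)) (iso_br _ _ _).
apply: tensm1l_inj; apply: (iso_mono d_iso).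
rewrite {1 2}/d tens_compr !compmA (comp2r (homT_nat _ _)) compmA.
rewrite (comp2r (hexVT _ _ _ _)) !compmA.
rewrite (comp2r (esym (tens_compr _ _ _))) triangle (comp2r (esym (brT_nat _ _ _))).
by rewrite compmA -/d tensm1 -compmA triangle'.
Qed.

Lemma brT_unitrV X T : brT X tunit T ∘ (idmor X ⊠ lunitV T) = lunitV (X ⊗ T).
Proof.
apply: (iso_mono (iso_lunit _)).
by rewrite compmA brT_unitr -tens_compr !lunitKV tensm1.
Qed.

Lemma brT_unitlV X T : brT tunit X T ∘ lunitV (X ⊗ T) = idmor X ⊠ lunitV T.
Proof.
apply: (iso_mono (iso_tens (iso_id X) (iso_lunit T))).
by rewrite compmA brT_unitl -tens_compr !lunitKV tensm1.
Qed.

(** Naturality of the braiding along [e] pulls a cap across the strand [Z], the crossing with the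
    unit being trivial. The primed variants use the opposite crossings, the [copair] ones treat
    cups, and those marked [V] carry one crossing to the other side. *)
Lemma pair_slide X Y Z T (e : mor (X ⊗ Y) tunit) :
  pairT e (Z ⊗ T) ∘ (idmor X ⊠ brT Z Y T) ∘ brT Z X (Y ⊗ T) = idmor Z ⊠ pairT e T.
Proof.
rewrite -compmA hexT !pairTE !compmA (comp2r (assocVK _ _ _)) compm1.
rewrite -tensm1 (comp2r (esym (brT_nat _ _ _))) compmA brT_unitr.
by rewrite !tens_compr.
Qed.

Lemma pair_slide' X Y Z T (e : mor (X ⊗ Y) tunit) :
  (idmor Z ⊠ pairT e T) ∘ brT X Z (Y ⊗ T) ∘ (idmor X ⊠ brT Y Z T) = pairT e (Z ⊗ T).
Proof.
rewrite -compmA hexVT !pairTE !tens_compr !compmA.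
rewrite (comp2r (esym (tens_compr _ _ _))) assocVK tensm1 compm1.
rewrite (comp2r (esym (brT_nat _ _ _))) compmA brT_unitl.
by rewrite tensm1.
Qed.

Lemma copair_slide X Y Z T (n : mor tunit (X ⊗ Y)) :
  (idmor X ⊠ brT Z Y T) ∘ brT Z X (Y ⊗ T) ∘ (idmor Z ⊠ copairT n T) = copairT n (Z ⊗ T).
Proof.
rewrite hexT !copairTE !tens_compr !compmA.
rewrite (comp2r (esym (tens_compr _ (assocV _ _ _) (assoc _ _ _)))) assocVK tensm1 compm1.
rewrite (comp2r (brT_nat _ _ _)) compmA tensm1.
by rewrite (comp2r (brT_unitrV _ _)).
Qed.

Lemma copair_slide' X Y Z T (n : mor tunit (X ⊗ Y)) :
  brT X Z (Y ⊗ T) ∘ (idmor X ⊠ brT Y Z T) ∘ copairT n (Z ⊗ T) = idmor Z ⊠ copairT n T.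
Proof.
rewrite hexVT !copairTE !tens_compr !compmA (comp2r (assocVK _ _ _)) compm1.
rewrite -tensm1 (comp2r (brT_nat _ _ _)) compmA.
by rewrite (comp2r (brT_unitlV _ _)).
Qed.

Lemma pair_slideV X Y Z T (e : mor (X ⊗ Y) tunit) :
  pairT e (Z ⊗ T) ∘ (idmor X ⊠ brT Z Y T) =
  (idmor Z ⊠ pairT e T) ∘ brVT Z X (Y ⊗ T).
Proof.
apply: (iso_epi (iso_br Z X (Y ⊗ T))).
by rewrite pair_slide -compmA brVK compm1.
Qed.

Lemma pair_slideV' X Y Z T (e : mor (X ⊗ Y) tunit) :
  (idmor Z ⊠ pairT e T) ∘ brT X Z (Y ⊗ T) =
  pairT e (Z ⊗ T) ∘ (idmor X ⊠ brVT Y Z T).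
Proof.
apply: (iso_epi (iso_tens (iso_id X) (iso_br Y Z T))).
by rewrite pair_slide' -compmA -tens_compr brVK tensm1 compm1.
Qed.

Lemma copair_slideV X Y Z T (n : mor tunit (X ⊗ Y)) :
  brT Z X (Y ⊗ T) ∘ (idmor Z ⊠ copairT n T) =
  (idmor X ⊠ brVT Z Y T) ∘ copairT n (Z ⊗ T).
Proof.
apply: (iso_mono (iso_tens (iso_id X) (iso_br Z Y T))).
by rewrite !compmA copair_slide -tens_compr brKV tensm1 comp1m.
Qed.

Lemma copair_slideV' X Y Z T (n : mor tunit (X ⊗ Y)) :
  (idmor X ⊠ brT Y Z T) ∘ copairT n (Z ⊗ T) =
  brVT X Z (Y ⊗ T) ∘ (idmor Z ⊠ copairT n T).
Proof.
apply: (iso_mono (iso_br X Z (Y ⊗ T))).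
by rewrite !compmA copair_slide' brKV comp1m.
Qed.

End Braiding.

(** * Twist and S-matrix *)

Section Twist.
Variables (k : fieldType) (C : bpcat k).
Implicit Types X Y Z W T U : C.

Lemma yang_baxter X Y Z T :
  brT Y Z (X ⊗ T) ∘ (idmor Y ⊠ brT X Z T) ∘ brT X Y (Z ⊗ T) =
  (idmor Z ⊠ brT X Y T) ∘ brT X Z (Y ⊗ T) ∘ (idmor X ⊠ brT Y Z T).
Proof.
rewrite hexVT [brT X Y (Z ⊗ T)]homTE !compmA (comp2r (assocVK _ _ _)) compm1.
rewrite -[idmor (Z ⊗ T)]tensm1 (comp2r (brT_nat _ _ _)) compmA.
rewrite (comp2r (hexVT _ _ _ _)) !compmA [brT X Y T]homTE !tens_compr.
by rewrite (comp2r (esym (tens_compr _ (assocV _ _ _) _))) assocVK tensm1 compm1.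
Qed.

(** Two Yang-Baxter moves let the strand [Z] pass across the inverse double braiding of [X] and
    [Y]. *)
Lemma yang_baxter_conj X Y Z T :
  (idmor Z ⊠ brVT X Y T) ∘ (idmor Z ⊠ brVT Y X T) ∘ brT X Z (Y ⊗ T) =
  brT X Z (Y ⊗ T) ∘ (idmor X ⊠ brT Y Z T) ∘ brVT X Y (Z ⊗ T) ∘ brVT Y X (Z ⊗ T)
    ∘ (idmor X ⊠ brVT Y Z T).
Proof.
apply: (iso_epi (f := (idmor X ⊠ brT Y Z T) ∘ brT Y X (Z ⊗ T) ∘ brT X Y (Z ⊗ T))).
  exact: iso_comp (iso_comp (iso_tens (iso_id X) (iso_br _ _ _)) (iso_br _ _ _))
    (iso_br _ _ _).
rewrite !compmA (comp3r (yang_baxter Y X Z T)) !compmA.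
rewrite (comp2r (esym (tens_compr _ (brVT Y X T) _))) brVK tensm1 compm1.
rewrite (comp3r (yang_baxter X Y Z T)) !compmA -tens_compr brVK tensm1 comp1m.
rewrite (comp2r (esym (tens_compr _ (brVT Y Z T) _))) brVK tensm1 compm1.
by rewrite (comp2r (brVK _ _ _)) compm1 (comp2r (brVK _ _ _)) compm1.
Qed.

(* Both sides are [pairT e] and [copairT n] joined by the inverse of          *)
(* [braid X X].                                                               *)
Lemma pair_kink X Y T (e : mor (X ⊗ Y) tunit) (n : mor tunit (X ⊗ Y)) :
  pairT e (X ⊗ T) ∘ (idmor X ⊠ (brT X Y T ∘ copairT n T)) =
  (idmor X ⊠ (pairT e T ∘ brT Y X T)) ∘ copairT n (X ⊗ T).
Proof.
by rewrite !tens_compr compmA pair_slideV -compmA -copair_slideV' compmA.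
Qed.

Lemma pair_kinkV X Y T (e : mor (X ⊗ Y) tunit) (n : mor tunit (X ⊗ Y)) :
  pairT e (X ⊗ T) ∘ (idmor X ⊠ (brVT Y X T ∘ copairT n T)) =
  (idmor X ⊠ (pairT e T ∘ brVT X Y T)) ∘ copairT n (X ⊗ T).
Proof.
by rewrite !tens_compr compmA -pair_slideV' -!compmA copair_slideV.
Qed.

Lemma pair_kinkVr X Y T (e : mor (X ⊗ Y) tunit) (n : mor tunit (X ⊗ Y)) :
  (idmor Y ⊠ pairT e T) ∘ brVT Y X (Y ⊗ T) ∘ copairT n (Y ⊗ T) =
  pairT e (Y ⊗ T) ∘ brVT X Y (Y ⊗ T) ∘ (idmor Y ⊠ copairT n T).
Proof.
rewrite -pair_slide -copair_slide' !compmA (comp2r (brKV _ _ _)) compm1.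
by rewrite (comp2r (brVK _ _ _)) compm1.
Qed.

Lemma ev_drinfeld X : ev (X^∨) ∘ (drinfeld X ⊠ idmor _) = ev X ∘ braid X (X^∨).
Proof. exact: ev_mate. Qed.

Lemma evT_drinfeld X T :
  evT (X^∨) T ∘ (drinfeld X ⊠ idmor _) = evT X T ∘ brT X (X^∨) T.
Proof. by rewrite ev_mateT pairT_comp. Qed.

Lemma iso_tens1 X Y (f : mor X Y) : iso_mor (f ⊠ idmor (tunit : C)) -> iso_mor f.
Proof.
move=> fP.
have fP' : iso_mor (runit Y ∘ (f ⊠ idmor tunit) ∘ runitV X).
  apply: iso_comp; last by exists (runit X); rewrite runitKV runitVK.
  apply: iso_comp fP; by exists (runitV Y); rewrite runitKV runitVK.
by rewrite runit_nat -compmA runitKV compm1 in fP'.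
Qed.

Lemma drinfeld_iso X : iso_mor (drinfeld X).
Proof.
apply: iso_tens1.
(* The cup [n] is inverse to the cap [ev X ∘ braid X (X^∨)] that defines [drinfeld]: the inverse
   crossing undoes the crossing in the zigzags, by the kink lemmas. *)
pose n T := copairT (braidV (X^∨) X ∘ coev X) T.
have nE T : n T = brVT (X^∨) X T ∘ coevT X T by rewrite /n copairT_comp.
have nu T : (idmor _ ⊠ (drinfeld X ⊠ idmor T)) ∘ n T = coevT (X^∨) T.
  move: T; apply: coevT_unique => [T U h|T].
    rewrite -compmA copairT_nat !compmA; congr (_ ∘ _).
    by rewrite -!tens_compr tens_exch.
  rewrite compmA -tens_compr evT_drinfeld nE compmA.
  rewrite -pairT_comp pair_kinkVr pairT_comp.
  by rewrite (comp2r (brKV _ _ _)) compm1; exact: zagT.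
set T := tunit; exists (evT (X^∨) (X ⊗ T) ∘ (idmor _ ⊠ n T)); split.
  rewrite -compmA tens_exch compmA evT_drinfeld nE.
  rewrite -pairT_comp pair_kinkV pairT_comp -(compmA _ (brT _ _ _)) brKV compm1.
  exact: zigT.
rewrite compmA -pairT_nat -compmA -tens_compr nu; exact: zagT.
Qed.

(** Since [drinfeld X] is invertible a solution exists, so [xget] does not fall back on its default
    0. *)
Lemma twistP X : piv X = drinfeld X ∘ twist X.
Proof.
apply: (@xgetPex _ 0 (fun t : mor X X => piv X = drinfeld X ∘ t)).
have [w [_ uw]] := drinfeld_iso X.
by exists (w ∘ piv X); rewrite compmA uw comp1m.
Qed.

Lemma drinfeld_nat X Y (f : mor X Y) :
  drinfeld Y ∘ f = dualm (dualm f) ∘ drinfeld X.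
Proof.
apply: ev_inj.
have -> : ev (Y^∨) ∘ ((drinfeld Y ∘ f) ⊠ idmor _) =
    ev Y ∘ (idmor _ ⊠ f) ∘ braid X (Y^∨).
  by rewrite (tens_compl _ (drinfeld Y) f) compmA ev_drinfeld -compmA braid_nat compmA.
have -> : ev (Y^∨) ∘ ((dualm (dualm f) ∘ drinfeld X) ⊠ idmor _) =
    ev X ∘ braid X (X^∨) ∘ (idmor X ⊠ dualm f).
  rewrite (tens_compl _ _ (drinfeld X)) compmA ev_dualm -compmA tens_exch compmA.
  by rewrite ev_drinfeld.
by rewrite -ev_dualm -[RHS]compmA braid_nat compmA.
Qed.

Lemma twist_nat X Y (f : mor X Y) : twist Y ∘ f = f ∘ twist X.
Proof.
apply: (iso_mono (drinfeld_iso Y)).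
by rewrite compmA -twistP compmA drinfeld_nat -compmA -twistP piv_nat.
Qed.

Lemma twist_iso X : iso_mor (twist X).
Proof.
have [w [wu uw]] := drinfeld_iso X; exists (pivV X ∘ drinfeld X); split.
  by rewrite -compmA -twistP pivVK.
apply: (iso_mono (drinfeld_iso X)).
by rewrite !compmA -twistP pivKV comp1m compm1.
Qed.

Lemma pev_twist X : pev X = ev X ∘ braid X (X^∨) ∘ (twist X ⊠ idmor _).
Proof. by rewrite pevE twistP tens_compl compmA ev_drinfeld. Qed.

(** By [coevT_tens] the zigzag of X ⊗ Y factors through [dual_tens], which yields a right
    inverse. *)
Lemma dual_tens_epi X Y T : exists s, (dual_tens X Y ⊠ idmor T) ∘ s = idmor _.
Proof.
have := zagT (X ⊗ Y) T; rewrite coevT_tens.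
rewrite assocV_nat tensm1 !tens_compr !compmA pairT_nat -!compmA.
by eexists; eassumption.
Qed.

Notation epT X T := (pairT (ev X ∘ braid X (X^∨)) T).

Lemma pevT_twist X T : pevT X T = epT X T ∘ (twist X ⊠ idmor _).
Proof. by rewrite pev_twist pairT_comp homT_tens tensm1. Qed.

Lemma epT_tens X Y T :
  epT (X ⊗ Y) T ∘ (idmor _ ⊠ (dual_tens X Y ⊠ idmor T))
    ∘ (idmor _ ⊠ assocV (Y^∨) (X^∨) T) ∘ assocV X Y _ ∘ brT Y X _ ∘ brT X Y _ =
  epT X T ∘ (idmor X ⊠ epT Y (X^∨ ⊗ T)).
Proof.
have -> : epT (X ⊗ Y) T ∘ (idmor _ ⊠ (dual_tens X Y ⊠ idmor T)) =
    evT (X ⊗ Y) T ∘ (dual_tens X Y ⊠ idmor _) ∘ brT (X ⊗ Y) _ T.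
  by rewrite pairT_comp -compmA brT_nat compmA tensm1.
rewrite evT_dual_tens (comp3r (esym (hexT _ _ _ _))) !compmA.
rewrite (comp2r (esym (tens_compr _ _ (brT _ _ T)))) hexVT_assoc.
rewrite (comp2r (esym (tens_compr _ _ _))) !compmA -pairT_comp pair_slideV.
rewrite !tens_compr !compmA pairT_nat (comp2r (hexVT_assoc _ _ _ _)) !compmA.
rewrite (comp2r (assocKV _ _ _)) compm1 (comp3r (yang_baxter _ _ _ _)) !compmA.
rewrite (comp2r (esym (tens_compr _ _ (brT Y X _)))) brVK tensm1 compm1.
by rewrite (comp2r (esym (pairT_comp _ _ _))) (comp3r (pair_slide _ _ _)).
Qed.

Lemma pevT_tens X Y T :
  pevT (X ⊗ Y) T ∘ (idmor _ ⊠ (dual_tens X Y ⊠ idmor T))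
    ∘ (idmor _ ⊠ assocV (Y^∨) (X^∨) T) ∘ assocV X Y _ =
  pevT X T ∘ (idmor X ⊠ pevT Y (X^∨ ⊗ T)).
Proof.
rewrite pevT_dual_tens (comp2r (esym (tens_compr _ _ _))) assocKV tensm1 compm1.
by rewrite (comp2r (assocKV _ _ _)) compm1.
Qed.

(** The caps of the pivotal structure are multiplicative ([pevT_tens]), those of [drinfeld] only up
    to the double braiding ([epT_tens]). The twist measures their quotient, and [dual_tens] is
    cancelled by its right inverse. *)
Lemma twist_tens X Y : twist (X ⊗ Y) = braid Y X ∘ braid X Y ∘ (twist X ⊠ twist Y).
Proof.
apply: (iso_mono (drinfeld_iso (X ⊗ Y))); rewrite -twistP.
apply: ev_inj; apply: pairT_inj.
set G := _ ∘ (twist X ⊠ _).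
rewrite -pevE tens_compl compmA ev_drinfeld pairT_comp homT_tens tensm1.
set T := tunit; have [s sP] := dual_tens_epi X Y T.
have iP : iso_mor ((idmor (X ⊗ Y) ⊠ assocV (Y^∨) (X^∨) T) ∘ assocV X Y _).
  exact: iso_comp (iso_tens (iso_id _) (iso_assocV _ _ _)) (iso_assocV _ _ _).
suff E : pevT (X ⊗ Y) T ∘ (idmor _ ⊠ (dual_tens X Y ⊠ idmor T)) =
    epT (X ⊗ Y) T ∘ (G ⊠ idmor _) ∘ (idmor _ ⊠ (dual_tens X Y ⊠ idmor T)).
  have := congr1 (fun x => x ∘ (idmor (X ⊗ Y) ⊠ s)) E.
  by rewrite -!compmA -!tens_compr sP tensm1 !compm1.
apply: (iso_epi iP); rewrite !compmA pevT_tens.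
rewrite (comp2r (esym (tens_exch _ _))) compmA (comp2r (esym (tens_exch _ _))) compmA.
have -> : forall W (x : mor _ W), x ∘ (G ⊠ idmor _) ∘ assocV X Y (Y^∨ ⊗ (X^∨ ⊗ T)) =
    x ∘ assocV X Y _ ∘ homT G _.
  by move=> W x; rewrite homTE !compmA (comp2r (assocVK _ _ _)) compm1.
rewrite /G !homT_comp homT_tens !compmA epT_tens !pevT_twist.
by rewrite -!compmA -!tensm_comp comp1m !compm1 comp1m.
Qed.

Lemma braid_tunit : braid (tunit : C) tunit = idmor _.
Proof.
apply: homT_inj; rewrite homT1; apply: (iso_mono (iso_lunit _)).
rewrite brT_unitr compm1; apply: (iso_mono (iso_lunit _)); exact: lunit_nat.
Qed.

Lemma pcoevT_unique X (n : forall T, mor T (X^∨ ⊗ (X ⊗ T))) :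
    (forall T U (h : mor T U), n U ∘ h = (idmor _ ⊠ (idmor X ⊠ h)) ∘ n T) ->
    (forall T, pevT X (X ⊗ T) ∘ (idmor X ⊠ n T) = idmor _) ->
  forall T, n T = pcoevT X T.
Proof.
move=> n_nat n_zag T; rewrite -[LHS]comp1m -(rzigT X) -compmA copairT_nat compmA.
by rewrite -tens_compr n_zag tensm1 comp1m.
Qed.

Hypothesis unit_brick : brick (tunit : C).

(** Balancing and naturality along [lunit] give c = c^2 for the scalar [c] of the twist, which is
    invertible. *)
Lemma twist_tunit : twist (tunit : C) = idmor _.
Proof.
have := brick_scalar (twist (tunit : C)) unit_brick.
set c := scalar_of _ => tE.
have := twist_nat (lunit (tunit : C)).
rewrite twist_tens braid_tunit comp1m comp1m tE !compZl comp1m.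
rewrite tensZl tensZr tensm1 !compZr compm1 => /eqP.
have [/eqP id0 _] := unit_brick.
have l0 : lunit (tunit : C) != 0.
  by apply: contra id0 => /eqP E; rewrite -(lunitKV tunit) E comp0m.
have c0 : c != 0.
  apply: contra id0 => /eqP E; have [w [<- _]] := twist_iso (tunit : C).
  by rewrite tE E scale0r compm0.
rewrite scalerA -subr_eq0 -scalerBl scaler_eq0 (negPf l0) orbF subr_eq0.
by rewrite -{1}[c]mulr1 (inj_eq (mulfI c0)) => /eqP <-; rewrite scale1r.
Qed.

(** Naturality of the twist along [ev X], its triviality on the unit, and balancing for X^∨ ⊗ X. *)
Lemma pev_ev X : pev X ∘ braid (X^∨) X ∘ (twist (X^∨) ⊠ idmor X) = ev X.
Proof.
have := twist_nat (ev X); rewrite twist_tunit comp1m twist_tens => ->.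
rewrite -(tens_split' (twist (X^∨)) (twist X)) !compmA.
have -> : forall W (x : mor _ W), x ∘ braid (X^∨) X ∘ (idmor _ ⊠ twist X) =
    x ∘ (twist X ⊠ idmor _) ∘ braid (X^∨) X.
  by move=> W x; rewrite -compmA braid_nat compmA.
by rewrite -pev_twist.
Qed.

Lemma pcoev_coev X T :
  pcoevT X T = (twist (X^∨) ⊠ idmor _) ∘ brT X (X^∨) T ∘ coevT X T.
Proof.
symmetry; move: T; apply: pcoevT_unique => [T U h|T].
  rewrite -compmA copairT_nat !compmA (comp2r (homT_nat _ _)) compmA.
  by rewrite tens_exch.
pose e := pev X ∘ (idmor X ⊠ twist (X^∨)).
have eE U : pairT e U = pevT X U ∘ (idmor X ⊠ (twist (X^∨) ⊠ idmor U)).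
  by rewrite pairT_comp homT_tens.
rewrite -!compmA tens_compr compmA -eE pair_kink -pairT_comp /e -compmA.
by rewrite -braid_nat compmA pev_ev zigT.
Qed.

(** Let L be the scalar of [ev X ∘ braid X (X^∨) ∘ coev X]. The right dimension is theta_X L and the
    left one is theta_{X^∨} L. *)
Lemma twist_dual_qdim X : brick X -> brick (X^∨) ->
  theta (X^∨) * qdimR X = theta X * qdimL X.
Proof.
move=> bX bX'.
have E1 := brick_scalar (twist X) bX; have E2 := brick_scalar (twist (X^∨)) bX'.
have ER := trRT unit_brick (idmor X) (tunit : C).
have EL := trLT unit_brick (idmor X) (tunit : C).
rewrite -/(qdimR X) tensm1 compm1 pevT_twist E1 -/(theta X) tensZl tensm1 in ER.
rewrite -/(qdimL X) !tensm1 compm1 pcoev_coev E2 -/(theta _) tensZl tensm1 in EL.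
rewrite compZr compm1 compZl pairT_comp in ER; rewrite !compZl comp1m compZr compmA in EL.
apply: (brick_scaleI unit_brick); rewrite -!scalerA -ER -EL !scalerA.
by rewrite mulrC.
Qed.

Lemma Smat_sym X Y : Smat X Y = Smat Y X.
Proof. exact: trR_cyc. Qed.

Lemma double_braid_tens L X Y :
  assocV L X Y ∘ (braid (X ⊗ Y) L ∘ braid L (X ⊗ Y)) ∘ assoc L X Y =
  (braid X L ⊠ idmor Y) ∘
    (assocV X L Y ∘ (idmor X ⊠ (braid Y L ∘ braid L Y)) ∘ assoc X L Y)
    ∘ (braid L X ⊠ idmor Y).
Proof.
have -> : assocV L X Y ∘ (braid (X ⊗ Y) L ∘ braid L (X ⊗ Y)) ∘ assoc L X Y =
   (assocV L X Y ∘ braid (X ⊗ Y) L ∘ assocV X Y L) ∘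
   (assoc X Y L ∘ braid L (X ⊗ Y) ∘ assoc L X Y).
  by rewrite !compmA (comp2r (assocVK _ _ _)) compm1.
by rewrite hexagon hexagonV tens_compr !compmA.
Qed.

Lemma double_braid_scalar_tens L X Y c c' :
    braid X L ∘ braid L X = c *: idmor _ -> braid Y L ∘ braid L Y = c' *: idmor _ ->
  braid (X ⊗ Y) L ∘ braid L (X ⊗ Y) = (c * c') *: idmor _.
Proof.
move=> cE c'E; apply: (iso_mono (iso_assocV L X Y)); apply: (iso_epi (iso_assoc L X Y)).
rewrite double_braid_tens c'E tensZr tensm1 !(compZl, compZr) !compm1.
rewrite !compmA (comp2r (assocVK X L Y)) compm1 -tens_compl cE tensZl tensm1.
by rewrite assocVK scalerA mulrC.
Qed.

Lemma double_braid_scalar_retract L X Y c (j : mor Y X) (q : mor X Y) :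
    q ∘ j = idmor Y -> braid X L ∘ braid L X = c *: idmor _ ->
  braid Y L ∘ braid L Y = c *: idmor _.
Proof.
move=> qj cE; rewrite -[LHS]compm1 -tensm1 -qj tens_compr compmA.
rewrite (comp2r (braid_nat _ _)) compmA braid_nat -(compmA _ _ (braid L X)) cE.
by rewrite compZr compm1 compZl -tens_compr qj tensm1.
Qed.

(** Closing the strand [Y] linked with [L] leaves a scalar [c] on [L], with S_{L,Y} = c d_L. Doing
    this inside the hexagon form of the double braiding with X ⊗ Y leaves c times that with [X]. *)
Lemma Smat_tens L X Y : brick L ->
  Smat L (X ⊗ Y) * qdimR L = Smat L X * Smat L Y.
Proof.
move=> bL; set m := braid Y L ∘ braid L Y.
have mE := brick_scalar (ptr m) bL; set c := scalar_of _ in mE.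
have -> : Smat L Y = c * qdimR L by rewrite /Smat trR_ptr // -/m mE trRZ.
rewrite mulrA; congr (_ * _).
have -> : Smat L (X ⊗ Y) =
    trR (assocV L X Y ∘ (braid (X ⊗ Y) L ∘ braid L (X ⊗ Y)) ∘ assoc L X Y).
  by rewrite trR_cyc !compmA assocKV comp1m.
rewrite double_braid_tens trR_ptr // ptr_comp ptr_assoc mE tensZr tensm1.
by rewrite compZr compm1 compZl trRZ // mulrC.
Qed.

(** A loop labelled Z^∨ around [W] is a loop labelled [Z] with opposite orientation and inverse
    crossings. Closing it with the cap and cup of the other side introduces the two twists. *)
Lemma Smat_dual W Z : brick Z -> brick (Z^∨) ->
    pev (Z^∨) ∘ (idmor _ ⊠ piv Z) = ev Z ->
  theta Z * Smat W (Z^∨) = theta (Z^∨) * trR (braidV W Z ∘ braidV Z W).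
Proof.
move=> bZ bZ' pivE; set D := Z^∨ in bZ' pivE *.
have tZ := brick_scalar (twist Z) bZ; have tD := brick_scalar (twist D) bZ'.
rewrite -!/(theta _) in tZ tD.
have evE T : (theta Z *: evT Z T) ∘ brT Z D T = pevT Z T.
  by rewrite compZl pevT_twist tZ tensZl tensm1 compZr compm1 pairT_comp.
have coevE T : pcoevT Z T = theta D *: (brT Z D T ∘ coevT Z T).
  by rewrite pcoev_coev tD tensZl tensm1 compZl comp1m compZl.
have pevDE T : pevT D T ∘ (idmor _ ⊠ (piv Z ⊠ idmor T)) = evT Z T.
  by rewrite -homT_tens -pairT_comp pivE.
suff E : theta Z *: ptr (braid D W ∘ braid W D) = theta D *: ptr (braidV W Z ∘ braidV Z W).
  by rewrite /Smat trR_ptr // [in RHS]trR_ptr // -!trRZ // E.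
apply: tensm1r_inj; rewrite !tensZl !ptrT !homT_comp; set T := tunit.
rewrite coevT_dual tens_compr !compmA (comp2r (homT_nat _ _)) compmA.
rewrite (comp2r (homT_nat _ _)) compmA -tens_compr pevDE.
rewrite (comp2r (copair_slideV _ _ _)) compmA pair_slideV' coevE.
rewrite compZr !compmA scalerA mulrC -scalerA; congr (_ *: _).
(* Pulling [W] through the inverse double braiding brings the self-crossing of the [Z] strand to the
   cap, where [evE] absorbs it together with theta_Z. *)
rewrite (comp3r (yang_baxter_conj _ _ _ _)) !compmA -!compZl evE pair_slideV.
rewrite (comp2r (esym (copair_slideV _ _ _))) !compmA.
by rewrite (comp2r (brVK _ _ _)) compm1.
Qed.

End Twist.

(** * Semisimplicity *)

Section Vectors.
Import VectorInternalTheory.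

Lemma vect_eigenvector (k : closedFieldType) (V : vectType k) (f : V -> V) (v : V) :
  linear f -> v != 0 -> exists c w, w != 0 /\ f w = c *: w.
Proof.
move=> linf nz.
pose F := GRing.isLinear.Build k V V *:%R f linf.
pose g : {linear V -> V} := HB.pack f F.
pose A := lin1_mx (v2r \o g \o r2v).
have dimV : (0 < dim V)%N.
  rewrite lt0n; apply: contra nz => /eqP d0; rewrite -[v]v2rK.
  have -> : v2r v = 0 by apply/rowP => i; have := ltn_ord i; rewrite {2}d0.
  by rewrite linear0.
have /closed_rootP[c] : size (char_poly A) != 1%N.
  by rewrite size_char_poly eqSS -lt0n.
rewrite -eigenvalue_root_char => /eigenvalueP[w wA wn].
exists c, (r2v w); split.
  by apply: contra wn => /eqP E; rewrite -[w]r2vK E linear0.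
by apply: v2r_inj; rewrite linearZ /= r2vK -wA mul_rV_lin1.
Qed.

Lemma dim_inj_le (k : fieldType) (V W : vectType k) (f : V -> W) :
  linear f -> injective f -> (\dim {:V} <= \dim {:W})%N.
Proof.
move=> linf injf.
pose F := GRing.isLinear.Build k V W *:%R f linf.
pose g : {linear V -> W} := HB.pack f F.
have kg : lker (linfun g) == 0%VS.
  apply/lker0P => x y; rewrite !lfunE; exact: injf.
have := limg_dim_eq (U := fullv) (f := linfun g).
rewrite (eqP kg) capv0 => <- //; exact: dimvS (subvf _).
Qed.

End Vectors.

Section SimpleObjects.
Variables (k : closedFieldType) (C : lincat k).
Hypothesis abC : abelian_cat C.
Implicit Types X Y Z : C.

(** The kernel is a mono into the simple [X], and cannot be an isomorphism as [f] is nonzero; so it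
    is zero, [f] is mono, and simplicity of [Y] concludes. *)
Lemma simple_iso X Y (f : mor X Y) : simple_obj X -> simple_obj Y -> f != 0 -> iso_mor f.
Proof.
move=> [_ sX] [_ sY] nz; have [K [i [fi iP]]] := ab_ker abC f.
have mi : mono_mor i.
  move=> Z g h E; have [|x [_ xu]] := iP Z (i ∘ g).
    by rewrite compmA fi comp0m.
  by rewrite -(xu g) // -(xu h).
have [i0|ii] := sX _ _ mi; last first.
  by case/eqP: nz; apply: (iso_epi ii); rewrite fi comp0m.
have mf : mono_mor f.
  move=> Z g h /eqP; rewrite -subr_eq0 => /eqP E.
  have [|x [xE _]] := iP Z (g - h).
    by rewrite compDr -scaleN1r compZr scaleN1r.
  by apply/eqP; rewrite -subr_eq0 -xE i0 comp0m.
by case: (sY _ _ mf) => // f0; rewrite f0 eqxx in nz.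
Qed.

(** Composition with [f] on End(X) has an eigenvector [w], the field being algebraically closed. As
    f - c kills the nonzero [w], it is not invertible, hence zero. *)
Lemma simple_brick X : simple_obj X -> brick X.
Proof.
move=> sX; split=> [|f]; first by case: sX.
have /eqP nz := proj1 sX.
have [c [w [wn wE]]] := vect_eigenvector (comp_linearr f) nz.
exists c; apply/eqP; rewrite -subr_eq0; apply: contraNT wn => nf.
have [g [gK _]] := simple_iso sX sX nf.
rewrite -[w]comp1m -gK -compmA compDl -scaleN1r !compZl comp1m scaleN1r.
by rewrite wE subrr compm0.
Qed.

End SimpleObjects.

Section Semisimple.
Variables (k : closedFieldType) (C : lincat k).
Hypotheses (abC : abelian_cat C) (ssC : semisimple_cat C).
Variables (I : finType) (S : I -> C).
Hypothesis irrS : irr_reps S.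
Implicit Types X Y Z : C.

Record decomp X n (d : 'I_n -> I) (i : forall m, mor (S (d m)) X)
    (p : forall m, mor X (S (d m))) : Prop := Decomp {
  dec_id : forall m, p m ∘ i m = idmor _;
  dec_0 : forall m m', m != m' -> p m' ∘ i m = 0;
  dec_sum : \sum_m i m ∘ p m = idmor X
}.

Lemma ex_decomp X : exists n d i p, @decomp X n d i p.
Proof.
have [n [R [sR [i [p [pi pi0 ip]]]]]] := ssC X.
have [_ _ all_S] := irrS.
have [d dP] : {d : 'I_n -> I & forall m, isomorphic (R m) (S (d m))}.
  exact: choice (fun m => all_S _ (sR m)).
pose f m := projT1 (cid (dP m)).
have fP m : iso_mor (f m) by exact: (projT2 (cid (dP m))).
pose g m := projT1 (cid (fP m)).
have [gf fg] : (forall m, g m ∘ f m = idmor _) /\ (forall m, f m ∘ g m = idmor _).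
  by split=> m; have [] := projT2 (cid (fP m)).
exists n, d, (fun m => i m ∘ g m), (fun m => f m ∘ p m); split=> [m|m m' ne|].
- by rewrite compmA (comp2r (pi m)) compm1 fg.
- by rewrite compmA (comp2r (pi0 _ _ ne)) compm0 comp0m.
- by rewrite -ip; apply: eq_bigr => m _; rewrite compmA (comp2r (gf m)) compm1.
Qed.

Lemma Sbrick v : brick (S v).
Proof. by apply: simple_brick => //; case: irrS. Qed.

Lemma S_neq_hom u v (f : mor (S u) (S v)) : u != v -> f = 0.
Proof.
have [simS injS _] := irrS => ne; apply/eqP; apply: contraNT ne => nf.
apply/eqP; apply: injS; exists f; exact: (simple_iso abC).
Qed.

(** The identity transported along u = v, made total so that it can be written for an index [d m];
    [mult_card] uses it only where the indices agree. *)
Definition Scast u v : mor (S u) (S v) :=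
  if u =P v is ReflectT e then ecast w (mor (S u) (S w)) e (idmor (S u)) else 0.

Lemma Scast_id u : Scast u u = idmor _.
Proof. by rewrite /Scast; case: eqP => // e; rewrite eq_axiomK. Qed.

Lemma Scast_comp u v : u = v -> Scast u v ∘ Scast v u = idmor _.
Proof. by move=> ->; rewrite Scast_id comp1m. Qed.

(** As a dimension of a Hom space, the multiplicity does not depend on a decomposition and
    adjunctions apply to it directly. *)
Definition mult X v : nat := \dim {: mor X (S v)}.

(** The projections [e] and inclusions [e'] of the summands of type [v] are dual families; they give
    injective linear maps in both directions between Hom(X, S v) and row vectors. *)
Lemma mult_card X n d i p v : @decomp X n d i p -> mult X v = #|[set m | d m == v]|.
Proof.
move=> [pi pi0 ip]; set P := [set m | d m == v].
have dP (j : 'I_#|P|) : d (enum_val j) = v by have := enum_valP j; rewrite inE => /eqP.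
have rVdim : \dim {: 'rV[k]_#|P|} = #|P| by rewrite dimvf /dim /= mul1n.
pose e (j : 'I_#|P|) := Scast (d (enum_val j)) v ∘ p (enum_val j).
pose e' (j : 'I_#|P|) := i (enum_val j) ∘ Scast v (d (enum_val j)).
have ee' j j' : e j ∘ e' j' = (j == j')%:R *: idmor _.
  rewrite /e /e' !compmA; case: eqVneq => [<-|ne].
    by rewrite (comp2r (pi _)) compm1 scale1r Scast_comp ?dP.
  by rewrite (comp2r (pi0 _ _ _)) ?compm0 ?comp0m ?scale0r // (inj_eq enum_val_inj) eq_sym.
have le1 : (\dim {: mor X (S v)} <= \dim {: 'rV[k]_#|P|})%N.
  pose f (h : mor X (S v)) := \row_j scalar_of (h ∘ e' j).
  have linf : linear f.
    move=> c h h'; apply/rowP => j; rewrite !mxE /scalar_of compDl compZl.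
    by rewrite linearD linearZ.
  apply: (dim_inj_le linf) => h h' /rowP E; rewrite -[h]compm1 -[h']compm1 -ip.
  rewrite !comp_sumr; apply: eq_bigr => m _; rewrite !compmA; congr (_ ∘ _).
  have [e0|ne] := eqVneq (d m) v; last by rewrite [LHS]S_neq_hom // [RHS]S_neq_hom.
  have Pm : m \in P by rewrite inE e0.
  have := E (enum_rank_in Pm m); rewrite !mxE /e' enum_rankK_in // !compmA.
  set x := h ∘ _ ∘ _; set x' := h' ∘ _ ∘ _ => xx'.
  have {}xx' : x = x' by rewrite (brick_scalar x (Sbrick v)) xx' -brick_scalar //; apply: Sbrick.
  rewrite -[h ∘ i m]compm1 -[h' ∘ i m]compm1 -!(Scast_comp (esym e0)) !compmA.
  by rewrite -/x -/x' xx'.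
have le2 : (\dim {: 'rV[k]_#|P|} <= \dim {: mor X (S v)})%N.
  pose f (r : 'rV[k]_#|P|) := \sum_j r ord0 j *: e j.
  have linf : linear f.
    move=> c r r'; rewrite /f scaler_sumr -big_split; apply: eq_bigr => j _.
    by rewrite !mxE scalerDl scalerA.
  apply: (dim_inj_le linf) => r r' E; apply/rowP => j.
  apply: (brick_scaleI (Sbrick v)).
  have fe' (q : 'rV[k]_#|P|) : f q ∘ e' j = q ord0 j *: idmor _.
    rewrite /f comp_suml (bigD1 j) //= compZl ee' eqxx scale1r big1 ?addr0 // => j' ne.
    by rewrite compZl ee' (negPf ne) scale0r scaler0.
  by rewrite -!fe' E.
by rewrite rVdim in le1 le2; apply/eqP; rewrite eqn_leq le1 le2.
Qed.

Lemma decomp_sum X n d i p (phi : I -> k) : @decomp X n d i p ->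
  \sum_m phi (d m) = \sum_v (mult X v)%:R * phi v.
Proof.
move=> dec; rewrite (partition_big d xpredT) //=; apply: eq_bigr => v _.
rewrite (eq_bigr (fun _ => phi v)) => [|m /eqP-> //].
rewrite sumr_const (mult_card v dec) mulr_natl; congr (_ *+ _).
by apply: eq_card => m; rewrite !inE.
Qed.

Lemma mult_retract X v : mult X v != 0%N ->
  exists (j : mor (S v) X) (q : mor X (S v)), q ∘ j = idmor _.
Proof.
have [n [d [i [p dec]]]] := ex_decomp X; rewrite (mult_card v dec) -lt0n.
case/card_gt0P => m; rewrite inE => /eqP <-; exists (i m), (p m); exact: dec_id.
Qed.

(** Some [i m ∘ p m] is nonzero; a nonzero scalar idempotent is the identity, so this summand is all
    of [X]. *)
Lemma brick_isomorphic X : brick X -> exists v, isomorphic X (S v).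
Proof.
move=> bX; have [n [d [i [p dec]]]] := ex_decomp X.
have [m ipm] : exists m, i m ∘ p m != 0.
  apply: contrapT => N; case: bX => nz _; apply: nz.
  rewrite -(dec_sum dec) big1 // => m _; apply/eqP; apply: contraT => ne.
  by case: N; exists m.
exists (d m), (p m), (i m); split; last exact: dec_id.
have [c cE] := proj2 bX (i m ∘ p m).
have idem : (i m ∘ p m) ∘ (i m ∘ p m) = i m ∘ p m.
  by rewrite !compmA (comp2r (dec_id dec m)) compm1.
rewrite [X in X ∘ _]cE compZl comp1m in idem.
suff c1 : c = 1 by rewrite cE c1 scale1r.
apply/eqP; rewrite -subr_eq0; apply: contraR ipm => /negPf c1.
by rewrite -[_ == 0]orFb -c1 -scaler_eq0 scalerBl scale1r idem subrr.
Qed.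

End Semisimple.

(** * Duality on Hom spaces *)

Section HomSpaces.
Variables (k : fieldType) (C : bpcat k).
Implicit Types X Y Z W V : C.

Lemma dim_mor_iso X X' Y Y' : isomorphic X X' -> isomorphic Y Y' ->
  \dim {: mor X Y} = \dim {: mor X' Y'}.
Proof.
have le A A' B B' : @isomorphic k C A A' -> @isomorphic k C B B' ->
    (\dim {: mor A B} <= \dim {: mor A' B'})%N.
  move=> [f [g [gf fg]]] [f' [g' [g'f' f'g']]].
  apply: (dim_inj_le (f := fun h => f' ∘ h ∘ g)) => [c h h'|h h' E].
    by rewrite compDr compZr compDl compZl.
  have := congr1 (fun x => g' ∘ x ∘ f) E.
  by rewrite !compmA g'f' !comp1m (comp2r gf) (comp2r (f := f) gf) !compm1.
move=> iX iY; apply/eqP; rewrite eqn_leq !le //; exact: isomorphic_sym.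
Qed.

Lemma dim_mor_adj X Y Z : \dim {: mor (X ⊗ Y) Z} = \dim {: mor Y (X^∨ ⊗ Z)}.
Proof.
apply/eqP; rewrite eqn_leq; apply/andP; split.
  apply: (dim_inj_le (f := fun h => (idmor _ ⊠ h) ∘ pcoevT X Y)) => [c h h'|h h' E].
    by rewrite tensDr tensZr compDl compZl.
  have := congr1 (fun x => pevT X Z ∘ (idmor _ ⊠ x)) E.
  by rewrite !tens_compr !compmA !pairT_nat !(comp2r (rzagT _ _)) !compm1.
apply: (dim_inj_le (f := fun h => pevT X Z ∘ (idmor _ ⊠ h))) => [c h h'|h h' E].
  by rewrite tensDr tensZr compDr compZr.
have := congr1 (fun x => (idmor _ ⊠ x) ∘ pcoevT X Y) E.
rewrite !tens_compr -!compmA -!copairT_nat !compmA.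
by rewrite !rzigT !comp1m.
Qed.

Lemma dim_mor_adj' X Y Z : \dim {: mor Y (X ⊗ Z)} = \dim {: mor (X^∨ ⊗ Y) Z}.
Proof.
apply/eqP; rewrite eqn_leq; apply/andP; split.
  apply: (dim_inj_le (f := fun h => evT X Z ∘ (idmor _ ⊠ h))) => [c h h'|h h' E].
    by rewrite tensDr tensZr compDr compZr.
  have := congr1 (fun x => (idmor _ ⊠ x) ∘ coevT X Y) E.
  rewrite !tens_compr -!compmA -!copairT_nat !compmA.
  by rewrite !zigT !comp1m.
apply: (dim_inj_le (f := fun h => (idmor _ ⊠ h) ∘ coevT X Y)) => [c h h'|h h' E].
  by rewrite tensDr tensZr compDl compZl.
have := congr1 (fun x => evT X Z ∘ (idmor _ ⊠ x)) E.
by rewrite !tens_compr !compmA !pairT_nat !(comp2r (zagT _ _)) !compm1.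
Qed.

Lemma braid_isomorphic X Y : isomorphic (X ⊗ Y) (Y ⊗ X).
Proof. by exists (braid X Y), (braidV X Y); rewrite braidVK braidKV. Qed.

(** Two adjunctions rotate the Hom space, the braiding reordering the factors. This symmetry of the
    fusion multiplicities allows the exchange of sums in [gauss_sum]. *)
Lemma dim_mor_dual X Y Z :
  \dim {: mor (X ⊗ Y) Z} = \dim {: mor (Z^∨ ⊗ X) (Y^∨)}.
Proof.
rewrite -dim_mor_adj' -(dim_mor_iso (isomorphic_refl X) (braid_isomorphic (Y^∨) Z)).
by rewrite -dim_mor_adj; apply: dim_mor_iso (braid_isomorphic _ _) (isomorphic_refl _).
Qed.

Lemma dualm_id X : dualm (idmor X) = idmor (X^∨).
Proof. by apply: ev_inj; rewrite ev_dualm. Qed.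

Lemma dualm_comp X Y Z (g : mor Y Z) (f : mor X Y) : dualm (g ∘ f) = dualm f ∘ dualm g.
Proof.
apply: ev_inj; rewrite ev_dualm tens_compl compmA ev_dualm tens_compr compmA.
by rewrite -ev_dualm -!compmA tens_exch.
Qed.

Lemma dualmZ X Y c (f : mor X Y) : dualm (c *: f) = c *: dualm f.
Proof. by apply: ev_inj; rewrite ev_dualm tensZr tensZl !compZr ev_dualm. Qed.

Lemma dual_isomorphic X Y : isomorphic X Y -> isomorphic (X^∨) (Y^∨).
Proof.
move=> [f [g [gf fg]]]; exists (dualm g), (dualm f).
by rewrite -!dualm_comp gf fg !dualm_id.
Qed.

Lemma bidual_isomorphic X : isomorphic X (X^∨^∨).
Proof. by exists (piv X), (pivV X); rewrite pivVK pivKV. Qed.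

Lemma ev_neq0 X : idmor X <> 0 -> ev X <> 0.
Proof. by move=> nz E; apply: nz; rewrite -zigzag E tensm0 compm0 !comp0m. Qed.

Lemma coev_neq0 X : idmor X <> 0 -> coev X <> 0.
Proof. by move=> nz E; apply: nz; rewrite -zigzag E tens0m compm0 comp0m. Qed.

(** The transpose of [g] is conjugate by [piv X] to an endomorphism of [X], hence scalar; naturality
    of [piv] on X^∨ recovers [g] from its double transpose. *)
Lemma dual_brick X : brick X -> brick (X^∨).
Proof.
move=> [nz sc]; split=> [E|g].
  apply: (ev_neq0 nz); rewrite -[ev X]compm1 -tensm1 E tens0m compm0 //.
have [c cE] := sc (pivV X ∘ dualm g ∘ piv X); exists c.
have gE : dualm g = c *: idmor _.
  rewrite -[LHS]compm1 -(pivKV X) -[dualm g]comp1m -(pivKV X) compmA.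
  by rewrite [X in X ∘ _](comp3r cE) compZr compm1 compZl.
have pI : iso_mor (piv (X^∨)) by exists (pivV (X^∨)); rewrite pivVK pivKV.
apply: (iso_mono pI).
by rewrite -piv_nat gE dualmZ dualm_id compZl comp1m compZr compm1.
Qed.

End HomSpaces.

(** * Dimensions, twists and the S-matrix in a fusion category *)

Section Fusion.
Variables (k : closedFieldType) (C : bpcat k).
Hypothesis fusC : fusion C.
Variables (I : finType) (S : I -> C).
Hypothesis irrS : irr_reps S.
Implicit Types X Y Z W : C.

Let abC := fusion_abelian fusC.
Let ssC := fusion_semisimple fusC.
Let SbrickC v : brick (S v) := Sbrick abC irrS v.
Let ex_decompC X := ex_decomp ssC irrS X.

Lemma unit_brick : brick (tunit : C).
Proof. exact: simple_brick abC _ (fusion_unit fusC). Qed.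
Let uB := unit_brick.

Lemma theta_isomorphic X Y : brick X -> isomorphic X Y -> theta X = theta Y.
Proof.
move=> bX [f [g [gf fg]]].
have tX := brick_scalar (twist X) bX; set c := scalar_of _ in tX.
have tY : twist Y = c *: idmor Y.
  by rewrite -[LHS]compm1 -fg compmA twist_nat tX compZr compm1 compZl fg.
have nz : idmor Y != 0.
  apply/eqP => E; case: bX => nX _; apply: nX.
  by rewrite -gf -[f]comp1m E comp0m compm0.
by rewrite /theta tY scalar_ofZ.
Qed.

Lemma theta_neq0 X : brick X -> theta X != 0.
Proof.
move=> bX; have tX := brick_scalar (twist X) bX.
have [w [wt _]] := twist_iso X; apply/eqP => E.
by case: bX => nX _; apply: nX; rewrite -wt tX -/(theta X) E scale0r compm0.
Qed.

Lemma Smat_isomorphic L X Y : isomorphic X Y -> Smat L X = Smat L Y.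
Proof.
move=> [f [g [gf fg]]].
rewrite /Smat -[LHS](trR_iso (f := idmor L ⊠ f) (g := idmor L ⊠ g)).
  rewrite !compmA -braid_nat (comp2r (esym (braid_nat _ _))) compmA.
  by rewrite (comp2r (esym (tens_compr _ f g))) fg tensm1 compm1.
by rewrite -tens_compr gf tensm1.
Qed.

Lemma trR_eigen X n d i p (f : mor X X) (c : 'I_n -> k) :
    @decomp _ _ _ S X n d i p -> (forall m, f ∘ i m = c m *: i m) ->
  trR f = \sum_m c m * qdimR (S (d m)).
Proof.
move=> dec fi; rewrite -[f]compm1 -(dec_sum dec) comp_sumr trR_sum //.
apply: eq_bigr => m _; rewrite compmA fi compZl trRZ // trR_cyc.
by rewrite (dec_id dec).
Qed.

Lemma qdimR_sum X : qdimR X = \sum_v (mult S X v)%:R * qdimR (S v).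
Proof.
have [n [d [i [p dec]]]] := ex_decompC X.
rewrite -(decomp_sum abC irrS _ dec) /qdimR.
rewrite (trR_eigen (c := fun=> 1) dec) => [|m]; last by rewrite comp1m scale1r.
by apply: eq_bigr => m _; rewrite mul1r.
Qed.

Lemma Smat_sum L X : Smat L X = \sum_v (mult S X v)%:R * Smat L (S v).
Proof.
have [n [d [i [p dec]]]] := ex_decompC X.
rewrite -(decomp_sum abC irrS (fun v => Smat L (S v)) dec) /Smat.
rewrite -[braid X L ∘ _]compm1 -tensm1 -(dec_sum dec) tens_sumr comp_sumr trR_sum //.
apply: eq_bigr => m _; rewrite tens_compr compmA trR_cyc !compmA.
rewrite -braid_nat (comp2r (esym (braid_nat _ _))) compmA.
by rewrite (comp2r (esym (tens_compr _ _ _))) (dec_id dec) tensm1 compm1.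
Qed.

(** The trace of the twist of X ⊗ Y is computed by balancing and by its eigenvalues on the
    summands. *)
Lemma twist_sum X Y : brick X -> brick Y ->
  theta X * theta Y * Smat X Y =
  \sum_v (mult S (X ⊗ Y) v)%:R * (theta (S v) * qdimR (S v)).
Proof.
move=> bX bY; have [n [d [i [p dec]]]] := ex_decompC (X ⊗ Y).
rewrite -(decomp_sum abC irrS (fun v => theta (S v) * qdimR (S v)) dec).
rewrite -(trR_eigen (f := twist (X ⊗ Y)) (c := fun m => theta (S (d m))) dec).
  rewrite twist_tens (brick_scalar (twist X) bX) (brick_scalar (twist Y) bY).
  by rewrite tensZl tensZr tensm1 !compZr compm1 !trRZ // mulrA.
by move=> m; rewrite twist_nat {1}(brick_scalar (twist _) (SbrickC _)) compZr compm1.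
Qed.

(** By balancing the inverse double braiding is theta_X theta_Y times the inverse twist, which acts
    on a summand [v] by theta_v^-1. *)
Lemma twistV_sum X Y : brick X -> brick Y ->
  trR (braidV X Y ∘ braidV Y X) =
  theta X * theta Y *
  \sum_v (mult S (X ⊗ Y) v)%:R * ((theta (S v))^-1 * qdimR (S v)).
Proof.
move=> bX bY; have [n [d [i [p dec]]]] := ex_decompC (X ⊗ Y).
rewrite -(decomp_sum abC irrS (fun v => (theta (S v))^-1 * qdimR (S v)) dec).
rewrite (trR_eigen (c := fun m => theta X * theta Y * (theta (S (d m)))^-1) dec).
  by rewrite mulr_sumr; apply: eq_bigr => m _; rewrite !mulrA.
move=> m; have t0 := theta_neq0 (SbrickC (d m)).
apply: (scalerI t0); rewrite scalerA mulrCA mulfV // mulr1 -compZr.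
have <- : twist (X ⊗ Y) ∘ i m = theta (S (d m)) *: i m.
  by rewrite twist_nat {1}(brick_scalar (twist _) (SbrickC _)) compZr compm1.
rewrite twist_tens !compmA (comp2r (braidVK _ _)) compm1 braidVK comp1m.
rewrite {1}(brick_scalar (twist X) bX) {1}(brick_scalar (twist Y) bY).
by rewrite tensZl tensZr tensm1 !compZl comp1m scalerA.
Qed.

(* By semisimplicity [coev X] has a retraction, which is a multiple of        *)
(* [pev X].                                                                   *)
Lemma qdimR_neq0 X : brick X -> qdimR X != 0.
Proof.
move=> bX; have [n [d [i [p dec]]]] := ex_decompC (X ⊗ X^∨).
have [m nm] : exists m, p m ∘ coev X != 0.
  apply: contrapT => N; case: bX => nz _; apply: (coev_neq0 nz).
  rewrite -[coev X]comp1m -(dec_sum dec) comp_suml big1 // => m _.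
  rewrite -compmA; apply/eqP; apply: contraT => ne; case: N; exists m.
  by apply: contra ne => /eqP ->; rewrite compm0.
have simS : simple_obj (S (d m)) by case: irrS.
have [r [rc _]] := simple_iso abC (fusion_unit fusC) simS nm.
have [c cE] := proj2 bX (pivV X ∘ mate (r ∘ p m)).
have rE : r ∘ p m = c *: pev X.
  rewrite -[LHS]ev_mate -[mate _]comp1m -(pivKV X) -compmA cE compZr compm1.
  by rewrite tensZl compZr pevE.
apply/eqP => d0; case: uB => nz _; apply: nz.
rewrite -rc compmA rE compZl; have := trRE (idmor X).
rewrite tensm1 compm1 -/(qdimR X) d0 => E.
by rewrite (brick_scalar (pev X ∘ coev X) uB) -E scale0r scaler0.
Qed.

Lemma theta_dual_qdim X : brick X ->
  theta (X^∨) * qdimR X = theta X * qdimL X.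
Proof. by move=> bX; apply: twist_dual_qdim => //; apply: dual_brick. Qed.

Lemma pev_piv_brick X : brick X -> pev (X^∨) ∘ (idmor _ ⊠ piv X) = ev X.
Proof. by move=> bX; apply: pev_piv; rewrite ?qdimR_neq0 //; apply: dual_brick. Qed.

(** The [piv] that relates the cups of X^∨ and [X] is absorbed by the cap of X^∨ ([pev_piv]), which
    leaves the loop of the left trace. *)
Lemma qdimR_dual X : brick X -> qdimR (X^∨) = qdimL X.
Proof.
move=> bX; apply: (brick_scaleI uB).
have := trRT uB (idmor (X^∨)) (tunit : C); rewrite tensm1 compm1 -/(qdimR _) => <-.
have := trLT uB (idmor X) (tunit : C); rewrite !tensm1 compm1 -/(qdimL _) => <-.
by rewrite coevT_dual compmA -homT_tens -pairT_comp pev_piv_brick.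
Qed.

Lemma Smat_dual_qdim W Z : brick Z ->
  qdimR Z * Smat W (Z^∨) = qdimL Z * trR (braidV W Z ∘ braidV Z W).
Proof.
move=> bZ; apply: (mulfI (theta_neq0 bZ)).
rewrite mulrCA (Smat_dual uB W bZ (dual_brick bZ) (pev_piv_brick bZ)).
by rewrite mulrCA !mulrA theta_dual_qdim.
Qed.

End Fusion.

(** * Characters of A *)

Section Functor.
Variables (k : fieldType) (D C : bpcat k) (F : bpfunctor D C).
Implicit Types V W : D.

Lemma F_isomorphic V W : isomorphic V W -> isomorphic (F V) (F W).
Proof.
move=> [f [g [gf fg]]]; exists (Fhom F f), (Fhom F g).
by rewrite -!Fhom_comp gf fg !Fhom1.
Qed.

Lemma F_tens_isomorphic V W : isomorphic (F V ⊗ F W) (F (V ⊗ W)).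
Proof. by exists (Fmu F V W); apply: Fmu_iso. Qed.

Lemma F_unit_isomorphic : isomorphic (F tunit) tunit.
Proof. by exists (Fmu0V F), (Fmu0 F); rewrite Fmu0VK Fmu0KV. Qed.

(** Along the canonical map [Fd] both [pev X] and [ev X ∘ braid X (X^∨)] become the image of the
    pairing of [V], because [F] preserves braiding and pivotal structure. They differ by theta, and
    their common value [e] is nonzero by faithfulness. *)
Lemma F_theta1 V : fully_faithful F -> brick (F V) -> idmor V <> 0 ->
  piv V = drinfeld V -> theta (F V) = 1.
Proof.
move=> ff bV nz pivE; set X : C := F V.
pose Fd V := mate (Fmu0V F ∘ Fhom F (ev V) ∘ Fmu F (V^∨) V).
set e := ev X ∘ braid X (X^∨) ∘ (idmor X ⊠ Fd V).
have eE : e = Fmu0V F ∘ Fhom F (ev V ∘ braid V (V^∨)) ∘ Fmu F V (V^∨).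
  rewrite /e -compmA braid_nat compmA ev_mate Fhom_comp !compmA.
  by rewrite (comp2r (Fmu_braid _ _ _)) compmA.
have pE : pev X ∘ (idmor X ⊠ Fd V) = e.
  rewrite eE pevE -compmA -tens_exch compmA -ev_dualm -compmA -tens_compl Fmu_piv.
  rewrite tens_compl compmA ev_mate.
  rewrite -(Fhom1 F) (comp2r (Fmu_nat _ _ _)) compmA (comp2r (esym (Fhom_comp _ _ _))).
  by rewrite pivE ev_drinfeld.
have e_neq0 : e != 0.
  apply/eqP; rewrite eE => E.
  have E' : Fhom F (ev V ∘ braid V (V^∨)) = 0.
    apply: (iso_epi (Fmu_iso F V (V^∨))).
    apply: (iso_mono (f := Fmu0V F)); first by exists (Fmu0 F); rewrite Fmu0VK Fmu0KV.
    by rewrite compmA E comp0m compm0.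
  have F0 : Fhom F (0 : mor (V ⊗ V^∨) tunit) = 0.
    have := @Fhom_linear _ _ _ F _ _ 1 (0 : mor (V ⊗ V^∨) tunit) 0.
    by rewrite !scale1r addr0 => /eqP; rewrite -subr_eq0 opprD addrA subrr add0r oppr_eq0 => /eqP.
  rewrite -F0 in E'; apply: (ev_neq0 nz).
  have br : iso_mor (braid V (V^∨)) by exists (braidV V (V^∨)); rewrite braidVK braidKV.
  by apply: (iso_epi br); rewrite comp0m; apply: (bij_inj (ff _ _)).
have tX := brick_scalar (twist X) bV.
move: pE; rewrite pev_twist tX tensZl tensm1 compZr compm1 compZl -/e -/(theta X).
move/eqP; rewrite -[X in _ == X]scale1r -subr_eq0 -scalerBl scaler_eq0 (negPf e_neq0).
by rewrite orbF subr_eq0 => /eqP.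
Qed.

End Functor.

Section Characters.
Variables (k : fieldType) (A : finGroupType) (z : A).
Variables (char0 : [pchar k] =i pred0) (abelA : abelian [set: A]).
Variable z2 : (z ^+ 2)%g = 1%g.
Notation D := (rep_bpcat char0 abelA z2).
Implicit Types alpha beta : linchar k A.

Definition lc_one : linchar k A.
Proof. by exists (fun _ => 1) => // g h; rewrite mulr1. Defined.

Definition lc_mul alpha beta : linchar k A.
Proof.
exists (fun g => alpha g * beta g) => [|g h]; first by rewrite !lc1 mulr1.
by rewrite !lcM mulrACA.
Defined.

Lemma lc_neq0 alpha g : alpha g != 0.
Proof.
apply/eqP => a0; have := lc1 alpha; rewrite -(mulgV g) lcM a0 mul0r.
by move/eqP; rewrite eq_sym oner_eq0.
Qed.

Lemma lcV alpha g : alpha g^-1%g = (alpha g)^-1.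
Proof.
by apply: (mulIf (lc_neq0 alpha g)); rewrite -lcM mulVg lc1 mulVf // lc_neq0.
Qed.

Definition lc_inv alpha : linchar k A.
Proof.
exists (fun g => (alpha g)^-1) => [|g h]; first by rewrite lc1 invr1.
by rewrite lcM invfM.
Defined.

Lemma tensmx_scalar1 (a b : k) :
  (a%:M : 'M[k]_1) *t (b%:M : 'M[k]_1) = ((a * b)%:M : 'M[k]_1).
Proof.
by rewrite -[a%:M]scalemx1 -[b%:M]scalemx1 tensmxZl tensmxZr tensmx11 scalerA scalemx1.
Qed.

Lemma rep_isomorphic1 (V W : D) (e : rep_dim V = rep_dim W) :
  (forall g, castmx (e, e) (rep_mx V g) = rep_mx W g) -> isomorphic V W.
Proof.
case: V e => n V; case: W => m W /= e; case: _ / e W => W E.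
have H g : V g *m 1%:M = 1%:M *m W g by rewrite mulmx1 mul1mx -E castmx_id.
have H' g : W g *m 1%:M = 1%:M *m V g by rewrite mulmx1 mul1mx -E castmx_id.
exists (@rep_mor _ _ (Rep V) (Rep W) _ H), (@rep_mor _ _ (Rep W) (Rep V) _ H').
by split; apply: val_inj; rewrite /= mulmx1.
Qed.

Lemma rep1_mul_isomorphic alpha beta :
  isomorphic ((rep1 alpha : D) ⊗ rep1 beta) (rep1 (lc_mul alpha beta)).
Proof.
apply: (@rep_isomorphic1 (rep_tens (rep1 alpha) (rep1 beta)) (rep1 _) erefl) => g.
rewrite castmx_id; exact: tensmx_scalar1.
Qed.

Lemma rep1_one_isomorphic : isomorphic (rep1 lc_one : D) tunit.
Proof. by apply: (@rep_isomorphic1 (rep1 lc_one) (rep_unit _ _) erefl) => g; rewrite castmx_id. Qed.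

Lemma rep1_ext_isomorphic alpha beta : alpha =1 beta ->
  isomorphic (rep1 alpha : D) (rep1 beta).
Proof.
move=> E; apply: (@rep_isomorphic1 (rep1 alpha) (rep1 beta) erefl) => g; rewrite castmx_id /=.
by rewrite E.
Qed.

Lemma rep1_id_neq0 alpha : idmor (rep1 alpha : D) <> 0.
Proof.
move/(congr1 vsval)/matrixP/(_ ord0 ord0); rewrite /= !mxE => /eqP.
by rewrite oner_eq0.
Qed.

End Characters.

Section Bricks.
Variables (k : fieldType) (C : lincat k).
Implicit Types X Y : C.

Lemma brick_isomorphic_trans X Y : isomorphic X Y -> brick X -> brick Y.
Proof.
move=> [f [g [gf fg]]] [nz sc]; split=> [E|h].
  by apply: nz; rewrite -gf -[f]comp1m E comp0m compm0.
have [c cE] := sc (g ∘ h ∘ f); exists c.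
have -> : h = f ∘ (g ∘ h ∘ f) ∘ g by rewrite !compmA fg comp1m -compmA fg compm1.
by rewrite cE compZr compm1 compZl fg.
Qed.

End Bricks.

Section Invertible.
Variables (k : fieldType) (C : moncat k).
Implicit Types X Y J K : C.

Lemma tens_isomorphic X X' Y Y' :
  isomorphic X X' -> isomorphic Y Y' -> isomorphic (X ⊗ Y) (X' ⊗ Y').
Proof. by move=> [f fP] [g gP]; exists (f ⊠ g); apply: iso_tens. Qed.

Lemma tens_inverse_isomorphic J K X : isomorphic (J ⊗ K) tunit ->
  isomorphic (J ⊗ (K ⊗ X)) X.
Proof.
move=> iJK; apply: (isomorphic_trans (Y := (J ⊗ K) ⊗ X)).
  by exists (assocV J K X); apply: iso_assocV.
apply: (isomorphic_trans (Y := tunit ⊗ X)).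
  exact: tens_isomorphic (isomorphic_refl _).
by exists (lunit X), (lunitV X); rewrite lunitVK lunitKV.
Qed.

Lemma tens_invertible_inj J K X Y (f g : mor X Y) : isomorphic (J ⊗ K) tunit ->
  idmor K ⊠ f = idmor K ⊠ g -> f = g.
Proof.
move=> [u [v [vu uv]]] E; apply: tensm1l_inj.
have {}E : idmor (J ⊗ K) ⊠ f = idmor (J ⊗ K) ⊠ g.
  apply: (iso_mono (iso_assoc J K Y)).
  by rewrite -tensm1 !assoc_nat E.
have hE h : idmor tunit ⊠ h = (u ⊠ idmor Y) ∘ (idmor (J ⊗ K) ⊠ h) ∘ (v ⊠ idmor X).
  by rewrite -!tensm_comp compm1 comp1m compm1 uv.
by rewrite !hE E.
Qed.

Lemma tens_invertible_brick J K X : isomorphic (J ⊗ K) tunit ->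
  isomorphic (K ⊗ J) tunit -> brick X -> brick (K ⊗ X).
Proof.
move=> iJK iKJ bX.
have [nz sc] := brick_isomorphic_trans (isomorphic_sym (tens_inverse_isomorphic X iJK)) bX.
split=> [E|f]; first by apply: nz; rewrite -tensm1 E tensm0.
have [c cE] := sc (idmor J ⊠ f); exists c.
apply: (tens_invertible_inj iKJ); by rewrite cE tensZr tensm1.
Qed.

End Invertible.

(** * The objects of the characters and the grading *)

Section CharacterObjects.
Variables (k : closedFieldType) (A : finGroupType) (z : A).
Variables (char0 : [pchar k] =i pred0) (abelA : abelian [set: A]).
Variable z2 : (z ^+ 2)%g = 1%g.
Variables (C : bpcat k) (F : bpfunctor (rep_bpcat char0 abelA z2) C).
Hypotheses (fusC : fusion C) (ffF : fully_faithful F).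
Variables (I : finType) (S : I -> C).
Hypothesis irrS : irr_reps S.
Implicit Types (X Y Z : C) (alpha beta : linchar k A).

Let uB := unit_brick fusC.
Notation Xc alpha := (Xchar F alpha).

Lemma brick_hom_isomorphic X Y (f : mor X Y) :
  brick X -> brick Y -> f != 0 -> isomorphic X Y.
Proof.
move=> bX bY nz.
have [u iu] := brick_isomorphic (fusion_semisimple fusC) irrS bX.
have [v iv] := brick_isomorphic (fusion_semisimple fusC) irrS bY.
have [uv|ne] := eqVneq u v.
  by apply: isomorphic_trans iu _; rewrite uv; apply: isomorphic_sym.
case: iu iv => [f1 [g1 [gf1 fg1]]] [f2 [g2 [gf2 fg2]]].
case/eqP: nz; rewrite -[f]comp1m -gf2 -[f]compm1 -gf1.
have -> : g2 ∘ f2 ∘ (f ∘ (g1 ∘ f1)) = g2 ∘ (f2 ∘ f ∘ g1) ∘ f1 by rewrite !compmA.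
have -> : f2 ∘ f ∘ g1 = 0 by apply: (S_neq_hom (fusion_abelian fusC) irrS) ne.
by rewrite compm0 comp0m.
Qed.

Lemma Xchar_tens alpha beta : isomorphic (Xc alpha ⊗ Xc beta) (Xc (lc_mul alpha beta)).
Proof.
apply: isomorphic_trans (F_tens_isomorphic F _ _) _.
exact: F_isomorphic (rep1_mul_isomorphic _ _ _ _ _).
Qed.

Lemma Xchar_ext alpha beta : alpha =1 beta -> isomorphic (Xc alpha) (Xc beta).
Proof. by move=> E; apply: F_isomorphic; apply: rep1_ext_isomorphic. Qed.

Lemma Xchar_one alpha : (forall g, alpha g = 1) -> isomorphic (Xc alpha) tunit.
Proof.
move=> E; apply: isomorphic_trans (F_unit_isomorphic F).
apply: isomorphic_trans (F_isomorphic F (rep1_one_isomorphic _ _ _)).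
exact: Xchar_ext.
Qed.

Lemma Xchar_inv alpha : isomorphic (Xc alpha ⊗ Xc (lc_inv alpha)) tunit.
Proof.
apply: isomorphic_trans (Xchar_tens _ _) _; apply: Xchar_one => g /=.
by rewrite mulfV ?lc_neq0.
Qed.

Lemma Xchar_invV alpha : isomorphic (Xc (lc_inv alpha) ⊗ Xc alpha) tunit.
Proof.
apply: isomorphic_trans (Xchar_tens _ _) _; apply: Xchar_one => g /=.
by rewrite mulVf ?lc_neq0.
Qed.

Lemma Xchar_tens_brick alpha X : brick X -> brick (Xc alpha ⊗ X).
Proof. exact: tens_invertible_brick (Xchar_invV _) (Xchar_inv _). Qed.

Lemma Xchar_brick alpha : brick (Xc alpha).
Proof.
apply: brick_isomorphic_trans (Xchar_tens_brick alpha uB).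
by exists (runit _), (runitV _); rewrite runitVK runitKV.
Qed.

(* The pivotal structure of [Rep (A, z)] is its Drinfeld morphism.            *)
Lemma theta_Xchar alpha : theta (Xc alpha) = 1.
Proof.
apply: F_theta1 => //; first exact: Xchar_brick; first exact: rep1_id_neq0.
exact: rep_drinfeld.
Qed.

Lemma Xchar_dual alpha : isomorphic (Xc (lc_inv alpha)) (Xc alpha)^∨.
Proof.
have [f [g [gf _]]] := Xchar_invV alpha.
apply: (brick_hom_isomorphic (f := mate f)) (Xchar_brick _) (dual_brick (Xchar_brick _)) _.
apply/eqP => E; have := ev_mate f; rewrite E tens0m compm0 => f0.
have := Xchar_tens_brick (lc_inv alpha) (Xchar_brick alpha).
by case=> nz _; apply: nz; rewrite -gf -f0 compm0.
Qed.

(** The twists of X_alpha and of its dual are trivial, so the left and right dimensions agree. *)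
Lemma qdimR_Xchar_inv alpha : qdimR (Xc (lc_inv alpha)) = qdimR (Xc alpha).
Proof.
have bX := Xchar_brick alpha.
have := theta_dual_qdim fusC bX.
rewrite -(theta_isomorphic (Xchar_brick _) (Xchar_dual alpha)) !theta_Xchar !mul1r => ->.
by rewrite (qdimR_isomorphic (Xchar_dual alpha)) (qdimR_dual fusC irrS).
Qed.

Lemma qdimR_Xchar_sq alpha : qdimR (Xc alpha) * qdimR (Xc alpha) = 1.
Proof.
rewrite -{2}qdimR_Xchar_inv -(qdimR_tens uB) (qdimR_isomorphic (Xchar_inv alpha)).
by apply: (qdimR_tunit uB); apply: (qdimR_neq0 fusC irrS).
Qed.

Lemma Smat_degree h X alpha : of_degree F h X ->
  Smat (Xc alpha) X = alpha h * (qdimR (Xc alpha) * qdimR X).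
Proof. by move=> /(_ alpha) E; rewrite /Smat E trRZ // -(qdimR_tens uB). Qed.

(** The product X_alpha ⊗ X is again a brick of nonzero dimension, so its double braiding is a
    scalar, determined by the trace. *)
Lemma of_degree_Smat h X : brick X ->
  (forall alpha, Smat (Xc alpha) X = alpha h * (qdimR (Xc alpha) * qdimR X)) ->
  of_degree F h X.
Proof.
move=> bX SE alpha; have bb := Xchar_tens_brick alpha bX.
have [c cE] := proj2 bb (braid X (Xc alpha) ∘ braid (Xc alpha) X).
rewrite cE; congr (_ *: _); have := SE alpha; rewrite /Smat cE trRZ // -/(qdimR _).
rewrite (qdimR_tens uB); apply: mulIf.
by rewrite mulf_neq0 // (qdimR_neq0 fusC irrS) //; apply: Xchar_brick.
Qed.

Lemma of_degree_tens g h X Y : of_degree F g X -> of_degree F h Y ->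
  of_degree F (g * h)%g (X ⊗ Y).
Proof.
move=> dX dY alpha; rewrite lcM.
exact: double_braid_scalar_tens (dX alpha) (dY alpha).
Qed.

Lemma of_degree_retract h X Y (j : mor Y X) (q : mor X Y) :
  q ∘ j = idmor Y -> of_degree F h X -> of_degree F h Y.
Proof. by move=> qj dX alpha; apply: double_braid_scalar_retract qj (dX alpha). Qed.

Lemma of_degree_isomorphic h X Y : isomorphic X Y -> of_degree F h X -> of_degree F h Y.
Proof. by move=> [f [g [gf fg]]]; apply: of_degree_retract fg. Qed.

Lemma of_degree_dual h X : brick X -> of_degree F h X -> of_degree F h^-1%g (X^∨).
Proof.
move=> bX dX; apply: of_degree_Smat (dual_brick bX) _ => alpha.
apply: (mulfI (qdimR_neq0 fusC irrS bX)).
rewrite (Smat_dual_qdim fusC irrS _ bX) (qdimR_dual fusC irrS) //.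
have -> : braidV (Xc alpha) X ∘ braidV X (Xc alpha) = (alpha h)^-1 *: idmor _.
  apply: (scalerI (lc_neq0 alpha h)).
  rewrite scalerA mulfV ?lc_neq0 // scale1r -compZr.
  suff -> : alpha h *: braidV X (Xc alpha) = braid (Xc alpha) X by rewrite braidVK.
  by rewrite -[RHS]comp1m -(braidVK X (Xc alpha)) -compmA dX compZr compm1.
rewrite trRZ // -/(qdimR _) (qdimR_tens uB) lcV.
by ring.
Qed.

Lemma Smat_Xchar_tens h X Y alpha : brick X -> of_degree F h X ->
  Smat X (Xc alpha ⊗ Y) = alpha h * qdimR (Xc alpha) * Smat X Y.
Proof.
move=> bX dX; apply: (mulIf (qdimR_neq0 fusC irrS bX)).
by rewrite (Smat_tens uB) // (Smat_sym X) (Smat_degree _ dX); ring.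
Qed.

Lemma theta_Xchar_tens X alpha : brick X -> of_degree F 1%g X ->
  theta (Xc alpha ⊗ X) = theta X.
Proof.
move=> bX dX; rewrite {1}/theta twist_tens dX lc1 scale1r comp1m.
rewrite (brick_scalar (twist (Xc alpha)) (Xchar_brick _)) (brick_scalar (twist X) bX).
rewrite -!/(theta _) theta_Xchar scale1r tensZr tensm1 scalar_ofZ //.
by apply/eqP; case: (Xchar_tens_brick alpha bX).
Qed.

(** All twists of characters and of their products are trivial, so balancing makes the double
    braiding the identity. *)
Lemma of_degree_Xchar alpha : of_degree F 1%g (Xc alpha).
Proof.
move=> beta; rewrite lc1 scale1r.
have bb := Xchar_tens_brick beta (Xchar_brick alpha).
have th : theta (Xc beta ⊗ Xc alpha) = 1.
  by rewrite (theta_isomorphic bb (Xchar_tens _ _)) theta_Xchar.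
have := brick_scalar (twist (Xc beta ⊗ Xc alpha)) bb; rewrite -/(theta _) th scale1r => <-.
rewrite twist_tens (brick_scalar (twist (Xc beta)) (Xchar_brick _)).
rewrite (brick_scalar (twist (Xc alpha)) (Xchar_brick _)) -!/(theta _) !theta_Xchar.
by rewrite !scale1r tensm1 compm1.
Qed.

Lemma of_degree_Xchar_tens h X alpha : of_degree F h X -> of_degree F h (Xc alpha ⊗ X).
Proof. by move/(of_degree_tens (of_degree_Xchar alpha)); rewrite mul1g. Qed.

(** Tested on the simple object isomorphic to X_alpha, the equation for [bar] has the dual character
    on its left side, hence the eigenvalue alpha(h)^-1. *)
Lemma of_degree_bar (bar : I -> I) h v : is_bar S bar -> of_degree F h (S v) ->
  of_degree F h^-1%g (S (bar v)).
Proof.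
move=> barP dv; have bS w := Sbrick (fusion_abelian fusC) irrS w.
apply: of_degree_Smat => // alpha.
have [j ij] := brick_isomorphic (fusion_semisimple fusC) irrS (Xchar_brick alpha).
have := barP v j.
rewrite -(Smat_isomorphic _ ij).
have -> : Smat (S v) ((S j)^∨) = Smat (S v) (Xc (lc_inv alpha)).
  apply: Smat_isomorphic; apply: isomorphic_sym.
  exact: isomorphic_trans (Xchar_dual alpha) (dual_isomorphic ij).
rewrite !(Smat_sym (S _)) (Smat_degree _ dv) qdimR_Xchar_inv.
have nz w := qdimR_neq0 fusC irrS (bS w).
move/(congr1 (fun x => x * qdimR (S (bar v)))); rewrite divfK // => <-.
by rewrite !mulrA mulfK // lcV.
Qed.

End CharacterObjects.

(** * Gauss sums and orbits *)

Section CyclicCharacters.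
Variables (k : closedFieldType) (A : finGroupType).
Hypothesis char0 : [pchar k] =i pred0.

Lemma closed_prim_root n : (0 < n)%N -> exists w : k, n.-primitive_root w.
Proof.
move=> n0; pose p : {poly k} := 'X^n - 1.
have [r Dp] := closed_field_poly_normal p.
rewrite (monicP _) ?monic_Xn_sub_1 // scale1r in Dp.
have rn1 : all n.-unity_root r by apply/allP => w; rewrite -root_prod_XsubC -Dp.
have sz_r : (n < (size r).+1)%N by rewrite -(size_prod_XsubC r id) -Dp size_Xn_sub_1.
have [|w] := hasP (has_prim_root n0 rn1 _ sz_r); last by exists w.
by rewrite -separable_prod_XsubC -Dp separable_Xn_sub_1 // (pcharf0P k).1 // -lt0n.
Qed.

Variable a : A.
Hypothesis gen_a : generator [set: A] a.

Lemma order_gen : #[a]%g = #|A|.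
Proof. by rewrite /order -(eqP gen_a) cardsT. Qed.

Lemma genP g : exists m, g = (a ^+ m)%g.
Proof. by apply/cycleP; rewrite -(eqP gen_a) inE. Qed.

Lemma lcX (alpha : linchar k A) g m : alpha (g ^+ m)%g = alpha g ^+ m.
Proof.
elim: m => [|m IH]; first by rewrite expg0 expr0 lc1.
by rewrite expgS lcM IH exprS.
Qed.

Lemma lc_eq (alpha beta : linchar k A) : alpha a = beta a -> alpha =1 beta.
Proof. by move=> E g; have [m ->] := genP g; rewrite !lcX E. Qed.

Lemma lc_root (alpha : linchar k A) : alpha a ^+ #|A| = 1.
Proof. by rewrite -lcX -order_gen expg_order lc1. Qed.

(** Raise [w] to a chosen discrete logarithm in base [a]; it matters only modulo #A. *)
Lemma ex_linchar (w : k) : w ^+ #|A| = 1 -> exists alpha : linchar k A, alpha a = w.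
Proof.
move=> w1; have /choice[lg lgP] := genP.
have E m m' : (a ^+ m)%g = (a ^+ m')%g -> w ^+ m = w ^+ m'.
  move/eqP; rewrite eq_expg_mod_order order_gen => /eqP mm'.
  by rewrite -(expr_mod m w1) mm' expr_mod.
have f1 : w ^+ lg 1%g = 1 by rewrite -[RHS](expr0 w); apply: E; rewrite -lgP.
have fM g h : w ^+ lg (g * h)%g = w ^+ lg g * w ^+ lg h.
  by rewrite -exprD; apply: E; rewrite -lgP expgD -!lgP.
exists (LinChar f1 fM); rewrite /= -[RHS]expr1; apply: E.
by rewrite -lgP.
Qed.

End CyclicCharacters.

Section GaussSum.
Variables (k : closedFieldType) (A : finGroupType) (z : A).
Variables (char0 : [pchar k] =i pred0) (abelA : abelian [set: A]).
Variable z2 : (z ^+ 2)%g = 1%g.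
Variables (C : bpcat k) (F : bpfunctor (rep_bpcat char0 abelA z2) C).
Hypotheses (fusC : fusion C) (ffF : fully_faithful F).
Variables (I : finType) (S : I -> C).
Hypothesis irrS : irr_reps S.
Implicit Types (alpha beta : linchar k A).

Let uB := unit_brick fusC.
Let bS v : brick (S v) := Sbrick (fusion_abelian fusC) irrS v.
Notation Xc alpha := (Xchar F alpha).
Notation I1 := (Ideg F S 1%g).
Let d v := qdimR (S v).
Let d_neq0 v : d v != 0 := qdimR_neq0 fusC irrS (bS v).
Let t v := theta (S v).
Let t_neq0 v : t v != 0 := theta_neq0 (bS v).

Lemma IdegP h v : reflect (of_degree F h (S v)) (v \in Ideg F S h).
Proof. by rewrite inE; apply: asboolP. Qed.

Lemma ex_dual_index : exists2 s : I -> I, injective s &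
  forall v, isomorphic ((S v)^∨) (S (s v)).
Proof.
have /choice[s sP] v : exists u, isomorphic ((S v)^∨) (S u).
  exact: (brick_isomorphic (fusion_semisimple fusC) irrS (dual_brick (bS v))).
exists s => // u v suv; have [_ injS _] := irrS; apply: injS.
apply: isomorphic_trans (bidual_isomorphic _) _.
apply: isomorphic_trans (isomorphic_sym (bidual_isomorphic _)).
apply: dual_isomorphic; apply: isomorphic_trans (sP u) _; rewrite suv.
exact: isomorphic_sym.
Qed.

Lemma Ideg_mult g h u v w : u \in Ideg F S g -> v \in Ideg F S h ->
  mult S (S u ⊗ S v) w != 0%N -> w \in Ideg F S (g * h)%g.
Proof.
move=> /IdegP du /IdegP dv /(mult_retract (fusion_abelian fusC) (fusion_semisimple fusC) irrS).
move=> [j [q qj]]; apply/IdegP; apply: of_degree_retract qj _.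
exact: of_degree_tens.
Qed.

(** Replacing [v] by its dual and expanding the inverse double braiding over the constituents [u] of
    w ⊗ v, the sum over [v] becomes a dimension and the sum over [u] becomes tau^-. *)
Lemma gauss_sum w : w \in I1 ->
  \sum_(v in I1) (t v)^-1 * d v * Smat (S w) (S v) = tau_minus F S * (t w * d w).
Proof.
move=> wI1; have [s s_inj sP] := ex_dual_index.
have I1s v : (s v \in I1) = (v \in I1).
  apply/idP/idP => /IdegP dv; apply/IdegP.
    have := of_degree_dual fusC irrS (bS _) dv; rewrite invg1.
    apply: of_degree_isomorphic; apply: isomorphic_trans (dual_isomorphic _) _.
      exact: isomorphic_sym (sP v).
    exact: isomorphic_sym (bidual_isomorphic _).
  apply: of_degree_isomorphic (sP v) _.
  by have := of_degree_dual fusC irrS (bS _) dv; rewrite invg1.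
pose N v u := mult S ((S u)^∨ ⊗ S w) (s v).
have NE v u : mult S (S w ⊗ S v) u = N v u.
  rewrite /N /mult dim_mor_dual; exact: dim_mor_iso (isomorphic_refl _) (sP v).
have termE v : (t (s v))^-1 * d (s v) * Smat (S w) (S (s v)) =
    \sum_u t w * ((t u)^-1 * d u) * ((N v u)%:R * d (s v)).
  rewrite /t /d -(theta_isomorphic (dual_brick (bS v)) (sP v)).
  rewrite -(qdimR_isomorphic (sP v)) -(Smat_isomorphic _ (sP v)).
  rewrite (qdimR_dual fusC irrS (bS v)).
  have t'_neq0 := theta_neq0 (dual_brick (bS v)).
  have -> : (theta (S v)^∨)^-1 * qdimL (S v) = (t v)^-1 * d v.
    apply: (mulfI t'_neq0); rewrite mulVKf //; apply: (mulfI (t_neq0 v)).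
    by rewrite -(theta_dual_qdim fusC (bS v)) mulrCA mulVKf.
  rewrite -mulrA (Smat_dual_qdim fusC irrS _ (bS v)).
  rewrite (twistV_sum fusC irrS) // -/(t w) -/(t v) mulrA.
  rewrite !mulrA mulr_sumr; apply: eq_bigr => u _; rewrite NE -/(t u) -/(d u).
  by field; rewrite !t_neq0.
rewrite (reindex_inj s_inj) /= (eq_bigl _ _ I1s) (eq_bigr _ (fun v _ => termE v)).
rewrite exchange_big /= /tau_minus mulr_suml [RHS]big_mkcond /=.
apply: eq_bigr => u _; rewrite -mulr_sumr.
(* Only [u] of degree 1 can occur in w ⊗ v, which restricts the sum to the index set of tau^-. *)
case: ifP => uI1; last first.
  rewrite big1 ?mulr0 // => v vI1; have [-> | nz] := eqVneq (N v u) 0%N; first by rewrite mul0r.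
  by rewrite -NE in nz; have := Ideg_mult wI1 vI1 nz; rewrite mulg1 uI1.
(* This is the right dimension of (S u)^∨ ⊗ S w, summed over its constituents, all of degree 1. *)
have -> : \sum_(v in I1) (N v u)%:R * d (s v) = qdimL (S u) * d w.
  rewrite -(qdimR_dual fusC irrS (bS u)) -(qdimR_tens uB) (qdimR_sum fusC irrS).
  rewrite [RHS](reindex_inj s_inj) /= big_mkcond; apply: eq_bigr => v _; case: ifP => // vI1.
  rewrite -/(N v u); have [-> | nz] := eqVneq (N v u) 0%N; first by rewrite mul0r.
  have [j [q qj]] := mult_retract (fusion_abelian fusC) (fusion_semisimple fusC) irrS nz.
  move/IdegP: uI1 => /(of_degree_dual fusC irrS (bS u)) du; move/IdegP: wI1 => dw.
  have := of_degree_retract qj (of_degree_tens du dw); rewrite invg1 mulg1 => /IdegP.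
  by rewrite I1s vI1.
by rewrite /t /d; ring.
Qed.

Lemma gauss_Smat g x y : x \in Ideg F S g^-1%g -> y \in Ideg F S g ->
  \sum_(v in I1) Smat (S x) (S v) * (t v)^-1 * Smat (S v) (S y) =
  tau_minus F S * (t x * t y * Smat (S x) (S y)).
Proof.
move=> xI yI; rewrite (twist_sum fusC irrS) //.
have termE v : Smat (S x) (S v) * (t v)^-1 * Smat (S v) (S y) =
    \sum_w (mult S (S x ⊗ S y) w)%:R * ((t v)^-1 * d v * Smat (S w) (S v)).
  rewrite (Smat_sym (S x)) mulrAC -(Smat_tens uB) // (Smat_sum fusC irrS) !mulr_suml.
  by apply: eq_bigr => w _; rewrite (Smat_sym (S v)) -/(d v); ring.
rewrite (eq_bigr _ (fun v _ => termE v)) exchange_big mulr_sumr; apply: eq_bigr => w _.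
rewrite -mulr_sumr.
have [-> | nz] := eqVneq (mult S (S x ⊗ S y) w) 0%N; first by rewrite !mul0r mulr0.
have := Ideg_mult xI yI nz; rewrite mulVg => /gauss_sum ->.
by rewrite mulrCA.
Qed.

Definition orbit j : {set I} :=
  [set i | `[< exists alpha, isomorphic (Xc alpha ⊗ S j) (S i) >]].

Lemma orbitP j i :
  reflect (exists alpha, isomorphic (Xc alpha ⊗ S j) (S i)) (i \in orbit j).
Proof. by rewrite inE; apply: asboolP. Qed.

Lemma Xchar_tensA alpha beta X :
  isomorphic (Xc alpha ⊗ (Xc beta ⊗ X)) (Xc (lc_mul alpha beta) ⊗ X).
Proof.
apply: (isomorphic_trans (Y := (Xc alpha ⊗ Xc beta) ⊗ X)).
  by exists (assocV (Xc alpha) (Xc beta) X); apply: iso_assocV.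
exact: tens_isomorphic (Xchar_tens _ _ _) (isomorphic_refl _).
Qed.

Lemma I1nP i : reflect (i \in I1 /\ trivial_stab F S i) (i \in I1n F S).
Proof.
rewrite [i \in I1n F S]inE; apply: (iffP andP) => -[iI ti]; split=> //; exact/asboolP.
Qed.

Lemma orbit_I1n j : j \in I1n F S -> orbit j \subset I1n F S.
Proof.
move=> /I1nP[/IdegP dj tj]; apply/fintype.subsetP => i /orbitP[alpha ji].
apply/I1nP; split.
  apply/IdegP; apply: of_degree_isomorphic ji _.
  exact: (of_degree_Xchar_tens fusC ffF).
move=> beta bi.
have : isomorphic (Xc (lc_mul (lc_mul (lc_inv alpha) beta) alpha) ⊗ S j) (S j).
  apply: isomorphic_trans (isomorphic_sym (Xchar_tensA _ _ _)) _.
  apply: isomorphic_trans (tens_isomorphic (isomorphic_refl _) ji) _.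
  apply: isomorphic_trans (isomorphic_sym (Xchar_tensA _ _ _)) _.
  apply: isomorphic_trans (tens_isomorphic (isomorphic_refl _) bi) _.
  apply: isomorphic_trans (tens_isomorphic (isomorphic_refl _) (isomorphic_sym ji)) _.
  by apply: tens_inverse_isomorphic; apply: Xchar_invV.
by move/tj => E g; have := E g; rewrite /= mulrAC mulVf ?lc_neq0 // mul1r.
Qed.

Variable a : A.
Hypothesis gen_a : generator [set: A] a.

(** With [w] a primitive root of unity of order #A, the characters sending [a] to w^r are all the
    characters. The trivial stabilizer makes their actions on [S j] pairwise non-isomorphic. *)
Lemma card_orbit j : j \in I1n F S -> #|orbit j| = #|A|.
Proof.
move=> /I1nP[_ tj]; have A0 : (0 < #|A|)%N by apply/card_gt0P; exists 1%g.
have [w w_prim] := closed_prim_root char0 A0.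
have w_neq0 : w != 0.
  apply/eqP => w0; have := prim_expr_order w_prim.
  by rewrite w0 expr0n gtn_eqF // => /eqP; rewrite eq_sym oner_eq0.
have /choice[chi chiP] (r : 'I_#|A|) : exists alpha : linchar k A, alpha a = w ^+ r.
  by apply: (ex_linchar gen_a); rewrite exprAC (prim_expr_order w_prim) expr1n.
have /choice[h hP] (r : 'I_#|A|) : exists v, isomorphic (Xc (chi r) ⊗ S j) (S v).
  apply: (brick_isomorphic (fusion_semisimple fusC) irrS).
  exact: Xchar_tens_brick (bS j).
have h_inj : injective h.
  move=> r s hrs; apply: val_inj.
  have : isomorphic (Xc (lc_mul (lc_inv (chi s)) (chi r)) ⊗ S j) (S j).
    apply: isomorphic_trans (isomorphic_sym (Xchar_tensA _ _ _)) _.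
    apply: isomorphic_trans (tens_isomorphic (isomorphic_refl _) (hP r)) _.
    rewrite hrs.
    apply: isomorphic_trans (tens_isomorphic (isomorphic_refl _) (isomorphic_sym (hP s))) _.
    by apply: tens_inverse_isomorphic; apply: Xchar_invV.
  move=> /tj /(_ a) /=; rewrite !chiP => /(congr1 ( *%R (w ^+ s))).
  rewrite mulrA mulfV ?expf_neq0 // mul1r mulr1 => /eqP.
  by rewrite (eq_prim_root_expr w_prim) !modn_small // => /eqP.
rewrite -[RHS]card_ord -(card_codom h_inj); apply: eq_card => i.
apply/orbitP/codomP => [[alpha ai]|[r ->]]; last by exists (chi r).
have [r rE] := prim_rootP w_prim (lc_root gen_a alpha); exists r.
have [_ injS _] := irrS; apply: injS; apply: isomorphic_trans (isomorphic_sym ai) _.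
apply: isomorphic_trans (hP r); apply: tens_isomorphic (isomorphic_refl _).
by apply: Xchar_ext; apply: (lc_eq gen_a); rewrite chiP.
Qed.

Lemma sum_orbits (R : {set I}) (f : I -> k) : orbit_reps F S (I1n F S) R ->
    (forall j i, j \in I1n F S -> i \in orbit j -> f i = f j) ->
  \sum_(i in I1n F S) f i = #|A|%:R * \sum_(j in R) f j.
Proof.
move=> [/fintype.subsetP sR repR] f_inv.
(* Each index lies in the orbit of exactly one representative, so the inner sum has a single term;
   the sums are then exchanged. *)
have -> : \sum_(i in I1n F S) f i =
    \sum_(i in I1n F S) \sum_(j in R | i \in orbit j) f j.
  apply: eq_bigr => i iI; have [j [[jR /orbitP ij] ju]] := repR i iI.
  rewrite (big_pred1 j) => [|j']; first by apply: f_inv (sR _ jR) ij.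
  apply/andP/eqP => [[j'R /orbitP ij']|->]; last by split.
  by rewrite (ju j').
rewrite (exchange_big_dep (mem R)) /= => [|i j _ /andP[] //].
rewrite mulr_sumr; apply: eq_bigr => j jR; have jI := sR _ jR.
rewrite (eq_bigl (mem (orbit j))) => [|i]; last first.
  rewrite jR /= -topredE /=; apply/andP/idP => [[]//|ij].
  by split=> //; apply: (fintype.subsetP (orbit_I1n jI)).
by rewrite sumr_const card_orbit // mulr_natl.
Qed.

(** A nontrivial alpha fixing [S i] has dimension 1, so S_{y,i} = alpha(a) S_{y,i}. If alpha(a) were
    1, alpha would be trivial, as [a] generates. *)
Lemma Smat_stab0 i y : y \in Ideg F S a -> i \in I1 -> i \notin I1n F S ->
  Smat (S y) (S i) = 0.
Proof.
move=> /IdegP dy iI iN.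
have [alpha [ai [g ag]]] : exists alpha, isomorphic (Xc alpha ⊗ S i) (S i) /\
    exists g, alpha g <> 1.
  apply: contrapT => N; case/I1nP: iN; split=> // alpha ai g.
  by apply: contrapT => ag; apply: N; exists alpha; split=> //; exists g.
have d1 : qdimR (Xc alpha) = 1.
  by apply: (mulIf (d_neq0 i)); rewrite -(qdimR_tens uB) (qdimR_isomorphic ai) mul1r.
have := Smat_Xchar_tens fusC irrS (S i) alpha (bS y) dy.
rewrite (Smat_isomorphic _ ai) d1 mulr1 => /eqP; rewrite -subr_eq0 -{1}[Smat _ _]mul1r.
rewrite -mulrBl mulf_eq0 subr_eq0 => /orP[/eqP a1|/eqP //].
case: ag; have [m ->] := genP gen_a g.
by rewrite lcX -a1 expr1n.
Qed.

End GaussSum.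

(** * The matrix identity, entry by entry *)

Theorem proposition2p8 (k : closedFieldType) (char0 : [pchar k] =i pred0)
    (C : bpcat k) (fusC : fusion C) (ndC : nondegenerate_cat C)
    (A : finGroupType) (a z : A) (gen_a : generator [set: A] a)
    (z2 : (z ^+ 2)%g = 1%g)
    (F : bpfunctor (rep_bpcat char0 (generator_abelian gen_a) z2) C)
    (ffF : fully_faithful F)
    (I : finType) (S : I -> C) (irrS : irr_reps S)
    (bar : I -> I) (barP : is_bar S bar)
    (R1 Ra : {set I}) (repR1 : orbit_reps F S (I1n F S) R1)
    (repRa : orbit_reps F S (Ideg F S a) Ra)
    (barRa : #|A| = 2%N -> bar @: Ra = Ra) :
  let RaV := bar @: Ra in
  Sblock S RaV R1 *m Tblock S R1 *m Sblock S R1 Ra =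
  (tau_minus F S / #|A|%:R) *:
    (invmx (Tblock S RaV) *m Sblock S RaV Ra *m invmx (Tblock S Ra)).
Proof.
move=> RaV.
have bS v : brick (S v) := Sbrick (fusion_abelian fusC) irrS v.
have t_neq0 v : theta (S v) != 0 := theta_neq0 (bS v).
have TV U : invmx (Tblock S U) = diag_mx (\row_i theta (S (enum_val i))).
  have E : Tblock S U *m diag_mx (\row_i theta (S (enum_val i))) = 1%:M.
    by rewrite mulmx_diag -diag_const_mx; congr diag_mx; apply/rowP => i; rewrite !mxE mulVf.
  have [uT _] := mulmx1_unit E.
  by rewrite -[RHS]mul1mx -(mulVmx uT) -mulmxA E mulmx1.
have A_neq0 : #|A|%:R != 0 :> k.
  by rewrite (pcharf0P k).1 // -lt0n; apply/card_gt0P; exists 1%g.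
apply/matrixP => i j; rewrite !TV.
rewrite mul_mx_diag mxE [RHS]mxE mul_mx_diag mul_diag_mx !mxE.
set x := enum_val i; set y := enum_val j.
have yI : y \in Ideg F S a.
  by case: repRa => /fintype.subsetP sRa _; apply/sRa/enum_valP.
have xI : x \in Ideg F S a^-1%g.
  have /imsetP[v vRa ->] : x \in RaV by apply: enum_valP.
  case: repRa => /fintype.subsetP /(_ _ vRa) /IdegP dv _; apply/IdegP.
  exact: (of_degree_bar fusC ffF irrS barP dv).
have /IdegP dx := xI; have /IdegP dy := yI.
pose f v := Smat (S x) (S v) * (theta (S v))^-1 * Smat (S v) (S y).
(* The factors alpha(a^-1) and alpha(a) from the opposite degrees of [x] and [y] cancel, and the
   dimension of X_alpha occurs squared. *)
have f_inv v u : v \in I1n F S -> u \in orbit F S v -> f u = f v.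
  move=> /I1nP[/IdegP dv _] /orbitP[alpha vu]; rewrite /f.
  rewrite -(theta_isomorphic (Xchar_tens_brick F alpha (bS v)) vu).
  rewrite (theta_Xchar_tens fusC ffF alpha (bS v) dv) (Smat_sym _ (S y)).
  rewrite -!(Smat_isomorphic _ vu) (Smat_sym (S v) (S y)).
  rewrite (Smat_Xchar_tens fusC irrS _ alpha (bS x) dx).
  rewrite (Smat_Xchar_tens fusC irrS _ alpha (bS y) dy).
  have E : alpha a^-1%g * alpha a = 1 by rewrite -lcM mulVg lc1.
  have D := qdimR_Xchar_sq fusC ffF irrS alpha.
  transitivity ((alpha a^-1%g * alpha a) *
     (qdimR (Xchar F alpha) * qdimR (Xchar F alpha)) *
     (Smat (S x) (S v) * (theta (S v))^-1 * Smat (S y) (S v))); first by ring.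
  by rewrite E D !mul1r.
have -> : \sum_l (\matrix_(i0, j0) (Sblock S RaV R1 i0 j0 *
    (\row_i1 (theta (S (enum_val i1)))^-1) 0 j0)) i l * Sblock S R1 Ra l j =
  \sum_(v in R1) f v.
  by rewrite [RHS]big_enum_val; apply: eq_bigr => l _; rewrite !mxE.
apply: (mulfI A_neq0); rewrite -(sum_orbits fusC ffF irrS gen_a repR1 f_inv).
(* The added indices have nontrivial stabilizers and contribute 0. *)
have -> : \sum_(v in I1n F S) f v = \sum_(v in Ideg F S 1%g) f v.
  rewrite big_mkcond [RHS]big_mkcond; apply: eq_bigr => v _; case: ifP => vN.
    by have /I1nP[-> _] := vN.
  case: ifP => // vI; rewrite /f (Smat_sym (S v)).
  by rewrite (Smat_stab0 fusC irrS gen_a yI vI) ?vN // mulr0.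
rewrite (gauss_Smat fusC irrS xI yI) /=.
by field.
Qed.
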